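(* Let $A=(A_1,A_2)$ be a pair of complex $n\times m$ matrices with $\ker A_1\cap\ker A_2=\{0\}$ and $\ker A_1^\dagger\cap\ker A_2^\dagger=\{0\}$. Let $(x_k,y_k)$ be the gradient-descent sequence in $P_n^1\times P_m^1$ given, with $L=2$, by $$(x_{k+1},y_{k+1}) = \exp_{x_k,y_k} \Bigl( - \frac{1}{L}\nabla f_A(x_k,y_k)\Bigr),\qquad (x_0,y_0) = (I,I).$$ Decompose $x_k = \sigma_k^{\dagger} e^{\mathrm{diag}(a^k)} \sigma_k$ and $y_k = \tau_k^{\dagger} e^{\mathrm{diag}(b^k)} \tau_k$, where $\sigma_k$ and $\tau_k$ are unitary matrices, and $a^k\in\mathbb{R}^n$ and $b^k\in\mathbb{R}^m$ are nondecreasing and nonincreasing vectors, respectively. Then $\sigma_k (sA_1+A_2) \tau_k^{\dagger}$ accumulates to coarse Kronecker triangular forms of $sA_1+A_2$ (every accumulation point is such a form), where the convergence is linear in the following sense: there are $c>0$, $M>0$ such that for all $k\ge M$ and $\ell\in\{1,2\}$, $$|(\sigma_k A_\ell\tau_k^\dagger)_{ij}|\le e^{-ck}\qquad((i,j)\in I_\alpha\times J_{\alpha'}:\ \alpha>\alpha').$$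
   Context: $n,m\ge1$; $\dagger$ is conjugate transpose; $s$ is an indeterminate; $gAh^\dagger:=(gA_1h^\dagger,gA_2h^\dagger)$; convergence of pencils means convergence of the two coefficient matrices. $P_n^1$ is the manifold of $n\times n$ positive definite Hermitian matrices of determinant one, with metric $\langle X,Y\rangle_x=\mathrm{tr}\,x^{-1}Xx^{-1}Y$ and exponential map $\exp_x(H)=x^{1/2}e^{x^{-1/2}Hx^{-1/2}}x^{1/2}$; $P_n^1\times P_m^1$ has the product metric, and $\exp_{x,y}$ acts componentwise. The Kempf–Ness function is $f_A(x,y):=\log\mathrm{tr}\sum_{\ell=1}^2 xA_\ell yA_\ell^\dagger$ on $P_n^1\times P_m^1$, with Riemannian gradient $\nabla f_A$. $\mathcal{S}_A$ is the set of pairs of subspaces $X\subseteq\mathbb{C}^n,Y\subseteq\mathbb{C}^m$ with $u^\top A_\ell\bar v=0$ for all $u\in X,v\in Y,\ell\in\{1,2\}$. $\phi(X,Y):=(\dim X,\dim Y)$. $\mathcal{E}_A$ is the set of $(X,Y)\in\mathcal{S}_A$ such that $\phi(X,Y)$ is an extreme point, other than $(0,0)$, of $\mathrm{Conv}\,\phi(\mathcal{S}_A)$. It is finite and can be arranged as $\mathcal{E}_A=\{(X_\alpha,Y_\alpha)\}_{\alpha=0}^\theta$ with $\mathbb{C}^n=X_0\supset\cdots\supset X_\theta=\{0\}$, $\{0\}=Y_0\subset\cdots\subset Y_\theta=\mathbb{C}^m$ (strict inclusions). A coarse DM-decomposition of $A$ is a pair $gAh^\dagger$ where $g\in GL_n(\mathbb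 C)$ has a basis of $X_\alpha$ as its last $\dim X_\alpha$ rows for every $\alpha$, and $h\in GL_m(\mathbb C)$ has a basis of $Y_\alpha$ as its first $\dim Y_\alpha$ rows for every $\alpha$; the corresponding pencil $g(sA_1+A_2)h^\dagger$ is called a coarse Kronecker triangular form. $I_\alpha\subseteq\{1,\ldots,n\}$ is the set of indices among the last $\dim X_{\alpha-1}$ but not among the last $\dim X_\alpha$; $J_\alpha\subseteq\{1,\ldots,m\}$ is the set of indices among the first $\dim Y_\alpha$ but not among the first $\dim Y_{\alpha-1}$ ($1\le\alpha\le\theta$). *)

(* Defs.v *)
From HB Require Import structures.
From mathcomp Require Import all_boot all_order all_algebra complex.
From mathcomp Require Import all_classical all_reals all_analysis.

Set Implicit Arguments.
Unset Strict Implicit.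
Unset Printing Implicit Defensive.

Import Order.TTheory GRing.Theory Num.Theory numFieldNormedType.Exports.

Local Open Scope classical_set_scope.
Local Open Scope ring_scope.
Local Open Scope sesquilinear_scope.

(* The detour through numClosedFieldType is what gives R[i], and matrices over
   it, the topology of the modulus. *)
Definition Cplx (R : realType) : numClosedFieldType := R[i]%C.

Definition toC (R : realType) (t : R) : Cplx R := t%:C%C.

(* A vector of C^n is stored as a row vector u, so that u^T A_l \bar v is
   u *m A l *m v^t*.  The pair (A_1, A_2) is A : 'I_2 -> 'M_(n, m). *)

Definition mxexp (R : realType) (n : nat) (H : 'M[Cplx R]_n) : 'M[Cplx R]_n :=
  lim (series (fun k : nat => (k`!%:R : Cplx R)^-1 *: H ^+ k) @ \oo).

(* x^{1/2} for x positive definite, by diagonalizing x in a unitary basis. *)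
Definition mxsqrt (R : realType) (n : nat) (x : 'M[Cplx R]_n) : 'M[Cplx R]_n :=
  (spectralmx x)^t* *m diag_mx (map_mx sqrtC (spectral_diag x)) *m spectralmx x.

(* The tangent space at x of the manifold of positive definite Hermitian
   matrices of determinant one. *)
Definition tangent (R : realType) (n : nat) (x : 'M[Cplx R]_n)
    : set 'M[Cplx R]_n :=
  [set H | H \is hermsymmx /\ \tr (invmx x *m H) = 0].

(* The trace is real for X, Y Hermitian and x positive definite. *)
Definition pd_inner (R : realType) (n : nat) (x X Y : 'M[Cplx R]_n) : R :=
  complex.Re (\tr (invmx x *m X *m invmx x *m Y)).

Definition pd_exp (R : realType) (n : nat) (x H : 'M[Cplx R]_n)
    : 'M[Cplx R]_n :=
  let r := mxsqrt x in r *m mxexp (invmx r *m H *m invmx r) *m r.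

(* The trace is real, and positive if A <> 0, for x, y positive definite. *)
Definition kempf_ness (R : realType) (n m : nat)
    (A : 'I_2 -> 'M[Cplx R]_(n, m)) (x : 'M[Cplx R]_n) (y : 'M[Cplx R]_m) : R :=
  ln (complex.Re (\tr (\sum_(l < 2) x *m A l *m y *m (A l)^t* ))).

(* G is tangent and <G, H> = df(H) for every tangent H, the differential being
   taken along the geodesic t |-> exp_{x,y}(t H). *)
Definition is_gradient (R : realType) (n m : nat)
    (f : 'M[Cplx R]_n -> 'M[Cplx R]_m -> R)
    (x : 'M[Cplx R]_n) (y : 'M[Cplx R]_m)
    (G : 'M[Cplx R]_n * 'M[Cplx R]_m) : Prop :=
  [/\ tangent x G.1, tangent y G.2 &
    forall H1 H2, tangent x H1 -> tangent y H2 ->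
      is_derive (0 : R) (1 : R)
        (fun t : R => f (pd_exp x (toC t *: H1)) (pd_exp y (toC t *: H2)))
        (pd_inner x G.1 H1 + pd_inner y G.2 H2)].

Definition gradient (R : realType) (n m : nat)
    (f : 'M[Cplx R]_n -> 'M[Cplx R]_m -> R)
    (x : 'M[Cplx R]_n) (y : 'M[Cplx R]_m) : 'M[Cplx R]_n * 'M[Cplx R]_m :=
  xget (0, 0) [set G | is_gradient f x y G].

Fixpoint grad_descent (R : realType) (n m : nat)
    (A : 'I_2 -> 'M[Cplx R]_(n, m)) (L : R) (k : nat)
    : 'M[Cplx R]_n * 'M[Cplx R]_m :=
  if k is k'.+1 then
    let xy := grad_descent A L k' in
    let G := gradient (kempf_ness A) xy.1 xy.2 in
    (pd_exp xy.1 (- (toC L)^-1 *: G.1), pd_exp xy.2 (- (toC L)^-1 *: G.2))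
  else (1%:M, 1%:M).

Definition isotropic_pairs (R : realType) (n m : nat)
    (A : 'I_2 -> 'M[Cplx R]_(n, m))
    : set ({vspace 'rV[Cplx R]_n} * {vspace 'rV[Cplx R]_m}) :=
  [set XY : {vspace 'rV[Cplx R]_n} * {vspace 'rV[Cplx R]_m} |
    forall u v l, u \in XY.1 -> v \in XY.2 -> u *m A l *m v^t* = 0].

Definition dim_pair (R : realType) (n m : nat)
    (XY : {vspace 'rV[Cplx R]_n} * {vspace 'rV[Cplx R]_m}) : R^o * R^o :=
  ((\dim XY.1)%:R, (\dim XY.2)%:R).

Definition conv_hull (R : realType) (E : lmodType R) (S : set E) : set E :=
  smallest (@convex_set R E) S.

Definition extreme_point (R : realType) (E : lmodType R) (S : set E) (p : E)
    : Prop :=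
  S p /\ forall (a b : E) (t : R), S a -> S b -> 0 < t < 1 ->
    p = t *: a + (1 - t) *: b -> a = p /\ b = p.

Definition extreme_pairs (R : realType) (n m : nat)
    (A : 'I_2 -> 'M[Cplx R]_(n, m))
    : set ({vspace 'rV[Cplx R]_n} * {vspace 'rV[Cplx R]_m}) :=
  [set XY | [/\ isotropic_pairs A XY, dim_pair XY <> (0, 0) &
    extreme_point (conv_hull (@dim_pair R n m @` isotropic_pairs A))
      (dim_pair XY)]].

(* Only the values of X and Y at 0, ..., theta matter. *)
Definition chain_arrangement (R : realType) (n m : nat)
    (A : 'I_2 -> 'M[Cplx R]_(n, m)) (theta : nat)
    (X : nat -> {vspace 'rV[Cplx R]_n})
    (Y : nat -> {vspace 'rV[Cplx R]_m}) : Prop :=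
  [/\ extreme_pairs A = [set (X a, Y a) | a in [set a | (a <= theta)%N]],
      X 0%N = fullv /\ X theta = 0%VS,
      Y 0%N = 0%VS /\ Y theta = fullv,
      forall a, (a < theta)%N -> (X a.+1 <= X a)%VS /\ X a.+1 <> X a &
      forall a, (a < theta)%N -> (Y a <= Y a.+1)%VS /\ Y a <> Y a.+1].

Definition among_first (n d : nat) (i : 'I_n) : bool := (i < d)%N.
Definition among_last (n d : nat) (i : 'I_n) : bool := (n - d <= i)%N.

Definition last_rows (R : realType) (n : nat) (g : 'M[Cplx R]_n) (d : nat)
    : seq 'rV[Cplx R]_n :=
  [seq row i g | i <- enum 'I_n & among_last d i].

Definition first_rows (R : realType) (n : nat) (h : 'M[Cplx R]_n) (d : nat)
    : seq 'rV[Cplx R]_n :=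
  [seq row j h | j <- enum 'I_n & among_first d j].

Definition pencil (R : realType) (n m : nat) (A : 'I_2 -> 'M[Cplx R]_(n, m))
    : 'M[{poly Cplx R}]_(n, m) :=
  'X *: map_mx polyC (A ord0) + map_mx polyC (A ord_max).

(* P is a coarse Kronecker triangular form of s A_1 + A_2. *)
Definition coarse_KTF (R : realType) (n m : nat)
    (A : 'I_2 -> 'M[Cplx R]_(n, m)) (theta : nat)
    (X : nat -> {vspace 'rV[Cplx R]_n}) (Y : nat -> {vspace 'rV[Cplx R]_m})
    (P : 'M[{poly Cplx R}]_(n, m)) : Prop :=
  exists (g : 'M[Cplx R]_n) (h : 'M[Cplx R]_m),
    [/\ g \in unitmx, h \in unitmx,
        forall a, (a <= theta)%N -> basis_of (X a) (last_rows g (\dim (X a))),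
        forall a, (a <= theta)%N -> basis_of (Y a) (first_rows h (\dim (Y a))) &
        P = map_mx polyC g *m pencil A *m map_mx polyC (h^t* )].

(* I_a and J_a, for 1 <= a <= theta. *)
Definition row_block (R : realType) (n : nat)
    (X : nat -> {vspace 'rV[Cplx R]_n}) (a : nat) : {set 'I_n} :=
  [set i | among_last (\dim (X a.-1)) i && ~~ among_last (\dim (X a)) i].

Definition col_block (R : realType) (m : nat)
    (Y : nat -> {vspace 'rV[Cplx R]_m}) (a : nat) : {set 'I_m} :=
  [set j | among_first (\dim (Y a)) j && ~~ among_first (\dim (Y a.-1)) j].

(* Main.v *)
(* With N_l = x^(1/2) A_l y^(1/2) and T = sum_l |N_l|^2, the gradient of the
   Kempf-Ness function f = log T is, in the frame of x^(1/2) and y^(1/2), the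
   pair of centred marginals sum_l N_l N_l^* / T - 1/n and
   sum_l N_l^* N_l / T - 1/m.

   One step with L = 2 has three features.  It decreases f by at least half the
   new squared gradient norm (convexity of f along the geodesic, and a
   2-Lipschitz gradient).  By Horn's inequalities for the spectrum of a product,
   the vector of log-eigenvalues (a, b) lengthens by at most half the gradient
   norm.  The sums of a and of b stay 0.

   On the combinatorial side, the extreme points give weights pv_1 > ... >
   pv_theta for the row blocks and C - pv_alpha for the column blocks, of total
   mass 1 on the rows and on the columns, such that an isotropic pair has total
   weight at most 1.  Compactness of the unitary groups and a north-west corner
   coupling then bound f from below by <p, a> + <q, b> + const, while testing
   the marginals against the flag of the X_alpha, Y_alpha bounds the gradient
   norm from below by kappa, kappa^2 = C - 1/n - 1/m.  The two bounds match: the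
   excesses |grad f| - kappa are square summable, (a^k, b^k) = (k/2) v + o(k)
   with v = (1/n - p, 1/m - q), and f <= const - kappa^2 k / 2.  Since
   |D_ij|^2 <= exp (f - a_i - b_j), the entry at blocks (alpha, alpha') with
   alpha > alpha' is at most exp (- k (pv_alpha' - pv_alpha) / 4 + o(k)) in
   modulus.  Accumulation points exist by compactness; their vanishing corners
   are isotropic pairs of extremal dimensions, and such pairs are the
   (X_alpha, Y_alpha). *)
Require Import Defs.
From HB Require Import structures.
From mathcomp Require Import all_boot all_order all_algebra all_fingroup complex.
From mathcomp Require Import all_classical all_reals all_analysis.
From mathcomp Require Import ring lra zify.
Set Implicit Arguments.
Unset Strict Implicit.
Unset Printing Implicit Defensive.
Import Order.TTheory GRing.Theory Num.Theory numFieldNormedType.Exports.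
Local Open Scope classical_set_scope.
Local Open Scope ring_scope.
Local Open Scope sesquilinear_scope.

Section RealCalculus.
Variable R : realType.

Lemma ler_is_derive_ge0 (f f' : R -> R) (a b : R) : a <= b ->
  (forall t : R, is_derive t (1 : R) f (f' t)) -> (forall t, 0 <= f' t) -> f a <= f b.
Proof.
move=> ab df f'0; have dv t : derivable f t 1 by have [] := df t.
apply: (@ger0_derive1_ndecr _ f a b) => //.
- by move=> t _; rewrite derive1E (@derive_val _ _ _ _ _ _ _ (df t)).
- apply: continuous_subspaceT => t; apply: differentiable_continuous.
  exact/derivable1_diffP.
Qed.

Lemma is_derive_bigsum (I : finType) (h : I -> R -> R) (t : R) (dh : I -> R) :
  (forall i, is_derive t (1 : R) (h i) (dh i)) ->
  is_derive t (1 : R) (fun u => \sum_i h i u) (\sum_i dh i).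
Proof.
move=> hd; rewrite [X in is_derive _ _ X _](_ : _ = \sum_i h i); last first.
  by apply/funext => u; rewrite fct_sumE.
rewrite big_enum_val [X in is_derive _ _ _ X]big_enum_val.
by apply: is_derive_sum => i; exact: hd.
Qed.

Lemma is_derive_expRM (c t : R) :
  is_derive t (1 : R) (fun u : R => expR (u * c)) (c * expR (t * c)).
Proof.
have dc : is_derive t (1 : R) (fun u : R => u * c) c.
  rewrite [X in is_derive _ _ X _](_ : _ = (id : R -> R) * cst c) //.
  apply: is_derive_eq. by rewrite scaler0 add0r -[_ *: _]/(_ * _) mulr1.
have := @is_derive1_comp R expR (fun u : R => u * c) t _ _ (is_derive_expR _) dc.
by rewrite mulrC.
Qed.

Lemma is_derive_quot (f g : R -> R) (f' g' t : R) : g t != 0 ->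
  is_derive t (1 : R) f f' -> is_derive t (1 : R) g g' ->
  is_derive t (1 : R) (fun u => f u / g u) ((f' * g t - f t * g') / g t ^+ 2).
Proof.
move=> g0 df dg; have dV := is_deriveV g0.
rewrite [X in is_derive _ _ X _](_ : _ = f * (fun u => (g u)^-1)); last first.
  by apply/funext.
apply: is_derive_eq; rewrite /= -![_ *: _]/(_ * _) -exprVn; field.
exact: g0.
Qed.

(* beta_k exp (- t z_k) are the weights |N_ij|^2 along the geodesic, z_k being
   the sum of the two eigenvalues of the gradient attached to the entry k, and
   q is the quadratic form of N |-> W1 N + N W2. *)
Section Gibbs.
Variables (I : finType) (z beta : I -> R) (q : I -> I -> R).

Definition gibbsT (t : R) : R := \sum_k beta k * expR (t * - z k).
Definition gibbsZ (t : R) : R := \sum_k z k * beta k * expR (t * - z k).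
Definition gibbsQ (t : R) : R :=
  \sum_k \sum_k' q k k' * expR (t * (- (z k + z k') / 2)).

Lemma gibbs_cov (s : R) :
  (forall k k', q k k' = q k' k) -> (forall t, 0 < gibbsT t) ->
  (forall t c : R,
    \sum_k \sum_k' (z k - c) * (q k k' * expR (t * (- (z k + z k') / 2))) <=
    2^-1 * (\sum_k (z k - c) ^+ 2 * (beta k * expR (t * - z k)))
    + s * gibbsT t) ->
  gibbsQ 0 / gibbsT 0 - gibbsQ 2^-1 / gibbsT 2^-1 <=
  2^-1 * (gibbsZ 0 / gibbsT 0 - gibbsZ 2^-1 / gibbsT 2^-1) + s / 2.
Proof.
move=> qC T0 hq.
pose Q1 t := \sum_k \sum_k' z k * (q k k' * expR (t * (- (z k + z k') / 2))).
pose Z2 t := \sum_k z k ^+ 2 * (beta k * expR (t * - z k)).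
have dT t : is_derive t (1 : R) gibbsT (- gibbsZ t).
  rewrite -sumrN; apply: is_derive_bigsum => k.
  have := is_deriveZ (beta k) (is_derive_expRM (- z k) t).
  by move/is_derive_eq; apply; rewrite -[_ *: _]/(_ * _) !mulNr mulrN; ring.
have dZ t : is_derive t (1 : R) gibbsZ (- Z2 t).
  rewrite -sumrN; apply: is_derive_bigsum => k.
  have := is_deriveZ (z k * beta k) (is_derive_expRM (- z k) t).
  by move/is_derive_eq; apply; rewrite -[_ *: _]/(_ * _); ring.
have dQ t : is_derive t (1 : R) gibbsQ (- Q1 t).
  have -> : - Q1 t = \sum_k \sum_k' - ((z k + z k') / 2) *
      (q k k' * expR (t * (- (z k + z k') / 2))).
    have : Q1 t = \sum_k \sum_k' z k' *
        (q k k' * expR (t * (- (z k + z k') / 2))).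
      rewrite /Q1 exchange_big; apply: eq_bigr => k _; apply: eq_bigr => k' _.
      by rewrite qC addrC.
    move=> Q1E; rewrite [in LHS](_ : Q1 t = (Q1 t + Q1 t) / 2); last by field.
    rewrite {2}Q1E -big_split -mulNr -sumrN mulr_suml; apply: eq_bigr => k _.
    rewrite -big_split -sumrN mulr_suml; apply: eq_bigr => k' _ /=.
    by field.
  apply: (@is_derive_bigsum _ (fun k u => \sum_k' q k k' *
    expR (u * (- (z k + z k') / 2)))) => k.
  apply: (@is_derive_bigsum _ (fun k' u => q k k' *
    expR (u * (- (z k + z k') / 2)))) => k'.
  have := is_deriveZ (q k k') (is_derive_expRM (- (z k + z k') / 2) t).
  by move/is_derive_eq; apply; rewrite -[_ *: _]/(_ * _); field.
pose h t := gibbsQ t / gibbsT t - 2^-1 * (gibbsZ t / gibbsT t) + t * s.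
pose h' t := (- Q1 t * gibbsT t - gibbsQ t * - gibbsZ t) / gibbsT t ^+ 2 -
  2^-1 * ((- Z2 t * gibbsT t - gibbsZ t * - gibbsZ t) / gibbsT t ^+ 2) + s.
have dh t : is_derive t (1 : R) h (h' t).
  have Tn0 : gibbsT t != 0 by rewrite gt_eqF.
  have d1 := is_derive_quot Tn0 (dQ t) (dT t).
  have d2 := is_deriveZ (2^-1) (is_derive_quot Tn0 (dZ t) (dT t)).
  have d3 : is_derive t (1 : R) (fun u : R => u * s) s.
    rewrite [X in is_derive _ _ X _](_ : _ = (id : R -> R) * cst s) //.
    by apply: is_derive_eq; rewrite scaler0 add0r -[_ *: _]/(_ * _) mulr1.
  exact: is_deriveD (is_deriveB d1 d2) d3.
have h'0 t : 0 <= h' t.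
  have Tp := T0 t; set c := gibbsZ t / gibbsT t.
  have := hq t c.
  have -> : \sum_k \sum_k' (z k - c) * (q k k' * expR (t * (- (z k + z k') / 2)))
      = Q1 t - c * gibbsQ t.
    rewrite /gibbsQ mulr_sumr -sumrB; apply: eq_bigr => k _.
    rewrite mulr_sumr -sumrB; apply: eq_bigr => k' _; ring.
  have -> : \sum_k (z k - c) ^+ 2 * (beta k * expR (t * - z k)) =
      Z2 t - 2 * c * gibbsZ t + c ^+ 2 * gibbsT t.
    rewrite /gibbsT /gibbsZ !mulr_sumr -sumrB -big_split.
    by apply: eq_bigr => k _ /=; ring.
  have -> : h' t = (2^-1 * (Z2 t - 2 * c * gibbsZ t + c ^+ 2 * gibbsT t)
      + s * gibbsT t - (Q1 t - c * gibbsQ t)) / gibbsT t.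
    by rewrite /h' /c; field; rewrite gt_eqF.
  by move=> H; apply: divr_ge0; [rewrite subr_ge0 | exact: ltW].
have h02 : (0 : R) <= 2^-1 by [].
have := ler_is_derive_ge0 h02 dh h'0; rewrite /h; lra.
Qed.

Lemma gibbs_jensen : (forall k, 0 <= beta k) -> 0 < gibbsT 2^-1 -> 0 < gibbsT 0 ->
  2^-1 * (gibbsZ 2^-1 / gibbsT 2^-1) <= ln (gibbsT 0) - ln (gibbsT 2^-1).
Proof.
move=> b0 Tp Tp0; set m := _ * _.
rewrite -ln_div ?posrE // -[leLHS]expRK ler_ln ?posrE ?expR_gt0 ?divr_gt0 //.
rewrite ler_pdivlMr //.
have -> : expR m * gibbsT 2^-1 = \sum_k beta k * expR (2^-1 * - z k) *
    (expR m * (1 + (z k / 2 - m))).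
  transitivity (expR m * (gibbsT 2^-1 + 2^-1 * gibbsZ 2^-1 - m * gibbsT 2^-1)).
    by rewrite /m; field; rewrite gt_eqF.
  rewrite /gibbsT /gibbsZ !mulr_sumr -big_split -sumrB mulr_sumr.
  by apply: eq_bigr => k _ /=; field.
apply: ler_sum => k _; rewrite mul0r expR0 mulr1.
rewrite -mulrA ler_piMr //.
set u := z k / 2 - m.
have -> : expR (2^-1 * - z k) * (expR m * (1 + u)) = (1 + u) / expR u.
  rewrite mulrA -expRD mulrC -expRN; congr (_ * expR _).
  by rewrite /u; field.
by rewrite ler_pdivrMr ?expR_gt0 // mul1r expR_ge1Dx.
Qed.

End Gibbs.
End RealCalculus.

(* Working over an abstract C keeps unification from unfolding R[i].  The
   definitions whose name starts with g copy those of Defs.v over such a C; they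
   are convertible to them at C = Cplx R. *)
Record cplxOver (R : realType) (C : numClosedFieldType) := CplxOver {
  cemb :> {rmorphism R -> C};
  cre : C -> R;
  creD : forall z w, cre (z + w) = cre z + cre w;
  cre_embM : forall t z, cre (cemb t * z) = t * cre z;
  cre1 : cre 1 = 1;
  cre_conj : forall z, cre z^* = cre z;
  cemb_re : forall z, z \is Num.real -> z = cemb (cre z);
  cemb_le : forall a b, (cemb a <= cemb b) = (a <= b) }.

Section Defs.
Variables (R : realType) (C : numClosedFieldType) (K : cplxOver R C).

Definition sqn (z : C) : R := cre K (z * z^* ).
Definition rip m n (M N : 'M[C]_(m, n)) : R := cre K (\tr (M *m N^t* )).
Definition rdiag n (a : 'rV[R]_n) : 'M[C]_n := diag_mx (map_mx (cemb K) a).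
Definition rexp n (a : 'rV[R]_n) : 'rV[R]_n := map_mx (@expR R) a.
Definition pdmx n (x : 'M[C]_n) := exists (U : 'M[C]_n) (a : 'rV[R]_n),
  U \is unitarymx /\ x = U^t* *m rdiag (rexp a) *m U.
End Defs.

(** * Complex matrices with real spectra *)

Section ComplexMatrices.
Variables (R : realType) (C : numClosedFieldType) (K : cplxOver R C).
Local Notation toC := (cemb K).
Local Notation Re := (cre K).

Lemma ReD (a b : C) : Re (a + b) = Re a + Re b.
Proof. exact: creD. Qed.

Lemma Re0 : Re 0 = 0.
Proof. by have /eqP := ReD 0 0; rewrite addr0 -subr_eq subrr => /eqP. Qed.

Lemma ReN (a : C) : Re (- a) = - Re a.
Proof. by apply/eqP; rewrite -subr_eq0 opprK -ReD addNr Re0. Qed.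

Lemma Re_sum I (r : seq I) P (F : I -> C) :
  Re (\sum_(i <- r | P i) F i) = \sum_(i <- r | P i) Re (F i).
Proof. by elim/big_rec2: _ => [|i x y _ <-]; rewrite ?Re0 ?ReD. Qed.

Lemma Re_toCM (t : R) (z : C) : Re (toC t * z) = t * Re z.
Proof. exact: cre_embM. Qed.

Lemma Re_toC (t : R) : Re (toC t) = t.
Proof. by rewrite -[toC t]mulr1 Re_toCM cre1 mulr1. Qed.

Lemma toC_le (a b : R) : (toC a <= toC b) = (a <= b).
Proof. exact: cemb_le. Qed.

Lemma toC_inj : injective toC.
Proof. exact: fmorph_inj. Qed.

Lemma toC_lt (a b : R) : (toC a < toC b) = (a < b).
Proof. by rewrite !lt_neqAle toC_le (inj_eq toC_inj). Qed.

Lemma toC_real (z : C) : z \is Num.real -> z = toC (Re z).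
Proof. exact: cemb_re. Qed.

Lemma toC_conj (t : R) : (toC t)^* = toC t.
Proof.
apply/CrealP; rewrite realE -(rmorph0 toC) !toC_le.
by have := le_total 0 t.
Qed.

Lemma mul_conj_sqn z : z * z^* = toC (sqn K z).
Proof. by apply/toC_real/ger0_real; exact: mul_conjC_ge0. Qed.

Lemma sqn_ge0 z : 0 <= sqn K z.
Proof. by rewrite -toC_le rmorph0 -mul_conj_sqn mul_conjC_ge0. Qed.

Lemma sqn_eq0 z : sqn K z = 0 -> z = 0.
Proof.
move=> z0; apply/eqP; rewrite -mul_conjC_eq0 mul_conj_sqn z0.
by rewrite rmorph0.
Qed.

Lemma sqn0 : sqn K 0 = 0.
Proof. by rewrite /sqn mul0r Re0. Qed.

Lemma sqnM z w : sqn K (z * w) = sqn K z * sqn K w.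
Proof.
by apply: toC_inj; rewrite rmorphM /= -!mul_conj_sqn rmorphM /= mulrACA.
Qed.

Lemma sqn_toC t : sqn K (toC t) = t ^+ 2.
Proof. by rewrite /sqn toC_conj -rmorphM Re_toC. Qed.

Lemma norm_sqn z : `|z| = toC (Num.sqrt (sqn K z)).
Proof.
apply/eqP; rewrite -(@eqrXn2 _ 2) // -?(rmorph0 toC) ?toC_le ?sqrtr_ge0 //.
by rewrite normCK mul_conj_sqn -rmorphXn /= sqr_sqrtr ?sqn_ge0.
Qed.

Lemma ctrmxM m n p (A : 'M[C]_(m, n)) (B : 'M[C]_(n, p)) :
  (A *m B)^t* = B^t* *m A^t*.
Proof. by rewrite trmx_mul map_mxM. Qed.

Lemma ctrmxD m n (A B : 'M[C]_(m, n)) : (A + B)^t* = A^t* + B^t*.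
Proof. by rewrite linearD map_mxD. Qed.

Lemma ctrmxN m n (A : 'M[C]_(m, n)) : (- A)^t* = - A^t*.
Proof. by rewrite linearN map_mxN. Qed.

Lemma ctrmxZ m n t (A : 'M[C]_(m, n)) : (toC t *: A)^t* = toC t *: A^t*.
Proof. by apply/matrixP => i j; rewrite !mxE rmorphM /= toC_conj. Qed.

Lemma ctrmx_sum m n I (r : seq I) P (F : I -> 'M[C]_(m, n)) :
  (\sum_(i <- r | P i) F i)^t* = \sum_(i <- r | P i) (F i)^t*.
Proof. by elim/big_rec2: _ => [|i x y _ <-]; rewrite ?trmx0 ?map_mx0 ?ctrmxD. Qed.

Lemma ctrmx1 n : (1%:M : 'M[C]_n)^t* = 1%:M.
Proof. by rewrite trmx1 map_mx1. Qed.

Lemma tr_ctrmx n (M : 'M[C]_n) : \tr (M^t*) = (\tr M)^*.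
Proof. by rewrite trace_map_mx mxtrace_tr. Qed.

Lemma Re_tr_adj n (M : 'M[C]_n) : Re (\tr (M^t*)) = Re (\tr M).
Proof. by rewrite tr_ctrmx cre_conj. Qed.

Lemma unitary_adjK n (U : 'M[C]_n) : U \is unitarymx -> U^t* *m U = 1%:M.
Proof. by move=> /unitarymxP; exact: mulmx1C. Qed.

Section Rip.
Variables m n : nat.
Implicit Types M N : 'M[C]_(m, n).

Lemma ripC M N : rip K M N = rip K N M.
Proof. by rewrite /rip -[in RHS]Re_tr_adj ctrmxM trmxCK. Qed.

Lemma ripDl M M' N : rip K (M + M') N = rip K M N + rip K M' N.
Proof. by rewrite /rip mulmxDl linearD ReD. Qed.

Lemma ripNl M N : rip K (- M) N = - rip K M N.
Proof. by rewrite /rip mulNmx linearN ReN. Qed.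

Lemma ripBl M M' N : rip K (M - M') N = rip K M N - rip K M' N.
Proof. by rewrite ripDl ripNl. Qed.

Lemma ripDr M N N' : rip K M (N + N') = rip K M N + rip K M N'.
Proof. by rewrite ripC ripDl !(ripC M). Qed.

Lemma ripNr M N : rip K M (- N) = - rip K M N.
Proof. by rewrite ripC ripNl (ripC M). Qed.

Lemma ripBr M N N' : rip K M (N - N') = rip K M N - rip K M N'.
Proof. by rewrite ripDr ripNr. Qed.

Lemma ripZl t M N : rip K (toC t *: M) N = t * rip K M N.
Proof. by rewrite /rip -scalemxAl linearZ /= Re_toCM. Qed.

Lemma ripZr t M N : rip K M (toC t *: N) = t * rip K M N.
Proof. by rewrite ripC ripZl (ripC M). Qed.

Lemma rip0l N : rip K 0 N = 0.
Proof. by rewrite /rip mul0mx linear0 Re0. Qed.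

Lemma rip0r M : rip K M 0 = 0.
Proof. by rewrite ripC rip0l. Qed.

Lemma rip_suml I (r : seq I) P (F : I -> 'M[C]_(m, n)) N :
  rip K (\sum_(i <- r | P i) F i) N = \sum_(i <- r | P i) rip K (F i) N.
Proof. by elim/big_rec2: _ => [|i x y _ <-]; rewrite ?rip0l ?ripDl. Qed.

Lemma rip_sumr I (r : seq I) P (F : I -> 'M[C]_(m, n)) N :
  rip K N (\sum_(i <- r | P i) F i) = \sum_(i <- r | P i) rip K N (F i).
Proof. by rewrite ripC rip_suml; apply: eq_bigr => i _; rewrite ripC. Qed.

Lemma ripE M N : rip K M N = \sum_i \sum_j Re (M i j * (N i j)^*).
Proof.
rewrite /rip /mxtrace Re_sum; apply: eq_bigr => i _.
by rewrite mxE Re_sum; apply: eq_bigr => j _; rewrite !mxE.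
Qed.

Lemma ripxx M : rip K M M = \sum_i \sum_j sqn K (M i j).
Proof.
rewrite ripE; apply: eq_bigr => i _; apply: eq_bigr => j _.
by [].
Qed.

Lemma rip_ge0 M : 0 <= rip K M M.
Proof. by rewrite ripxx; do 2![apply: sumr_ge0 => ? _]; exact: sqn_ge0. Qed.

Lemma rip_eq0 M : rip K M M = 0 -> M = 0.
Proof.
rewrite ripxx => /eqP; rewrite psumr_eq0 => [/allP M0|i _]; last first.
  by apply: sumr_ge0 => ? _; exact: sqn_ge0.
apply/matrixP => i j; rewrite mxE; apply: sqn_eq0.
have := M0 i; rewrite mem_index_enum => /(_ isT) /=.
rewrite psumr_eq0 => [/allP /(_ j)|? _]; last exact: sqn_ge0.
by rewrite mem_index_enum => /(_ isT) /eqP.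
Qed.

Lemma rip_amgm M N : rip K M N <= 2^-1 * rip K M M + 2^-1 * rip K N N.
Proof.
have := rip_ge0 (M - N); rewrite ripBl !ripBr (ripC N M).
move: (rip K M M) (rip K M N) (rip K N N) => a b c ?; lra.
Qed.

Lemma rip_amgmD M N : rip K (M + N) (M + N) <= 2 * (rip K M M + rip K N N).
Proof.
have := rip_amgm M N; rewrite ripDl !ripDr (ripC N M).
move: (rip K M M) (rip K M N) (rip K N N) => a b c ?; lra.
Qed.

End Rip.

Lemma rip_mull m n p (A : 'M[C]_(m, n)) (M : 'M[C]_(n, p)) (N : 'M[C]_(m, p)) :
  rip K (A *m M) N = rip K M (A^t* *m N).
Proof. by rewrite /rip ctrmxM trmxCK -mulmxA mxtrace_mulC mulmxA. Qed.

Lemma rip_mulr m n p (B : 'M[C]_(n, p)) (M : 'M[C]_(m, n)) (N : 'M[C]_(m, p)) :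
  rip K (M *m B) N = rip K M (N *m B^t*).
Proof. by rewrite /rip ctrmxM trmxCK -mulmxA. Qed.

Lemma rip_unitaryl m n (U : 'M[C]_m) (M N : 'M[C]_(m, n)) :
  U \is unitarymx -> rip K (U *m M) (U *m N) = rip K M N.
Proof. by move=> Uu; rewrite rip_mull mulmxA (unitary_adjK Uu) mul1mx. Qed.

Lemma rip_unitaryr m n (U : 'M[C]_n) (M N : 'M[C]_(m, n)) :
  U \is unitarymx -> rip K (M *m U) (N *m U) = rip K M N.
Proof. by move=> Uu; rewrite rip_mulr mulmxtVK. Qed.

Lemma rip_ctrmx m n (M N : 'M[C]_(m, n)) : rip K (M^t* ) (N^t* ) = rip K M N.
Proof. by rewrite /rip trmxCK mxtrace_mulC -/(rip K N M) ripC. Qed.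

Lemma rdiag_ctrmx n (a : 'rV[R]_n) : (rdiag K a)^t* = rdiag K a.
Proof.
rewrite tr_diag_mx map_diag_mx; congr diag_mx.
by apply/rowP => i; rewrite !mxE; exact: toC_conj.
Qed.

Lemma rdiagM n (a b : 'rV[R]_n) :
  rdiag K a *m rdiag K b = rdiag K (\row_i (a 0 i * b 0 i)).
Proof.
rewrite mulmx_diag; congr diag_mx; apply/rowP => i.
by rewrite !mxE rmorphM.
Qed.

Lemma rdiag_eq1 n (a : 'rV[R]_n) : (forall i, a 0 i = 1) -> rdiag K a = 1%:M.
Proof.
move=> a1; rewrite -diag_const_mx; congr diag_mx.
by apply/rowP => i; rewrite !mxE a1 rmorph1.
Qed.

Lemma rdiagE n (a : 'rV[R]_n) i j : rdiag K a i j = toC (a 0 i) *+ (i == j).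
Proof. by rewrite !mxE. Qed.

Lemma mul_rdiagE n m (a : 'rV[R]_n) (M : 'M[C]_(n, m)) i j :
  (rdiag K a *m M) i j = toC (a 0 i) * M i j.
Proof. by rewrite mul_diag_mx !mxE. Qed.

Lemma mulE_rdiag n m (a : 'rV[R]_n) (M : 'M[C]_(m, n)) i j :
  (M *m rdiag K a) i j = M i j * toC (a 0 j).
Proof. by rewrite mul_mx_diag !mxE. Qed.

Lemma hermsymP n (H : 'M[C]_n) : reflect (H^t* = H) (H \is hermsymmx).
Proof.
by apply: (iffP (is_hermitianmxP _ _ _)); rewrite expr0 scale1r => e; exact: esym.
Qed.

Lemma herm_spectral n (H : 'M[C]_n) : H^t* = H ->
  exists (U : 'M[C]_n) (a : 'rV[R]_n), U \is unitarymx /\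
    H = U^t* *m rdiag K a *m U.
Proof.
move=> /hermsymP Hh.
exists (spectralmx H), (map_mx Re (spectral_diag H)).
have Uu := spectral_unitarymx H; split=> //.
have e : spectral_diag H = map_mx toC (map_mx Re (spectral_diag H)).
  apply/rowP => i; rewrite !mxE; apply: toC_real.
  exact: (mxOverP (hermitian_spectral_diag_real Hh)).
rewrite /rdiag -e -(invmx_unitary Uu).
exact/orthomx_spectralP/hermitian_normalmx.
Qed.

End ComplexMatrices.

Section PositiveDefinite.
Variables (R : realType) (C : numClosedFieldType) (K : cplxOver R C).
Local Notation toC := (cemb K).
Local Notation Re := (cre K).

Definition gmxexp n (H : 'M[C]_n) : 'M[C]_n :=
  lim (series (fun k : nat => (k`!%:R : C)^-1 *: H ^+ k) @ \oo).

Definition gmxsqrt n (x : 'M[C]_n) : 'M[C]_n :=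
  (spectralmx x)^t* *m diag_mx (map_mx sqrtC (spectral_diag x)) *m spectralmx x.

Lemma cvg_mx_coord (T : Type) (F : set_system T) {FF : Filter F} m n
  (f : T -> 'M[C]_(m, n)) (M : 'M[C]_(m, n)) :
  (forall i j, (fun t => f t i j) @ F --> M i j) -> f @ F --> M.
Proof.
move=> FM A [P nP sPA]; apply: filterS (_ : (\forall t \near F, forall i j, P i j (f t i j))).
  by move=> k Pk; apply: sPA.
apply: filter_forall => i; apply: filter_forall => j; exact: FM (nP i j).
Qed.

Lemma toC_continuous : continuous toC.
Proof.
move=> t; apply/(cvgrPdist_lt (FF := nbhs_filter t)) => e e0.
have eE : e = toC (cre K e) by apply/toC_real/gtr0_real.
have e'0 : 0 < cre K e by rewrite -(toC_lt K) rmorph0 -eE.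
apply: filterS (nbhsx_ballx t _ e'0) => k; rewrite /ball /= => H.
by rewrite eE -rmorphB (norm_sqn K) sqn_toC sqrtr_sqr toC_lt.
Qed.

Lemma unitary_conjX n (U D : 'M[C]_n) k : U \is unitarymx ->
  (U^t* *m D *m U) ^+ k = U^t* *m D ^+ k *m U.
Proof.
move=> Uu; elim: k => [|k IH]; first by rewrite !expr0 mulmx1 unitary_adjK.
rewrite !exprS IH.
have e (X : 'M[C]_n) : (U^t* *m D *m U) *m (U^t* *m X *m U) = U^t* *m (D *m X) *m U.
  by rewrite !mulmxA (mulmxtVK _ Uu).
exact: e.
Qed.

Lemma rdiagX n (a : 'rV[R]_n) k : rdiag K a ^+ k = rdiag K (map_mx (fun t => t ^+ k) a).
Proof.
elim: k => [|k IH]; first by rewrite expr0 rdiag_eq1 // => i; rewrite mxE.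
rewrite exprS IH -mulmxE rdiagM; congr rdiag.
by apply/rowP => i; rewrite !mxE exprS.
Qed.

Lemma cvg_unitary_rdiag n (U : 'M[C]_n) (s : nat -> 'rV[R]_n) (b : 'rV[R]_n) :
  (forall l, (fun N => s N 0 l) @ \oo --> b 0 l) ->
  (fun N => U^t* *m rdiag K (s N) *m U) @ \oo --> U^t* *m rdiag K b *m U.
Proof.
move=> sb; apply: cvg_mx_coord => i j.
have E (c : 'rV[R]_n) : (U^t* *m rdiag K c *m U) i j =
    \sum_k (U k i)^* * toC (c 0 k) * U k j.
  by rewrite mxE; apply: eq_bigr => k _; rewrite mulE_rdiag !mxE.
rewrite (E b); under eq_fun => N do rewrite (E (s N)).
apply: (cvg_big (P := xpredT)); first exact: add_continuous.
move=> l _; apply: cvgM; last exact: cvg_cst.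
by apply: cvgM; [exact: cvg_cst | exact: (cvg_comp _ _ (sb _) (@toC_continuous _))].
Qed.

Lemma mxexpE n (U : 'M[C]_n) (a : 'rV[R]_n) : U \is unitarymx ->
  gmxexp (U^t* *m rdiag K a *m U) = U^t* *m rdiag K (rexp a) *m U.
Proof.
move=> Uu; apply: cvg_lim; first exact: norm_hausdorff.
have -> : series (fun k => (k`!%:R : C)^-1 *: (U^t* *m rdiag K a *m U) ^+ k) =
    (fun N => U^t* *m rdiag K (map_mx (fun t => series (exp_coeff t) N) a) *m U).
  apply/funext => N.
  have -> : rdiag K (map_mx (fun t => series (exp_coeff t) N) a) =
      \sum_(0 <= k < N) (k`!%:R : C)^-1 *: rdiag K a ^+ k.
    apply/matrixP => i j; rewrite rdiagE mxE summxE rmorph_sum -sumrMnl.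
    apply: eq_bigr => k _; rewrite rdiagX [RHS]mxE rdiagE mxE mulrnAr; congr (_ *+ _).
    by rewrite /exp_coeff rmorphM fmorphV rmorph_nat mulrC.
  rewrite mulmx_sumr mulmx_suml /series /=; apply: eq_bigr => k _.
  by rewrite unitary_conjX // -scalemxAr -scalemxAl.
apply: cvg_unitary_rdiag => l; rewrite mxE.
under eq_fun do rewrite mxE.
exact: is_cvg_series_exp_coeff.
Qed.

Lemma pdmx_ctrmx n (x : 'M[C]_n) : pdmx K x -> x^t* = x.
Proof.
by move=> [U [a [_ ->]]]; rewrite !ctrmxM rdiag_ctrmx trmxCK mulmxA.
Qed.

Lemma rip_rdiag m n (M : 'M[C]_(m, n)) (a : 'rV[R]_n) :
  rip K (M *m rdiag K a) M = \sum_i \sum_j a 0 j * sqn K (M i j).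
Proof.
rewrite ripE; apply: eq_bigr => i _; apply: eq_bigr => j _.
by rewrite mulE_rdiag mulrAC (mul_conj_sqn K) mulrC Re_toCM Re_toC mulrC.
Qed.

Lemma rip_conj_diag m n (M : 'M[C]_(m, n)) (U : 'M[C]_n) (a : 'rV[R]_n) :
  rip K (M *m (U^t* *m rdiag K a *m U)) M =
  \sum_i \sum_j a 0 j * sqn K ((M *m U^t* ) i j).
Proof. by rewrite !mulmxA rip_mulr rip_rdiag. Qed.

Lemma pdmx_pos m n (x : 'M[C]_n) (M : 'M[C]_(m, n)) : pdmx K x -> M != 0 ->
  0 < rip K (M *m x) M.
Proof.
move=> [U [a [Uu ->]]] M0; rewrite rip_conj_diag.
have ge0 i j : 0 <= rexp a 0 j * sqn K ((M *m U^t* ) i j).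
  by rewrite mulr_ge0 ?sqn_ge0 // mxE expR_ge0.
rewrite lt_neqAle sumr_ge0 ?andbT; last by move=> i _; exact: sumr_ge0.
apply: contra_neqN M0 => /eqP e.
have MU0 : M *m U^t* = 0.
  apply/matrixP => i j; rewrite [RHS]mxE; apply: sqn_eq0.
  have /eqP := esym e; rewrite psumr_eq0; last by move=> ? _; exact: sumr_ge0.
  move=> /allP /(_ i); rewrite mem_index_enum => /(_ isT) /=.
  rewrite psumr_eq0 // => /allP /(_ j); rewrite mem_index_enum => /(_ isT) /=.
  by rewrite mulf_eq0 mxE expR_eq0 => /eqP; exact.
by rewrite -[M](mulmxKtV _ Uu) // MU0 mul0mx.
Qed.

Lemma unitary_row_neq0 n (U : 'M[C]_n) i : U \is unitarymx -> row i U != 0.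
Proof.
move=> /unitarymxP Uu; apply: contra_eq_neq (Uu) => ri0.
apply/eqP => /matrixP /(_ i i); rewrite [RHS]mxE eqxx mxE big1 => [|j _].
  by move/eqP; rewrite eq_sym mulr1n oner_eq0.
by move/rowP : ri0 => /(_ j); rewrite !mxE => ->; rewrite mul0r.
Qed.

Lemma rip_row n (U : 'M[C]_n) (M : 'M[C]_n) i :
  rip K (row i U *m M) (row i U) = Re ((U *m M *m U^t* ) i i).
Proof.
rewrite /rip trace_mx11 -!row_mul; congr (Re _).
by rewrite !mxE; apply: eq_bigr => k _; rewrite !mxE.
Qed.

Lemma pdmx_spectral n (x U : 'M[C]_n) (d : 'rV[R]_n) :
  (forall v : 'rV_n, v != 0 -> 0 < rip K (v *m x) v) ->
  U \is unitarymx -> x = U^t* *m rdiag K d *m U ->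
  d = rexp (map_mx (@ln R) d).
Proof.
move=> xp Uu xE; apply/rowP => i; rewrite !mxE lnK // posrE.
have := xp _ (unitary_row_neq0 i Uu); rewrite rip_row xE !mulmxA.
by rewrite (unitarymxP Uu) mul1mx (mulmxtVK _ Uu) rdiagE eqxx mulr1n Re_toC.
Qed.

Lemma pdmxP n (x : 'M[C]_n) : x^t* = x ->
  (forall v : 'rV_n, v != 0 -> 0 < rip K (v *m x) v) -> pdmx K x.
Proof.
move=> /(herm_spectral K)[U [d [Uu xE]]] xp; exists U, (map_mx (@ln R) d).
split=> //; have e := pdmx_spectral xp Uu xE.
exact: etrans xE (congr1 (fun d => U^t* *m rdiag K d *m U) e).
Qed.

Lemma pdmx_congr m n (x : 'M[C]_n) (V : 'M[C]_(m, n)) : pdmx K x -> row_free V ->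
  pdmx K (V *m x *m V^t* ).
Proof.
move=> xp Vf; apply: pdmxP; first by rewrite !ctrmxM (pdmx_ctrmx xp) trmxCK mulmxA.
move=> v v0; rewrite !mulmxA rip_mulr trmxCK; apply: pdmx_pos => //.
by rewrite mulmx_free_eq0.
Qed.

Lemma pdmx_unit n (x : 'M[C]_n) : pdmx K x -> x \in unitmx.
Proof.
move=> [U [a [Uu ->]]]; rewrite !unitmx_mul (unitarymx_unit Uu).
rewrite unitarymx_unit ?trmxC_unitary // andbT /=.
have e : rdiag K (rexp a) *m rdiag K (rexp (- a)) = 1%:M.
  by rewrite rdiagM rdiag_eq1 // => i; rewrite !mxE expRN mulfV // expR_eq0.
exact: (mulmx1_unit e).1.
Qed.

Lemma mxsqrtP n (x : 'M[C]_n) : pdmx K x ->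
  pdmx K (gmxsqrt x) /\ gmxsqrt x *m gmxsqrt x = x.
Proof.
move=> xp; have xh := pdmx_ctrmx xp.
have Uu := spectral_unitarymx x; set U := spectralmx x in Uu.
have /hermsymP Hh := xh.
have dE : spectral_diag x = map_mx toC (map_mx Re (spectral_diag x)).
  apply/rowP => i; rewrite !mxE; apply: toC_real.
  exact: (mxOverP (hermitian_spectral_diag_real Hh)).
set d := map_mx Re (spectral_diag x) in dE.
have xE : x = U^t* *m rdiag K d *m U.
  rewrite /rdiag -dE -(invmx_unitary Uu).
  exact/orthomx_spectralP/hermitian_normalmx.
have de := pdmx_spectral (fun v => @pdmx_pos _ _ _ v xp) Uu xE.
set b := map_mx (@ln R) d in de.
have rE : gmxsqrt x = U^t* *m rdiag K (rexp (2^-1 *: b)) *m U.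
  have e : map_mx sqrtC (spectral_diag x) = map_mx toC (rexp (2^-1 *: b)).
    rewrite dE; apply/rowP => i; rewrite [LHS]mxE mxE [in RHS]mxE.
    rewrite [in RHS]mxE [X in expR X]mxE.
    rewrite -[RHS]sqrCK; last first.
      by rewrite -(rmorph0 toC) toC_le expR_ge0.
    rewrite -rmorphXn -expRM_natl; congr (sqrtC (toC _)).
    by rewrite mulrA mulfV // mul1r [in LHS]de !mxE.
  by rewrite /gmxsqrt e.
split; first by exists U, (2^-1 *: b).
rewrite rE !mulmxA (mulmxtVK _ Uu) -(mulmxA (U^t* )) rdiagM [RHS]xE [in RHS]de.
congr (_ *m rdiag K _ *m _); apply/rowP => i; rewrite !mxE -expRD.
by congr expR; field.
Qed.

End PositiveDefinite.

(** * The gradient of the Kempf-Ness function *)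

Section KempfNess.
Variables (R : realType) (C : numClosedFieldType) (K : cplxOver R C).

Definition gtangent n (x : 'M[C]_n) : set 'M[C]_n :=
  [set H | H \is hermsymmx /\ \tr (invmx x *m H) = 0].

Definition ginner n (x X Y : 'M[C]_n) : R :=
  cre K (\tr (invmx x *m X *m invmx x *m Y)).

Definition gpd_exp n (x H : 'M[C]_n) : 'M[C]_n :=
  let r := gmxsqrt x in r *m gmxexp (invmx r *m H *m invmx r) *m r.

Definition gtrace n m (A : 'I_2 -> 'M[C]_(n, m)) (x : 'M[C]_n) (y : 'M[C]_m) : R :=
  cre K (\tr (\sum_(l < 2) x *m A l *m y *m (A l)^t* )).

Definition gkn n m (A : 'I_2 -> 'M[C]_(n, m)) (x : 'M[C]_n) (y : 'M[C]_m) : R :=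
  ln (gtrace A x y).

Definition gis_gradient n m (f : 'M[C]_n -> 'M[C]_m -> R)
    (x : 'M[C]_n) (y : 'M[C]_m) (G : 'M[C]_n * 'M[C]_m) : Prop :=
  [/\ gtangent x G.1, gtangent y G.2 &
    forall H1 H2, gtangent x H1 -> gtangent y H2 ->
      is_derive (0 : R) (1 : R)
        (fun t : R => f (gpd_exp x (cemb K t *: H1)) (gpd_exp y (cemb K t *: H2)))
        (ginner x G.1 H1 + ginner y G.2 H2)].

Definition ggradient n m (f : 'M[C]_n -> 'M[C]_m -> R)
    (x : 'M[C]_n) (y : 'M[C]_m) : 'M[C]_n * 'M[C]_m :=
  xget (0, 0) [set G | gis_gradient f x y G].

Definition tnorm n m (N : 'I_2 -> 'M[C]_(n, m)) : R := \sum_l rip K (N l) (N l).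

Definition marg1 n m (N : 'I_2 -> 'M[C]_(n, m)) : 'M[C]_n :=
  cemb K (tnorm N)^-1 *: \sum_l N l *m (N l)^t*.

Definition marg2 n m (N : 'I_2 -> 'M[C]_(n, m)) : 'M[C]_m :=
  cemb K (tnorm N)^-1 *: \sum_l (N l)^t* *m N l.

Definition cent n (P : 'M[C]_n) : 'M[C]_n := P - cemb K (n%:R^-1) *: 1%:M.
End KempfNess.

Section Gradient.
Variables (R : realType) (C : numClosedFieldType) (K : cplxOver R C).
Variables (n m : nat).
Local Notation toC := (cemb K).
Local Notation Re := (cre K).
Implicit Types (N : 'I_2 -> 'M[C]_(n, m)).

Lemma gtrace_diag (A : 'I_2 -> 'M[C]_(n, m)) (E : 'M[C]_n) (F : 'M[C]_m)
    (a : 'rV[R]_n) (b : 'rV[R]_m) :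
  gtrace K A (E^t* *m rdiag K a *m E) (F^t* *m rdiag K b *m F) =
  \sum_l \sum_i \sum_j a 0 i * b 0 j * sqn K ((E *m A l *m F^t* ) i j).
Proof.
rewrite /gtrace raddf_sum Re_sum; apply: eq_bigr => l _ /=.
have -> : \tr (E^t* *m rdiag K a *m E *m A l *m (F^t* *m rdiag K b *m F) *m (A l)^t* )
    = \tr (rdiag K a *m (E *m A l *m F^t* ) *m rdiag K b *m (E *m A l *m F^t* )^t* ).
  rewrite -!mulmxA [LHS]mxtrace_mulC !ctrmxM trmxCK !mulmxA //.
rewrite -/(rip K _ _) ripE; apply: eq_bigr => i _; apply: eq_bigr => j _.
rewrite mulE_rdiag mul_rdiagE; set z := (E *m _ *m _) i j.
have -> : toC (a 0 i) * z * toC (b 0 j) * z^* =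
  toC (a 0 i) * (toC (b 0 j) * (z * z^* )) by ring.
by rewrite !Re_toCM mulrA.
Qed.

Lemma gtrace_conj (A : 'I_2 -> 'M[C]_(n, m)) (E : 'M[C]_n) (F : 'M[C]_m) :
  gtrace K A (E^t* *m E) (F^t* *m F) = tnorm K (fun l => E *m A l *m F^t* ).
Proof.
rewrite /gtrace raddf_sum Re_sum; apply: eq_bigr => l _ /=.
rewrite /rip; congr Re.
by rewrite -!mulmxA [LHS]mxtrace_mulC !ctrmxM trmxCK !mulmxA.
Qed.

Lemma tr_mulCadj p q (M : 'M[C]_(p, q)) : \tr (M *m M^t* ) = toC (rip K M M).
Proof.
apply: toC_real; rewrite /mxtrace sum_real // => i _; rewrite mxE.
by apply: sum_real => j _; rewrite !mxE; apply/ger0_real; exact: mul_conjC_ge0.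
Qed.

Lemma tr_marg1 N : tnorm K N != 0 -> \tr (marg1 K N) = 1.
Proof.
move=> T0; rewrite /marg1 mxtraceZ (raddf_sum (@mxtrace C _)) /=.
rewrite (eq_bigr (fun l => toC (rip K (N l) (N l)))) => [|l _]; last exact: tr_mulCadj.
by rewrite -rmorph_sum -rmorphM mulVf ?rmorph1.
Qed.

Lemma tr_marg2 N : tnorm K N != 0 -> \tr (marg2 K N) = 1.
Proof.
move=> T0; rewrite /marg2 mxtraceZ (raddf_sum (@mxtrace C _)) /=.
rewrite (eq_bigr (fun l => toC (rip K (N l) (N l)))) => [|l _]; last first.
  by rewrite mxtrace_mulC tr_mulCadj.
by rewrite -rmorph_sum -rmorphM mulVf ?rmorph1.
Qed.

Lemma marg1_adj N : (marg1 K N)^t* = marg1 K N.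
Proof.
rewrite /marg1 ctrmxZ ctrmx_sum; congr (_ *: _); apply: eq_bigr => l _.
by rewrite ctrmxM trmxCK.
Qed.

Lemma marg2_adj N : (marg2 K N)^t* = marg2 K N.
Proof.
rewrite /marg2 ctrmxZ ctrmx_sum; congr (_ *: _); apply: eq_bigr => l _.
by rewrite ctrmxM trmxCK.
Qed.

Lemma rip_marg N (W1 : 'M[C]_n) (W2 : 'M[C]_m) :
  rip K (marg1 K N) W1 + rip K (marg2 K N) W2 =
  (\sum_l rip K (N l) (W1 *m N l + N l *m W2)) / tnorm K N.
Proof.
rewrite !ripZl !rip_suml -mulrDr mulrC -big_split; congr (_ / _).
by apply: eq_bigr => l _; rewrite rip_mulr trmxCK rip_mull trmxCK ripDr.
Qed.

End Gradient.

Section Cent.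
Variables (R : realType) (C : numClosedFieldType) (K : cplxOver R C) (n : nat).
Local Notation toC := (cemb K).
Implicit Types P : 'M[C]_n.

Lemma cent_adj P : P^t* = P -> (cent K P)^t* = cent K P.
Proof. by move=> Ph; rewrite ctrmxD ctrmxN ctrmxZ Ph ctrmx1. Qed.

Lemma tr_cent P : (0 < n)%N -> \tr P = 1 -> \tr (cent K P) = 0.
Proof.
move=> n0 P1; rewrite linearB /= linearZ /= mxtrace1 P1 -(rmorph_nat toC) -rmorphM.
by rewrite mulVf ?rmorph1 ?subrr // pnatr_eq0 -lt0n.
Qed.

Lemma rip_cent P W : \tr W = 0 -> rip K (cent K P) W = rip K P W.
Proof.
move=> W0; rewrite ripBl ripZl [rip K 1%:M W]ripC [rip K W 1%:M]/rip ctrmx1 mulmx1 W0.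
by rewrite Re0 mulr0 subr0.
Qed.

End Cent.

Section GradientStep.
Variables (R : realType) (C : numClosedFieldType) (K : cplxOver R C).
Variables (n m : nat) (n0 : (0 < n)%N) (m0 : (0 < m)%N).
Local Notation toC := (cemb K).
Variable A : 'I_2 -> 'M[C]_(n, m).

Lemma inv_sqrt p (x : 'M[C]_p) : pdmx K x -> let r := gmxsqrt x in
  [/\ r \in unitmx, r^t* = r, r *m r = x, (invmx r)^t* = invmx r &
      invmx x = invmx r *m invmx r].
Proof.
move=> xp r; have [rp rr] := mxsqrtP xp.
have ru := pdmx_unit rp; have rh := pdmx_ctrmx rp; split=> //.
  apply: (row_full_inj (A := r)); rewrite ?row_full_unit //.
  by rewrite mulmxV // -[X in X *m _]rh -ctrmxM mulVmx // ctrmx1.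
apply: (row_full_inj (A := x)); rewrite ?row_full_unit ?(pdmx_unit xp) //.
rewrite mulmxV ?(pdmx_unit xp) // -rr.
by rewrite mulmxA -(mulmxA r) mulmxV // mulmx1 mulmxV.
Qed.

Lemma gtangentE p (x H : 'M[C]_p) : pdmx K x -> let r := gmxsqrt x in
  let H' := invmx r *m H *m invmx r in
  gtangent x H <-> H'^t* = H' /\ \tr H' = 0.
Proof.
move=> xp /=; have := inv_sqrt xp; rewrite /=.
move: (gmxsqrt x) => r [ru rh rr rih xi]; set H' := _ *m H *m _.
have trE : \tr (invmx x *m H) = \tr H'.
  by rewrite xi /H' [RHS]mxtrace_mulC mulmxA.
split=> [[/hermsymP Hh t0]|[Hh t0]].
  by rewrite -trE /H' !ctrmxM rih Hh mulmxA.
split; last by rewrite trE.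
apply/hermsymP; have -> : H = r *m H' *m r.
  by rewrite /H' -!mulmxA mulVmx // mulmx1 mulKVmx.
by rewrite ctrmxM ctrmxM Hh rh mulmxA.
Qed.

Lemma ginnerE p (x X Y : 'M[C]_p) : pdmx K x -> let r := gmxsqrt x in
  let Y' := invmx r *m Y *m invmx r in Y'^t* = Y' ->
  ginner K x X Y = rip K (invmx r *m X *m invmx r) Y'.
Proof.
move=> xp /=; have := inv_sqrt xp; rewrite /=.
move: (gmxsqrt x) => r [ru rh rr rih xi]; set Y' := _ *m Y *m _ => Yh.
rewrite /ginner /rip Yh /Y' xi; congr (cre K _).
by rewrite -!mulmxA [LHS]mxtrace_mulC !mulmxA.
Qed.

Lemma gpd_expE p (x H U : 'M[C]_p) (d : 'rV[R]_p) (t : R) :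
  let r := gmxsqrt x in U \is unitarymx ->
  invmx r *m H *m invmx r = U^t* *m rdiag K d *m U ->
  gpd_exp x (toC t *: H) = r *m (U^t* *m rdiag K (rexp (t *: d)) *m U) *m r.
Proof.
move=> r Uu HE; rewrite /gpd_exp -/r; congr (_ *m _ *m _).
rewrite -mxexpE // -scalemxAr -scalemxAl HE; congr gmxexp.
have -> : rdiag K (t *: d) = toC t *: rdiag K d.
  by apply/matrixP => i j; rewrite rdiagE [RHS]mxE rdiagE mxE rmorphM mulrnAr.
by rewrite -scalemxAr -scalemxAl.
Qed.

Lemma is_derive_gkn (x : 'M[C]_n) (y : 'M[C]_m) (H1 : 'M[C]_n) (H2 : 'M[C]_m) :
  pdmx K x -> pdmx K y -> gtangent x H1 -> gtangent y H2 ->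
  let r := gmxsqrt x in let s := gmxsqrt y in
  let N l := r *m A l *m s in 0 < tnorm K N ->
  is_derive (0 : R) (1 : R)
    (fun t : R => gkn K A (gpd_exp x (toC t *: H1)) (gpd_exp y (toC t *: H2)))
    (rip K (marg1 K N) (invmx r *m H1 *m invmx r) +
     rip K (marg2 K N) (invmx s *m H2 *m invmx s)).
Proof.
move=> xp yp /(gtangentE _ xp) [H1h _] /(gtangentE _ yp) [H2h _] r s N T0.
have [U [al [Uu H1E]]] := herm_spectral K H1h.
have [V [be [Vu H2E]]] := herm_spectral K H2h.
have Vu' : V^t* \is unitarymx by rewrite trmxC_unitary.
have [ru rh rr _ _] := inv_sqrt xp; have [su sh ss _ _] := inv_sqrt yp.
rewrite -/r -/s in ru rh rr su sh ss H1E H2E.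
pose w l i j := sqn K ((U *m N l *m V^t* ) i j).
pose T (t : R) := \sum_l \sum_i \sum_j w l i j * expR (t * (al 0 i + be 0 j)).
have TE t : gkn K A (gpd_exp x (toC t *: H1)) (gpd_exp y (toC t *: H2)) = ln (T t).
  rewrite (gpd_expE _ Uu H1E) (gpd_expE _ Vu H2E) -/r -/s.
  have -> : r *m (U^t* *m rdiag K (rexp (t *: al)) *m U) *m r =
    (U *m r)^t* *m rdiag K (rexp (t *: al)) *m (U *m r) by rewrite ctrmxM rh !mulmxA.
  have -> : s *m (V^t* *m rdiag K (rexp (t *: be)) *m V) *m s =
    (V *m s)^t* *m rdiag K (rexp (t *: be)) *m (V *m s) by rewrite ctrmxM sh !mulmxA.
  rewrite /gkn gtrace_diag; congr ln.
  apply: eq_bigr => l _; apply: eq_bigr => i _; apply: eq_bigr => j _.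
  have -> : U *m r *m A l *m (V *m s)^t* = U *m N l *m V^t*.
    by rewrite ctrmxM sh /N !mulmxA.
  by rewrite /rexp 4!mxE -expRD -mulrDr mulrC.
have T00 : T 0 = tnorm K N.
  rewrite /T /tnorm; apply: eq_bigr => l _.
  rewrite -(rip_unitaryl K _ _ Uu) -(rip_unitaryr K _ _ Vu').
  rewrite ripxx; apply: eq_bigr => i _; apply: eq_bigr => j _.
  by rewrite mul0r expR0 mulr1.
under eq_fun do rewrite TE.
pose T' := \sum_l \sum_i \sum_j (al 0 i + be 0 j) * w l i j.
have dT : is_derive (0 : R) (1 : R) T T'.
  rewrite /T /T'.
  apply: (@is_derive_bigsum _ _ (fun l u => \sum_i \sum_j w l i j * expR (u * (al 0 i + be 0 j)))) => l.
  apply: (@is_derive_bigsum _ _ (fun i u => \sum_j w l i j * expR (u * (al 0 i + be 0 j)))) => i.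
  apply: (@is_derive_bigsum _ _ (fun j u => w l i j * expR (u * (al 0 i + be 0 j)))) => j.
  have := is_deriveZ (w l i j) (is_derive_expRM (al 0 i + be 0 j) 0).
  move/is_derive_eq; apply.
  by rewrite mul0r expR0 mulr1 mulrC.
have T0p : 0 < T 0 by rewrite T00.
have := is_derive1_comp (is_derive1_ln T0p) dT.
move/is_derive_eq; apply.
rewrite rip_marg T00 mulrC; congr (_ / _).
rewrite /T'; apply: eq_bigr => l _; rewrite H1E H2E.
rewrite -(rip_unitaryl K _ _ Uu) -(rip_unitaryr K _ _ Vu').
set M := U *m N l *m V^t*.
have -> : U *m (U^t* *m rdiag K al *m U *m N l + N l *m (V^t* *m rdiag K be *m V)) *m V^t*
   = rdiag K al *m M + M *m rdiag K be.
  rewrite mulmxDr mulmxDl !mulmxA (unitarymxP Uu) mul1mx (mulmxtVK _ Vu).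
  by rewrite /M !mulmxA.
rewrite ripC ripE; apply: eq_bigr => i _; apply: eq_bigr => j _.
rewrite mxE mul_rdiagE mulE_rdiag [_ * toC _]mulrC -mulrDl -rmorphD -mulrA.
by rewrite Re_toCM.
Qed.

End GradientStep.

Section UnitaryInvariance.
Variables (R : realType) (C : numClosedFieldType) (K : cplxOver R C).
Variables (n m : nat).
Variables (N : 'I_2 -> 'M[C]_(n, m)) (U : 'M[C]_n) (V : 'M[C]_m).
Hypotheses (Uu : U \is unitarymx) (Vu : V \is unitarymx).

Lemma tnorm_unitary : tnorm K (fun l => U *m N l *m V^t* ) = tnorm K N.
Proof.
apply: eq_bigr => l _; rewrite -[in RHS](rip_unitaryl K _ _ Uu).
by rewrite [LHS]rip_unitaryr // trmxC_unitary.
Qed.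

Lemma marg1_unitary :
  marg1 K (fun l => U *m N l *m V^t* ) = U *m marg1 K N *m U^t*.
Proof.
rewrite /marg1 tnorm_unitary -scalemxAr -scalemxAl mulmx_sumr mulmx_suml.
congr (_ *: _); apply: eq_bigr => l _; rewrite !ctrmxM trmxCK !mulmxA.
by rewrite (mulmxKtV _ Vu).
Qed.

Lemma marg2_unitary :
  marg2 K (fun l => U *m N l *m V^t* ) = V *m marg2 K N *m V^t*.
Proof.
rewrite /marg2 tnorm_unitary -scalemxAr -scalemxAl mulmx_sumr mulmx_suml.
congr (_ *: _); apply: eq_bigr => l _; rewrite !ctrmxM trmxCK !mulmxA.
by rewrite (mulmxKtV _ Uu).
Qed.

Lemma cent_unitary p (W : 'M[C]_p) P : W \is unitarymx ->
  W *m cent K P *m W^t* = cent K (W *m P *m W^t* ).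
Proof.
move=> Wu; rewrite mulmxBr mulmxBl -scalemxAr mulmx1 -scalemxAl.
by rewrite (unitarymxP Wu).
Qed.

End UnitaryInvariance.

Section GradientStep.
Variables (R : realType) (C : numClosedFieldType) (K : cplxOver R C).
Variables (n m : nat) (n0 : (0 < n)%N) (m0 : (0 < m)%N).
Local Notation toC := (cemb K).
Variable A : 'I_2 -> 'M[C]_(n, m).

Lemma sandwichK p (r G : 'M[C]_p) : r \in unitmx ->
  invmx r *m (r *m G *m r) *m invmx r = G.
Proof. by move=> ru; rewrite -!mulmxA mulmxV // mulmx1 mulKmx. Qed.

Lemma gtangent0 p (x : 'M[C]_p) : gtangent x 0.
Proof.
by split; [apply/hermsymP; rewrite trmx0 map_mx0 | rewrite mulmx0 linear0].
Qed.

Lemma gtangentB p (x H H' : 'M[C]_p) :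
  gtangent x H -> gtangent x H' -> gtangent x (H - H').
Proof.
move=> [/hermsymP h t] [/hermsymP h' t']; split.
  by apply/hermsymP; rewrite ctrmxD ctrmxN h h'.
by rewrite mulmxBr linearB /= t t' subrr.
Qed.

Lemma ginner_eq p (x G G' : 'M[C]_p) : pdmx K x ->
  gtangent x G -> gtangent x G' ->
  ginner K x G (G - G') = ginner K x G' (G - G') -> G = G'.
Proof.
move=> xp tG tG' e; have tD := gtangentB tG tG'.
have [ru _ _ _ _] := inv_sqrt xp; have [Dh _] := (gtangentE _ xp).1 tD.
rewrite !(ginnerE _ xp Dh) in e.
have D0 : invmx (gmxsqrt x) *m (G - G') *m invmx (gmxsqrt x) = 0.
  apply: (rip_eq0 (K := K)); rewrite {1}mulmxBr mulmxBl ripBl.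
  by apply/eqP; rewrite subr_eq0; apply/eqP.
apply/eqP; rewrite -subr_eq0; apply/eqP.
apply: (row_full_inj (A := invmx (gmxsqrt x))).
  by rewrite row_full_unit unitmx_inv.
apply: (row_free_inj (A := invmx (gmxsqrt x))).
  by rewrite row_free_unit unitmx_inv.
by rewrite /= D0 mulmx0 mul0mx.
Qed.

Lemma is_derive_unique (f : R -> R) (t a b : R) :
  is_derive t (1 : R) f a -> is_derive t (1 : R) f b -> a = b.
Proof. by move=> /@derive_val <- /@derive_val <-. Qed.

Section AtPoint.
Variables (x : 'M[C]_n) (y : 'M[C]_m).
Hypotheses (xp : pdmx K x) (yp : pdmx K y).
Let r := gmxsqrt x.
Let s := gmxsqrt y.
Let N l := r *m A l *m s.
Hypothesis T0 : 0 < tnorm K N.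

Lemma ggradientE : ggradient K (gkn K A) x y =
  (r *m cent K (marg1 K N) *m r, s *m cent K (marg2 K N) *m s).
Proof.
have [ru rh rr _ _] := inv_sqrt xp; have [su sh ss _ _] := inv_sqrt yp.
rewrite -/r -/s in ru rh rr su sh ss.
set G := (_, _).
have Tn0 : tnorm K N != 0 by rewrite gt_eqF.
have t1 : gtangent x G.1.
  apply/(gtangentE _ xp); rewrite sandwichK //; split.
    by rewrite cent_adj // marg1_adj.
  by rewrite tr_cent // tr_marg1.
have t2 : gtangent y G.2.
  apply/(gtangentE _ yp); rewrite sandwichK //; split.
    by rewrite cent_adj // marg2_adj.
  by rewrite tr_cent // tr_marg2.
have GG : gis_gradient K (gkn K A) x y G.
  split=> // H1 H2 tH1 tH2.
  have [H1h H10] := (gtangentE _ xp).1 tH1; have [H2h H20] := (gtangentE _ yp).1 tH2.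
  rewrite (ginnerE _ xp H1h) (ginnerE _ yp H2h) !sandwichK // !rip_cent //.
  exact: is_derive_gkn.
apply: xget_unique => // -[G1 G2] [/= tG1 tG2 dG].
have [_ _ dG'] := GG.
have e1 := is_derive_unique (dG _ _ (gtangentB tG1 t1) (gtangent0 y))
  (dG' _ _ (gtangentB tG1 t1) (gtangent0 y)).
have e2 := is_derive_unique (dG _ _ (gtangent0 x) (gtangentB tG2 t2))
  (dG' _ _ (gtangent0 x) (gtangentB tG2 t2)).
rewrite /G; congr (_, _).
  apply: (ginner_eq xp tG1 t1); move: e1.
  by rewrite /ginner !mulmx0 linear0 Re0 !addr0.
apply: (ginner_eq yp tG2 t2); move: e2.
by rewrite /ginner !mulmx0 linear0 Re0 !add0r.
Qed.

Definition gstep (L : R) : 'M[C]_n * 'M[C]_m :=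
  let G := ggradient K (gkn K A) x y in
  (gpd_exp x (- (toC L)^-1 *: G.1), gpd_exp y (- (toC L)^-1 *: G.2)).

Lemma gstepP (L : R) : exists E F (al : 'rV[R]_n) (be : 'rV[R]_m),
  let N' l := E *m A l *m F^t* in
  [/\ [/\ x = E^t* *m E, y = F^t* *m F, E \in unitmx & F \in unitmx],
    cent K (marg1 K N') = rdiag K al, cent K (marg2 K N') = rdiag K be &
    gstep L = (E^t* *m rdiag K (rexp (- L^-1 *: al)) *m E,
               F^t* *m rdiag K (rexp (- L^-1 *: be)) *m F)].
Proof.
have [ru rh rr _ _] := inv_sqrt xp; have [su sh ss _ _] := inv_sqrt yp.
rewrite -/r -/s in ru rh rr su sh ss.
have [U [al [Uu H1E]]] := herm_spectral K (cent_adj K (marg1_adj K N)).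
have [V [be [Vu H2E]]] := herm_spectral K (cent_adj K (marg2_adj K N)).
exists (U *m r), (V *m s), al, be.
have NE l : U *m r *m A l *m (V *m s)^t* = U *m N l *m V^t*.
  by rewrite ctrmxM sh /N !mulmxA.
have N'E : (fun l => U *m r *m A l *m (V *m s)^t* ) = (fun l => U *m N l *m V^t* ).
  exact/funext/NE.
have m1 := marg1_unitary K N Uu Vu; have m2 := marg2_unitary K N Uu Vu.
have conjU p (W : 'M[C]_p) P d : W \is unitarymx -> P = W^t* *m d *m W ->
    W *m P *m W^t* = d.
  move=> Wu ->; rewrite !mulmxA (unitarymxP Wu) mul1mx.
  by rewrite (mulmxtVK _ Wu).
rewrite /=; split.
- split; last by rewrite unitmx_mul (unitarymx_unit Vu) su.
  + by rewrite ctrmxM rh mulmxA (mulmxKtV _ Uu).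
  + by rewrite ctrmxM sh mulmxA (mulmxKtV _ Vu).
  + by rewrite unitmx_mul (unitarymx_unit Uu) ru.
- by rewrite N'E m1 -cent_unitary // (conjU _ _ _ _ Uu H1E).
- by rewrite N'E m2 -cent_unitary // (conjU _ _ _ _ Vu H2E).
rewrite /gstep ggradientE /=.
have LE : - (toC L)^-1 = toC (- L^-1) by rewrite rmorphN /= fmorphV.
have h1 := sandwichK (cent K (marg1 K N)) ru.
have h2 := sandwichK (cent K (marg2 K N)) su.
rewrite LE (gpd_expE _ Uu (etrans h1 H1E)) (gpd_expE _ Vu (etrans h2 H2E)).
by rewrite (ctrmxM U r) (ctrmxM V s) rh sh !mulmxA.
Qed.

End AtPoint.
End GradientStep.

(** * The decrease of the value in one step *)

Section FrobeniusBounds.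
Variables (R : realType) (C : numClosedFieldType) (K : cplxOver R C).
Local Notation toC := (cemb K).

Lemma rip_mull_le n m (W : 'M[C]_n) (M : 'M[C]_(n, m)) : W^t* = W ->
  rip K (W *m M) (W *m M) <= rip K W W * rip K M M.
Proof.
move=> /(herm_spectral K)[U [d [Uu ->]]].
have Uu' : U^t* \is unitarymx by rewrite trmxC_unitary.
rewrite -!mulmxA !(rip_unitaryl K _ _ Uu') !mulmxA (rip_unitaryr K _ _ Uu).
rewrite -[rip K M M](rip_unitaryl K _ _ Uu) -mulmxA.
move: (U *m M) => {}M; rewrite [leLHS]ripxx [rip K M M]ripxx mulr_sumr.
apply: ler_sum => i _; rewrite mulr_sumr; apply: ler_sum => j _.
rewrite mul_rdiagE sqnM sqn_toC ler_wpM2r ?sqn_ge0 // ripxx.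
rewrite (bigD1 i) //= (bigD1 i) //= rdiagE eqxx mulr1n sqn_toC -addrA lerDl.
by rewrite addr_ge0 // !sumr_ge0 // => *; rewrite ?sumr_ge0 // => *; exact: sqn_ge0.
Qed.

Lemma rip_mulr_le n m (W : 'M[C]_m) (M : 'M[C]_(n, m)) : W^t* = W ->
  rip K (M *m W) (M *m W) <= rip K W W * rip K M M.
Proof.
move=> Wh; rewrite -(rip_ctrmx K (M *m W)) -(rip_ctrmx K M) ctrmxM Wh.
exact: rip_mull_le.
Qed.

End FrobeniusBounds.

Section StepInequality.
Variables (R : realType) (C : numClosedFieldType) (K : cplxOver R C).
Variables (n m : nat) (n0 : (0 < n)%N) (m0 : (0 < m)%N).
Local Notation toC := (cemb K).

Definition gdot (N N' : 'I_2 -> 'M[C]_(n, m)) : R :=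
  rip K (cent K (marg1 K N)) (cent K (marg1 K N')) +
  rip K (cent K (marg2 K N)) (cent K (marg2 K N')).

Variable N : 'I_2 -> 'M[C]_(n, m).
Local Notation I := ('I_2 * ('I_n * 'I_m))%type.

Definition wgt (w : I -> R) (l : 'I_2) : 'M[C]_(n, m) :=
  \matrix_(i, j) (toC (w (l, (i, j))) * N l i j).

Lemma big_I (F : I -> R) :
  \sum_k F k = \sum_l \sum_i \sum_j F (l, (i, j)).
Proof.
rewrite [RHS](eq_bigr (fun l => \sum_p F (l, (p.1, p.2)))); last first.
  by move=> l _; rewrite pair_bigA.
by rewrite pair_bigA; apply: eq_bigr => -[l [i j]].
Qed.

Lemma wgt_sum w l :
  wgt w l = \sum_k toC (w k) *: wgt (fun k' => (k' == k)%:R) l.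
Proof.
apply/matrixP => i j; rewrite mxE summxE (bigD1 (l, (i, j))) //= !mxE eqxx.
rewrite rmorph1 mul1r big1 ?addr0 // => k /negbTE kk; rewrite !mxE eq_sym kk.
by rewrite rmorph0 mul0r mulr0.
Qed.

Lemma tnorm_wgt w : tnorm K (wgt w) = \sum_k w k ^+ 2 * sqn K (N k.1 k.2.1 k.2.2).
Proof.
rewrite big_I; apply: eq_bigr => l _; rewrite ripxx.
by apply: eq_bigr => i _; apply: eq_bigr => j _; rewrite mxE sqnM sqn_toC.
Qed.

Section Act.
Variables (W1 : 'M[C]_n) (W2 : 'M[C]_m).
Hypotheses (W1h : W1^t* = W1) (W2h : W2^t* = W2).

Definition act (M : 'M[C]_(n, m)) := W1 *m M + M *m W2.

Lemma act_sum (w : I -> R) (F : I -> 'M[C]_(n, m)) :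
  act (\sum_k toC (w k) *: F k) = \sum_k toC (w k) *: act (F k).
Proof.
rewrite /act mulmx_sumr mulmx_suml -big_split; apply: eq_bigr => k _ /=.
by rewrite scalerDr -scalemxAr -scalemxAl.
Qed.

Lemma rip_act M M' : rip K M (act M') = rip K M' (act M).
Proof.
rewrite !ripDr ripC rip_mull W1h [X in _ + X]ripC rip_mulr W2h.
by [].
Qed.

Lemma rip_act_le M :
  rip K (act M) (act M) <= 2 * ((rip K W1 W1 + rip K W2 W2) * rip K M M).
Proof.
apply: le_trans (rip_amgmD _ _ _) _.
rewrite ler_wpM2l // mulrDl lerD //; first exact: rip_mull_le.
exact: rip_mulr_le.
Qed.

Definition actq (k k' : I) : R :=
  \sum_l rip K (wgt (fun h => (h == k)%:R) l) (act (wgt (fun h => (h == k')%:R) l)).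

Lemma actqC k k' : actq k k' = actq k' k.
Proof. by apply: eq_bigr => l _; rewrite rip_act. Qed.

Lemma actq_sum w w' : \sum_k \sum_k' w k * w' k' * actq k k' =
  \sum_l rip K (wgt w l) (act (wgt w' l)).
Proof.
have -> : \sum_l rip K (wgt w l) (act (wgt w' l)) = \sum_l \sum_k \sum_k'
   w k * w' k' * rip K (wgt (fun h => (h == k)%:R) l) (act (wgt (fun h => (h == k')%:R) l)).
  apply: eq_bigr => l _; rewrite wgt_sum (wgt_sum w') act_sum rip_suml.
  apply: eq_bigr => k _; rewrite rip_sumr; apply: eq_bigr => k' _.
  by rewrite ripZl ripZr mulrA.
rewrite [RHS]exchange_big; apply: eq_bigr => k _; rewrite [RHS]exchange_big.
by apply: eq_bigr => k' _; rewrite mulr_sumr.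
Qed.
End Act.

Variables (al : 'rV[R]_n) (be : 'rV[R]_m).
Hypothesis c1E : cent K (marg1 K N) = rdiag K al.
Hypothesis c2E : cent K (marg2 K N) = rdiag K be.
Hypothesis T0 : 0 < tnorm K N.

Let z (k : I) : R := al 0 k.2.1 + be 0 k.2.2.
Let beta (k : I) : R := sqn K (N k.1 k.2.1 k.2.2).

Definition flow (t : R) (l : 'I_2) : 'M[C]_(n, m) :=
  rdiag K (rexp (- (t / 2) *: al)) *m N l *m rdiag K (rexp (- (t / 2) *: be)).

Lemma flowE t l : flow t l = wgt (fun k => expR (- (t / 2) * z k)) l.
Proof.
apply/matrixP => i j; rewrite mulE_rdiag mul_rdiagE !mxE mulrDr expRD rmorphM.
by rewrite mulrAC.
Qed.

Lemma flow0 l : flow 0 l = N l.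
Proof.
rewrite flowE; apply/matrixP => i j.
by rewrite mxE mul0r oppr0 mul0r expR0 rmorph1 mul1r.
Qed.

Lemma gibbsT_flow t : gibbsT z beta t = tnorm K (flow t).
Proof.
transitivity (tnorm K (wgt (fun k => expR (- (t / 2) * z k)))); last first.
  by apply: eq_bigr => l _; rewrite flowE.
rewrite tnorm_wgt; apply: eq_bigr => k _; rewrite mulrC -expRM_natl /beta.
by congr (_ * _); congr expR; field.
Qed.

Lemma tnorm_flow_gt0 t : 0 < tnorm K (flow t).
Proof.
have ge0 M : 0 <= tnorm K (M : 'I_2 -> 'M[C]_(n, m)).
  by apply: sumr_ge0 => l _; exact: rip_ge0.
rewrite lt_neqAle ge0 andbT; apply: contraTneq T0 => /esym/eqP.
rewrite -gibbsT_flow psumr_eq0 => [/allP H|k _]; last first.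
  by rewrite mulr_ge0 ?expR_ge0 ?sqn_ge0.
suff -> : tnorm K N = 0 by rewrite ltxx.
have -> : tnorm K N = gibbsT z beta 0.
  by rewrite gibbsT_flow; apply: eq_bigr => l _; rewrite flow0.
rewrite /gibbsT big1 // => k _; have := H k; rewrite mem_index_enum => /(_ isT).
by rewrite mulf_eq0 expR_eq0 orbF => /eqP ->; rewrite mul0r.
Qed.

Lemma gibbsQ_flow W1 W2 t : gibbsQ z (actq W1 W2) t =
  \sum_l rip K (flow t l) (W1 *m flow t l + flow t l *m W2).
Proof.
rewrite (eq_bigr (fun l => rip K (wgt (fun k => expR (- (t / 2) * z k)) l)
  (act W1 W2 (wgt (fun k => expR (- (t / 2) * z k)) l)))); last first.
  by move=> l _; rewrite !flowE.
rewrite -actq_sum; apply: eq_bigr => k _; apply: eq_bigr => k' _.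
by rewrite mulrC -expRD; congr (_ * _); congr expR; field.
Qed.

Lemma gibbsZ_flow t : gibbsZ z beta t =
  \sum_l rip K (flow t l) (rdiag K al *m flow t l + flow t l *m rdiag K be).
Proof.
rewrite /gibbsZ big_I; apply: eq_bigr => l _; rewrite ripC ripE.
have := flowE t l; move: (flow t l) => F FE.
apply: eq_bigr => i _; apply: eq_bigr => j _.
rewrite mxE mul_rdiagE mulE_rdiag [_ * toC _]mulrC -mulrDl -rmorphD -[in RHS]mulrA /=.
rewrite Re_toCM -/(sqn K _) FE mxE sqnM sqn_toC -expRM_natl /z /beta /=.
rewrite -mulrA; congr (_ * _); rewrite mulrC; congr (expR _ * _).
by field.
Qed.

Lemma trc1 t : \tr (cent K (marg1 K (flow t))) = 0.
Proof. by rewrite tr_cent // tr_marg1 // gt_eqF ?tnorm_flow_gt0. Qed.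

Lemma trc2 t : \tr (cent K (marg2 K (flow t))) = 0.
Proof. by rewrite tr_cent // tr_marg2 // gt_eqF ?tnorm_flow_gt0. Qed.

Lemma gibbsZ_gdot t : gibbsZ z beta t / gibbsT z beta t = gdot (flow t) N.
Proof.
rewrite gibbsT_flow gibbsZ_flow -rip_marg /gdot c1E c2E.
have := trc1 0; have := trc2 0.
have -> : flow 0 = N by apply/funext => l; rewrite flow0.
by rewrite c1E c2E => t2 t1; rewrite !rip_cent.
Qed.

Lemma gibbsQ_gdot W1 W2 t : \tr W1 = 0 -> \tr W2 = 0 ->
  gibbsQ z (actq W1 W2) t / gibbsT z beta t =
  rip K (cent K (marg1 K (flow t))) W1 + rip K (cent K (marg2 K (flow t))) W2.
Proof.
move=> W1t W2t; rewrite (rip_cent _ _ W1t) (rip_cent _ _ W2t) rip_marg.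
by rewrite gibbsQ_flow gibbsT_flow.
Qed.

(* The first inequality is <g', g' - g> <= 0 for the gradients g, g' at the two
   ends of the step: gibbs_cov with W = g - g', whose constant is |g - g'|^2. *)
Lemma step_inequality :
  gdot (flow 2^-1) (flow 2^-1) <= gdot (flow 2^-1) N /\
  2^-1 * gdot (flow 2^-1) N <= ln (tnorm K N) - ln (tnorm K (flow 2^-1)).
Proof.
have f0 : flow 0 = N by apply/funext => l; rewrite flow0.
split; last first.
  have := @gibbs_jensen R _ z beta (fun k => sqn_ge0 _ _).
  rewrite gibbsZ_gdot !gibbsT_flow f0; apply => //; exact: tnorm_flow_gt0.
pose W1 := cent K (marg1 K N) - cent K (marg1 K (flow 2^-1)).
pose W2 := cent K (marg2 K N) - cent K (marg2 K (flow 2^-1)).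
have W1h : W1^t* = W1 by rewrite ctrmxD ctrmxN !cent_adj // ?marg1_adj.
have W2h : W2^t* = W2 by rewrite ctrmxD ctrmxN !cent_adj // ?marg2_adj.
have W1t : \tr W1 = 0.
  by have := trc1 0; rewrite f0 => t0; rewrite linearB /= t0 trc1 subrr.
have W2t : \tr W2 = 0.
  by have := trc2 0; rewrite f0 => t0; rewrite linearB /= t0 trc2 subrr.
have := @gibbs_cov R _ z beta (actq W1 W2) (rip K W1 W1 + rip K W2 W2).
have hq (t c : R) : \sum_k \sum_k' (z k - c) *
     (actq W1 W2 k k' * expR (t * (- (z k + z k') / 2))) <=
   2^-1 * (\sum_k (z k - c) ^+ 2 * (beta k * expR (t * - z k)))
   + (rip K W1 W1 + rip K W2 W2) * gibbsT z beta t.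
  pose w k := (z k - c) * expR (- (t / 2) * z k).
  pose w' k := expR (- (t / 2) * z k).
  have -> : \sum_k \sum_k' (z k - c) *
     (actq W1 W2 k k' * expR (t * (- (z k + z k') / 2))) =
     \sum_l rip K (wgt w l) (act W1 W2 (wgt w' l)).
    rewrite -actq_sum; apply: eq_bigr => k _; apply: eq_bigr => k' _.
    rewrite /w /w' -!mulrA; congr (_ * _); rewrite mulrC [RHS]mulrA -expRD.
    by congr (_ * _); congr expR; field.
  have -> : \sum_k (z k - c) ^+ 2 * (beta k * expR (t * - z k)) = tnorm K (wgt w).
    rewrite tnorm_wgt; apply: eq_bigr => k _; rewrite exprMn -expRM_natl.
    rewrite -[RHS]mulrA [beta k * _]mulrC; congr (_ * (_ * _)); congr expR.
    by field.
  have -> : gibbsT z beta t = tnorm K (wgt w').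
    by rewrite gibbsT_flow; apply: eq_bigr => l _; rewrite flowE.
  rewrite /tnorm !mulr_sumr -big_split; apply: ler_sum => l _ /=.
  apply: le_trans (rip_amgm _ _ _) _; rewrite lerD2l.
  by rewrite ler_pdivrMl // rip_act_le.
move=> /(_ (actqC W1h W2h) _ hq).
have T0' t : 0 < gibbsT z beta t by rewrite gibbsT_flow tnorm_flow_gt0.
move=> /(_ T0').
rewrite (gibbsZ_gdot 0) (gibbsZ_gdot 2^-1) (gibbsQ_gdot 0 W1t W2t).
rewrite (gibbsQ_gdot 2^-1 W1t W2t) f0.
rewrite /gdot /W1 /W2.
move: (cent K (marg1 K N)) (cent K (marg1 K (flow 2^-1))) => G1 G1'.
move: (cent K (marg2 K N)) (cent K (marg2 K (flow 2^-1))) => G2 G2'.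
rewrite !ripBr !ripBl (ripC K G1 G1') (ripC K G2 G2').
move: (rip K G1 G1) (rip K G1' G1) (rip K G1' G1') => a1 b1 d1.
move: (rip K G2 G2) (rip K G2' G2) (rip K G2' G2') => a2 b2 d2.
lra.
Qed.

End StepInequality.

(** * Horn inequalities *)

Section Abel.
Variable R : realType.

Lemma abel_le (w c : nat -> R) n :
  (forall i, (i.+1 < n)%N -> w i.+1 <= w i) ->
  (forall d, (d <= n)%N -> \sum_(i < d) c i <= 0) ->
  \sum_(i < n) w i * c i <= w n.-1 * \sum_(i < n) c i.
Proof.
elim: n => [|n IH] hw hc; first by rewrite !big_ord0 mulr0.
rewrite !big_ord_recr /=.
have {}IH : \sum_(i < n) w i * c i <= w n.-1 * \sum_(i < n) c i.
  apply: IH => [i lin|d ld]; first by apply: hw; rewrite ltnW.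
  by apply: hc; rewrite leqW.
case: n => [|n] in hw hc IH *; first by rewrite !big_ord0 !add0r.
rewrite /= in IH; rewrite mulrDr lerD2r; apply: le_trans IH _.
by apply: ler_wnM2r; [exact: hc | exact: hw].
Qed.
End Abel.

Section Interlacing.
Variables (R : realType) (C : numClosedFieldType) (K : cplxOver R C).
Local Notation toC := (cemb K).

Definition nonincr n (a : 'rV[R]_n) := forall i j : 'I_n, (i <= j)%N -> a 0 j <= a 0 i.

Lemma sort_row n (a : 'rV[R]_n) : exists s : {perm 'I_n}, nonincr (\row_i a 0 (s i)).
Proof.
pose t := [tuple a 0 i | i < n].
pose u := [tuple of sort (fun x y : R => y <= x) t].
have /tuple_permP[s us] : perm_eq u t by rewrite perm_sort.
exists s => i j ij; rewrite !mxE.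
have E k : a 0 (s k) = tnth u k.
  have -> : u = [tuple tnth t (s k) | k < n] by exact: val_inj.
  by rewrite !tnth_mktuple.
rewrite !E !(tnth_nth 0).
have us' : sorted (fun x y : R => y <= x) (u : seq R) by apply: sort_sorted => x y; exact: le_total.
have := sorted_leq_nth (leT := fun x y : R => y <= x) _ _ 0 us' => /(_ _ _ i j) H; apply: H => //.
- by move=> x y z /= yx xz; exact: le_trans xz yx.
- by have := ltn_ord i; rewrite -[X in (_ < X)%N](size_tuple u).
- by have := ltn_ord j; rewrite -[X in (_ < X)%N](size_tuple u).
Qed.

Lemma perm_rdiag n (a : 'rV[R]_n) (s : {perm 'I_n}) :
  let Q := perm_mx s : 'M[C]_n in Q \is unitarymx /\
  rdiag K a = Q^t* *m rdiag K (\row_i a 0 (s i)) *m Q.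
Proof.
move=> Q.
have Qct : Q^t* = perm_mx (s^-1)%g.
  by rewrite tr_perm_mx; apply/matrixP => i j; rewrite !mxE conjC_nat.
have Qu : Q \is unitarymx.
  by apply/unitarymxP; rewrite Qct -perm_mxM mulgV perm_mx1.
split=> //; rewrite -mulmxA.
have <- : Q *m rdiag K a = rdiag K (\row_i a 0 (s i)) *m Q.
  apply/matrixP => i j; rewrite mulE_rdiag mul_rdiagE !mxE.
  by case: eqP => [->|_]; rewrite ?mulr0 ?mul0r // mul1r mulr1.
by rewrite mulmxA unitary_adjK // mul1mx.
Qed.

Lemma spectral_sorted n (x : 'M[C]_n) : pdmx K x -> exists U (a : 'rV[R]_n),
  [/\ U \is unitarymx, nonincr a & x = U^t* *m rdiag K (rexp a) *m U].
Proof.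
move=> [U [a [Uu ->]]]; have [s sa] := sort_row a.
have [Qu aE] := perm_rdiag (rexp a) s.
exists (perm_mx s *m U), (\row_i a 0 (s i)); split=> //.
  exact: mul_unitarymx.
rewrite {1}aE ctrmxM !mulmxA; congr (_ *m _ *m _ *m _); congr rdiag.
by apply/rowP => i; rewrite !mxE.
Qed.

Lemma singular_col0 n (Z : 'M[C]_n) (i : 'I_n) : (forall p, Z p i = 0) ->
  exists2 u : 'rV[C]_n, u != 0 & u *m Z = 0.
Proof.
move=> Zi; have : kermx Z != 0.
  rewrite kermx_eq0; apply/negP; rewrite row_free_unit => Zu.
  have : Z *m delta_mx i (0 : 'I_1) = 0.
    apply/matrixP => p k; rewrite !mxE big1 // => j _; rewrite mxE.
    by case: eqP => [->|_]; rewrite ?Zi ?mul0r ?mulr0.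
  move/(congr1 (mulmx (invmx Z))); rewrite mulKmx // mulmx0.
  by move/matrixP => /(_ i 0); rewrite !mxE !eqxx => /eqP; rewrite oner_eq0.
by case/rowV0Pn => u /sub_kermxP uZ u0; exists u.
Qed.

Lemma interlacing d n (le_dn : (d <= n)%N) (W : 'M[C]_(d, n)) (de : 'rV[R]_n)
    (Q : 'M[C]_d) (nu : 'rV[R]_d) :
  W \is unitarymx -> Q \is unitarymx -> nonincr de -> nonincr nu ->
  W *m rdiag K de *m W^t* = Q^t* *m rdiag K nu *m Q ->
  forall i, nu 0 i <= de 0 (widen_ord le_dn i).
Proof.
move=> Wu Qu de_ni nu_ni WQ i; pose M := Q *m W.
have Mu : M \is unitarymx by exact: mul_unitarymx.
(* u Z = 0 says that u is supported on its first i + 1 coordinates and that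
   u M vanishes on its first i ones. *)
pose Z : 'M[C]_d := \matrix_(p, k) if (k < i)%N then M p (widen_ord le_dn k)
  else if k == i then 0 else (p == k)%:R.
have [p|u u0 uZ] := @singular_col0 _ Z i; first by rewrite mxE ltnn eqxx.
have u_gt (p : 'I_d) : (i < p)%N -> u 0 p = 0.
  move=> ip; move/matrixP : uZ => /(_ 0 p); rewrite !mxE => <-.
  rewrite (bigD1 p) //= mxE ltnNge ltnW // -val_eqE /= gtn_eqF // eqxx mulr1.
  rewrite big1 ?addr0 // => q /negbTE qp.
  by rewrite mxE ltnNge ltnW // -val_eqE /= gtn_eqF // qp mulr0.
have uM_lt (k : 'I_n) : (k < i)%N -> (u *m M) 0 k = 0.
  move=> ki; have kd : (k < d)%N := ltn_trans ki (ltn_ord i).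
  move/matrixP : uZ => /(_ 0 (Ordinal kd)); rewrite [LHS]mxE [RHS]mxE => uZk.
  rewrite [LHS]mxE -[RHS]uZk; apply: eq_bigr => p _.
  rewrite [Z _ _]mxE /= ki; congr (_ * M p _).
  exact: val_inj.
have nuM : rdiag K nu = M *m rdiag K de *m M^t*.
  rewrite /M ctrmxM !mulmxA -(mulmxA Q) -(mulmxA Q) WQ !mulmxA.
  by rewrite (unitarymxP Qu) mul1mx (mulmxtVK _ Qu).
clear uZ; clearbody M.
have upos : 0 < rip K u u.
  rewrite lt_neqAle rip_ge0 andbT eq_sym; apply: contra_neq u0; exact: rip_eq0.
rewrite -(ler_pM2r upos).
have h1 : nu 0 i * rip K u u <= rip K (u *m rdiag K nu) u.
  rewrite rip_rdiag ripxx mulr_sumr ler_sum // => r _; rewrite ord1 mulr_sumr.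
  apply: ler_sum => p _; have [ip|pi] := ltnP i p; first by rewrite u_gt // sqn0 !mulr0.
  by apply: ler_wpM2r; [exact: sqn_ge0 | exact: nu_ni].
apply: le_trans h1 _.
have -> : rip K (u *m rdiag K nu) u = rip K (u *m M *m rdiag K de) (u *m M).
  by rewrite nuM !mulmxA [LHS]rip_mulr trmxCK.
have -> : rip K u u = rip K (u *m M) (u *m M).
  by rewrite rip_mulr (mulmxtVK _ Mu).
rewrite rip_rdiag ripxx mulr_sumr ler_sum // => r _; rewrite ord1 mulr_sumr.
apply: ler_sum => k _; have [ki|ik] := ltnP k i; first by rewrite uM_lt // sqn0 !mulr0.
by apply: ler_wpM2r; [exact: sqn_ge0 | exact: de_ni].
Qed.

Lemma det_rdiag_exp n (a : 'rV[R]_n) :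
  \det (rdiag K (rexp a)) = toC (expR (\sum_i a 0 i)).
Proof.
rewrite det_diag expR_sum rmorph_prod; apply: eq_bigr => i _.
by rewrite !mxE.
Qed.

Lemma det_unitary_conj n (U D : 'M[C]_n) : U \is unitarymx ->
  \det (U^t* *m D *m U) = \det D.
Proof.
move=> /unitary_adjK Uu; rewrite !det_mulmx mulrAC -det_mulmx Uu det1.
by rewrite mul1r.
Qed.

Lemma det_compress d n (le_dn : (d <= n)%N) (W : 'M[C]_(d, n)) (de : 'rV[R]_n) :
  W \is unitarymx -> nonincr de ->
  exists2 t, \det (W *m rdiag K (rexp de) *m W^t* ) = toC (expR t) &
    t <= \sum_(i < d) de 0 (widen_ord le_dn i).
Proof.
move=> Wu de_ni.
have dp : pdmx K (rdiag K (rexp de)).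
  exists 1%:M, de; rewrite ctrmx1 mul1mx mulmx1; split=> //.
  by apply/unitarymxP; rewrite ctrmx1 mulmx1.
have Wf : row_free W by rewrite /row_free mxrank_unitary.
have [Q [nu [Qu nu_ni WE]]] := spectral_sorted (pdmx_congr dp Wf).
exists (\sum_i nu 0 i); first by rewrite WE det_unitary_conj // det_rdiag_exp.
apply: ler_sum => i _; rewrite -ler_expR.
have de_ni' : nonincr (rexp de) by move=> j k jk; rewrite !mxE ler_expR de_ni.
have nu_ni' : nonincr (rexp nu) by move=> j k jk; rewrite !mxE ler_expR nu_ni.
by have := interlacing le_dn Wu Qu de_ni' nu_ni' WE i; rewrite !mxE.
Qed.

End Interlacing.

Section Horn.
Variables (R : realType) (C : numClosedFieldType) (K : cplxOver R C).
Local Notation toC := (cemb K).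

Section OneStep.
Variables (n : nat) (U U' E : 'M[C]_n) (a a' de : 'rV[R]_n).
Hypotheses (Uu : U \is unitarymx) (Uu' : U' \is unitarymx).
Hypothesis xE : U^t* *m rdiag K (rexp a) *m U = E^t* *m E.
Hypothesis xE' : U'^t* *m rdiag K (rexp a') *m U' = E^t* *m rdiag K (rexp de) *m E.

Lemma horn_sum : \sum_i a' 0 i = \sum_i a 0 i + \sum_i de 0 i.
Proof.
apply: expR_inj; rewrite expRD; apply: (@toC_inj _ _ K); rewrite rmorphM /=.
rewrite -!det_rdiag_exp -(det_unitary_conj (rdiag K (rexp a')) Uu') xE'.
rewrite -(det_unitary_conj (rdiag K (rexp a)) Uu) xE.
by rewrite !det_mulmx mulrAC.
Qed.

Hypotheses (a_ni : nonincr a) (de_ni : nonincr de).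

(* Compress E^* e^de E to the top d eigenvectors V of x': the determinant of the
   compression is that of V x V^* times that of a compression of e^de. *)
Lemma horn_topsum d (le_dn : (d <= n)%N) :
  \sum_(i < d) a' 0 (widen_ord le_dn i) <=
  \sum_(i < d) a 0 (widen_ord le_dn i) + \sum_(i < d) de 0 (widen_ord le_dn i).
Proof.
pose J : 'M[C]_(d, n) := rowsub (widen_ord le_dn) 1%:M.
have JE (c : 'rV[R]_n) : J *m rdiag K c *m J^t* = rdiag K (\row_i c 0 (widen_ord le_dn i)).
  apply/matrixP => i j; rewrite rdiagE [LHS]mxE.
  rewrite (bigD1 (widen_ord le_dn i)) //= big1 ?addr0 => [|k ki]; last first.
    by rewrite mulE_rdiag !mxE eq_sym (negbTE ki) !mul0r.
  rewrite mulE_rdiag !mxE eqxx mul1r conjC_nat.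
  by rewrite -(inj_eq val_inj) /= (inj_eq val_inj) eq_sym mulr_natr.
have Ju : J \is unitarymx.
  apply/unitarymxP; have := JE (const_mx 1).
  rewrite !rdiag_eq1 ?mulmx1 // => [i|i]; by rewrite !mxE.
pose V := J *m U'.
have Vu : V \is unitarymx by exact: mul_unitarymx.
have xp : pdmx K (E^t* *m E) by exists U, a.
have Vf : row_free V by rewrite /row_free mxrank_unitary.
have Sp := pdmx_congr xp Vf; set S := V *m _ *m _ in Sp.
have [Rp RR] := mxsqrtP Sp; set r := gmxsqrt S in Rp RR.
have ru := pdmx_unit Rp; have rh := pdmx_ctrmx Rp.
pose W := invmx r *m V *m E^t*.
have VE : V *m E^t* = r *m W by rewrite /W !mulmxA mulmxV // mul1mx.
have Wu : W \is unitarymx.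
  apply/unitarymxP; apply: (row_full_inj (A := r)); rewrite ?row_full_unit //.
  apply: (row_free_inj (A := r)); rewrite ?row_free_unit //=.
  rewrite mulmx1 RR; transitivity ((r *m W) *m (r *m W)^t* ).
    by rewrite (ctrmxM r) rh; move: (W^t* ) => W'; rewrite !mulmxA.
  by rewrite -VE /S ctrmxM trmxCK !mulmxA.
have [t1 dS ht1] : exists2 t, \det S = toC (expR t) &
    t <= \sum_(i < d) a 0 (widen_ord le_dn i).
  have -> : S = (V *m U^t* ) *m rdiag K (rexp a) *m (V *m U^t* )^t*.
    by rewrite /S -xE ctrmxM trmxCK !mulmxA.
  by apply: det_compress => //; apply: mul_unitarymx; rewrite ?trmxC_unitary.
have [t2 dW ht2] := det_compress K le_dn Wu de_ni.
suff -> : \sum_(i < d) a' 0 (widen_ord le_dn i) = t1 + t2 by exact: lerD.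
apply: expR_inj; apply: (@toC_inj _ _ K); rewrite expRD rmorphM /=.
rewrite -dS -dW -RR det_mulmx mulrAC -!det_mulmx.
transitivity (\det (V *m (U'^t* *m rdiag K (rexp a') *m U') *m V^t* )).
  rewrite /V ctrmxM !mulmxA (mulmxtVK _ Uu') (mulmxtVK _ Uu').
  rewrite JE -[X in rdiag K X](_ : rexp (\row_i a' 0 (widen_ord le_dn i)) = _).
    by rewrite det_rdiag_exp; congr (toC (expR _)); apply: eq_bigr => i _; rewrite mxE.
  by apply/rowP => i; rewrite !mxE.
rewrite xE' !mulmxA VE -mulmxA -[E *m V^t*]trmxCK ctrmxM trmxCK VE ctrmxM rh.
by rewrite !mulmxA.
Qed.
End OneStep.

Definition vnat n (n0 : (0 < n)%N) (a : 'rV[R]_n) (k : nat) : R :=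
  a 0 (insubd (Ordinal n0) k).

Lemma vnatE n (n0 : (0 < n)%N) (a : 'rV[R]_n) (i : 'I_n) : vnat n0 a i = a 0 i.
Proof. by rewrite /vnat valKd. Qed.

Lemma horn_energy n (n0 : (0 < n)%N) (U U' E : 'M[C]_n) (a a' de : 'rV[R]_n) :
  U \is unitarymx -> U' \is unitarymx ->
  U^t* *m rdiag K (rexp a) *m U = E^t* *m E ->
  U'^t* *m rdiag K (rexp a') *m U' = E^t* *m rdiag K (rexp de) *m E ->
  nonincr a -> nonincr a' ->
  exists2 de' : 'rV[R]_n, \sum_i de' 0 i ^+ 2 = \sum_i de 0 i ^+ 2 &
    \sum_i a' 0 i ^+ 2 <= \sum_i a' 0 i * (a 0 i + de' 0 i).
Proof.
move=> Uu Uu' xE xE' a_ni a'_ni; have [s s_ni] := sort_row de.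
exists (\row_i de 0 (s i)).
  rewrite [RHS](reindex_inj (@perm_inj _ s)).
  by apply: eq_bigr => i _; rewrite mxE.
set de' := \row__ _ in s_ni *.
have [Qu dE] := perm_rdiag K (rexp de) s.
have e1 : E^t* *m E = (perm_mx s *m E)^t* *m (perm_mx s *m E).
  by rewrite ctrmxM mulmxA (mulmxKtV _ Qu).
have e2 : E^t* *m rdiag K (rexp de) *m E =
    (perm_mx s *m E)^t* *m rdiag K (rexp de') *m (perm_mx s *m E).
  rewrite dE ctrmxM !mulmxA; congr (_ *m rdiag K _ *m _ *m _).
  by apply/rowP => i; rewrite !mxE.
rewrite e1 in xE; rewrite e2 in xE'.
pose w k := vnat n0 a' k.
pose c k := vnat n0 a' k - (vnat n0 a k + vnat n0 de' k).
have vw d (le_dn : (d <= n)%N) (b : 'rV[R]_n) (i : 'I_d) :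
  vnat n0 b i = b 0 (widen_ord le_dn i) by rewrite -(vnatE n0).
have c_le d : (d <= n)%N -> \sum_(i < d) c i <= 0.
  move=> le_dn; rewrite sumrB big_split /= subr_le0.
  under eq_bigr do rewrite (vw _ le_dn).
  under [X in _ <= X + _]eq_bigr do rewrite (vw _ le_dn).
  under [X in _ <= _ + X]eq_bigr do rewrite (vw _ le_dn).
  exact: horn_topsum xE xE' a_ni s_ni _ le_dn.
have c_n : \sum_(i < n) c i = 0.
  rewrite sumrB big_split /=; under eq_bigr do rewrite vnatE.
  under [X in _ - (X + _)]eq_bigr do rewrite vnatE.
  under [X in _ - (_ + X)]eq_bigr do rewrite vnatE.
  by rewrite (horn_sum Uu Uu' xE xE') subrr.
have w_ni k : (k.+1 < n)%N -> w k.+1 <= w k.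
  by move=> kn; apply: a'_ni; rewrite !val_insubd kn (ltnW kn) leqnSn.
have := abel_le w_ni c_le; rewrite c_n mulr0.
move=> wc; rewrite -subr_le0 -sumrB; apply: le_trans wc.
rewrite le_eqVlt; apply/orP; left; apply/eqP; apply: eq_bigr => i _.
by rewrite /w /c !vnatE; ring.
Qed.

Definition nondecr n (a : 'rV[R]_n) := forall i j : 'I_n, (i <= j)%N -> a 0 i <= a 0 j.

Lemma horn_energy_nondecr n (n0 : (0 < n)%N) (U U' E : 'M[C]_n) (a a' de : 'rV[R]_n) :
  U \is unitarymx -> U' \is unitarymx ->
  U^t* *m rdiag K (rexp a) *m U = E^t* *m E ->
  U'^t* *m rdiag K (rexp a') *m U' = E^t* *m rdiag K (rexp de) *m E ->
  nondecr a -> nondecr a' ->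
  exists2 de' : 'rV[R]_n, \sum_i de' 0 i ^+ 2 = \sum_i de 0 i ^+ 2 &
    \sum_i a' 0 i ^+ 2 <= \sum_i a' 0 i * (a 0 i + de' 0 i).
Proof.
move=> Uu Uu' xE xE' a_nd a'_nd.
pose s : {perm 'I_n} := perm (@rev_ord_inj n).
have sE i : s i = rev_ord i by rewrite permE.
pose rv (b : 'rV[R]_n) : 'rV[R]_n := \row_i b 0 (s i).
have rvE (V : 'M[C]_n) b : V^t* *m rdiag K (rexp b) *m V =
    (perm_mx s *m V)^t* *m rdiag K (rexp (rv b)) *m (perm_mx s *m V).
  have [_ ->] := perm_rdiag K (rexp b) s.
  rewrite ctrmxM !mulmxA; congr (_ *m rdiag K _ *m _ *m _).
  by apply/rowP => i; rewrite !mxE.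
have [Qu _] := perm_rdiag K (rexp a) s.
have rv_ni b : nondecr b -> nonincr (rv b).
  by move=> b_nd i j ij; rewrite !mxE !sE; apply: b_nd; rewrite /= leq_sub2l.
rewrite rvE in xE; rewrite (rvE U') in xE'.
have [de' deE le] := horn_energy n0 (mul_unitarymx Qu Uu) (mul_unitarymx Qu Uu')
  xE xE' (rv_ni _ a_nd) (rv_ni _ a'_nd).
exists (rv de').
  rewrite -deE [RHS](reindex_inj (@perm_inj _ s)).
  by apply: eq_bigr => i _; rewrite mxE.
have ss i : s (s i) = i by rewrite !sE rev_ordK.
move: le; rewrite [X in X <= _ -> _](reindex_inj (@perm_inj _ s)).
rewrite [X in _ <= X -> _](reindex_inj (@perm_inj _ s)) /=.
under eq_bigr do rewrite mxE ss.
under [X in _ <= X -> _]eq_bigr do rewrite !mxE !ss.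
by under [X in _ -> _ <= X]eq_bigr do rewrite mxE.
Qed.

End Horn.

(** * The polygon of isotropic dimensions *)

Section ConvexHull.
Variable R : realType.
Local Notation V := (R^o * R^o)%type.
Implicit Types (S : set V).

Lemma sub_conv_hull S : S `<=` conv_hull S.
Proof. exact: sub_gen_smallest. Qed.

Lemma conv_hull_conv S (a b : V) (t : R) : 0 <= t <= 1 ->
  conv_hull S a -> conv_hull S b -> conv_hull S (t *: a + (1 - t) *: b).
Proof.
move=> /andP[t0 t1] Sa Sb A [cA SA].
have Aa : a \in A by rewrite inE; apply: Sa.
have Ab : b \in A by rewrite inE; apply: Sb.
have := cA a b (Itv01 t0 t1) Aa Ab; rewrite inE => H; exact: H.
Qed.

End ConvexHull.

Section StepFunctions.
Variable R : realType.
Variables (u : nat -> nat) (n theta : nat).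
Hypotheses (u0 : u 0%N = 0%N) (ut : u theta = n).
Hypothesis u_incr : forall a, (a < theta)%N -> (u a < u a.+1)%N.

Definition blk (i : nat) : nat := find (fun a => i < u a.+1)%N (iota 0 theta).

Lemma u_mono a b : (a <= b)%N -> (b <= theta)%N -> (u a <= u b)%N.
Proof.
elim: b => [|b IH]; first by rewrite leqn0 => /eqP ->.
rewrite leq_eqVlt => /orP[/eqP -> //|ab] bt.
by apply: leq_trans (IH ab (ltnW bt)) (ltnW (u_incr bt)).
Qed.

Lemma blk_lt i : (i < n)%N -> (blk i < theta)%N.
Proof.
move=> lin; rewrite -[X in (_ < X)%N](size_iota 0 theta) -has_find.
case: theta ut => [|t] ut'; first by rewrite -ut' u0 in lin.
by apply/hasP; exists t; rewrite ?mem_iota ?ltnSn //= ut'.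
Qed.

Lemma blkP i : (i < n)%N -> (u (blk i) <= i < u (blk i).+1)%N.
Proof.
move=> lin; have bt := blk_lt lin.
have hs : has (fun a => i < u a.+1)%N (iota 0 theta) by rewrite has_find size_iota.
have := nth_find 0%N hs; rewrite -/(blk i) nth_iota // add0n => ->; rewrite andbT.
case E : (blk i) => [|b]; first by rewrite u0.
have bb : (b < blk i)%N by rewrite E.
have := before_find 0%N bb; rewrite nth_iota ?add0n; last by rewrite (ltn_trans bb).
by move/negbT; rewrite -leqNgt.
Qed.

Lemma blk_lt_u i a : (i < n)%N -> (a <= theta)%N -> (blk i < a)%N = (i < u a)%N.
Proof.
move=> lin at_; have /andP[h1 h2] := blkP lin; apply/idP/idP => h.
  by apply: leq_trans h2 _; exact: u_mono.
rewrite ltnNge; apply/negP => ab; move: h; rewrite ltnNge.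
by rewrite (leq_trans (u_mono ab (ltnW (blk_lt lin)))).
Qed.

Lemma blkE i a : (a < theta)%N -> (u a <= i < u a.+1)%N -> blk i = a.
Proof.
move=> at_ /andP[h1 h2].
have lin : (i < n)%N by apply: leq_trans h2 _; rewrite -ut; exact: u_mono.
apply/eqP; rewrite eqn_leq -ltnS blk_lt_u // h2 /= leqNgt blk_lt_u ?(ltnW at_) //.
by rewrite -leqNgt.
Qed.

Definition psum (f : nat -> R) (k : nat) : R := \sum_(0 <= i < k) f (blk i).

Lemma psum_block f a k : (a < theta)%N -> (u a <= k <= u a.+1)%N ->
  psum f k = psum f (u a) + (k%:R - (u a)%:R) * f a.
Proof.
move=> at_ /andP[h1 h2]; rewrite /psum (big_cat_nat (leq0n _) h1) //=; congr (_ + _).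
rewrite (eq_big_nat _ _ (F2 := fun=> f a)) => [|i /andP[i1 i2]]; last first.
  by rewrite (blkE at_) // i1 (leq_trans i2).
by rewrite big_const_nat iter_addr_0 -natrB // mulr_natl.
Qed.

Lemma psum_u f a : (a <= theta)%N ->
  psum f (u a) = \sum_(0 <= b < a) ((u b.+1)%:R - (u b)%:R) * f b.
Proof.
elim: a => [_|a IH at_]; first by rewrite u0 /psum !big_geq.
rewrite big_nat_recr //= -IH ?(ltnW at_) //.
by apply: psum_block; rewrite ?leqnn ?andbT // ltnW // u_incr.
Qed.

Lemma psum_mono f j k : (forall a, (a < theta)%N -> 0 <= f a) -> (j <= k)%N ->
  (k <= n)%N -> psum f j <= psum f k.
Proof.
move=> f0 jk kn; rewrite /psum (big_cat_nat (leq0n _) jk) //= lerDl.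
rewrite big_nat_cond sumr_ge0 // => i /andP[/andP[_ ik] _]; apply: f0.
by apply: blk_lt; exact: leq_trans ik kn.
Qed.

Lemma step_telescope (f : nat -> R) i : (i < n)%N ->
  f (blk i) = f 0%N - \sum_(0 <= b < theta.-1) (f b - f b.+1) * (u b.+1 <= i)%N%:R.
Proof.
move=> lin; have bt := blk_lt lin.
have bt' : (blk i <= theta.-1)%N by case: theta bt.
rewrite (big_cat_nat (leq0n _) bt') //=.
rewrite [X in _ - (_ + X)]big_nat_cond [X in _ - (_ + X)]big1 => [|b]; last first.
  move=> /andP[/andP[h1 h2] _]; rewrite leqNgt -blk_lt_u ?ltnS ?h1 ?mulr0 //.
  by case: theta h2 => [|t] //; rewrite ltnS => /ltnW.
rewrite addr0 (eq_big_nat _ _ (F2 := fun b => - (f b.+1 - f b))) => [|b /andP[_ bb]].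
  by rewrite sumrN telescope_sumr // opprK addrC subrK.
rewrite leqNgt -blk_lt_u //; last by apply: leq_trans bb (ltnW bt).
by rewrite -leqNgt bb mulr1 opprB.
Qed.

End StepFunctions.

Lemma extremum_exists (R : realType) (T : finType) (Q : pred T) (F : T -> R) (t0 : T) :
  Q t0 -> exists2 t, Q t & forall t', Q t' -> F t' <= F t.
Proof.
move=> Q0; case: (@Order.TotalTheory.arg_maxP _ _ T t0 Q F Q0) => t Qt H.
by exists t.
Qed.

Lemma conv_hull_lex (R : realType) (S : set (R^o * R^o)%type) (al be M c : R) :
  (forall z : R^o * R^o, S z ->
    al * z.1 + be * z.2 < M \/ (al * z.1 + be * z.2 = M /\ z.1 <= c)) ->
  forall z : R^o * R^o, conv_hull S z ->
    al * z.1 + be * z.2 < M \/ (al * z.1 + be * z.2 = M /\ z.1 <= c).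
Proof.
move=> Sc z; apply: smallest_sub (Sc) _; apply/convex_setW => x y.
rewrite !inE /= => hx hy t t0 t1; rewrite inE /= -![_ *: _]/(_ * _) /unstable.onem.
move: (t%:num) t0 t1 => {}t t0 t1; have t1' : 0 < 1 - t by rewrite subr_gt0.
have -> : al * (t * x.1 + (1 - t) * y.1) + be * (t * x.2 + (1 - t) * y.2) =
  t * (al * x.1 + be * x.2) + (1 - t) * (al * y.1 + be * y.2) by ring.
case: hx hy => [hx|[-> hx]] [hy|[-> hy]].
- by left; nra.
- by left; nra.
- by left; nra.
- by right; split; nra.
Qed.

Section Chain.
Variable R : realType.
Local Notation V := (R^o * R^o)%type.
Definition pt (d e : nat) : V := (d%:R, e%:R).

Lemma conv_pt (t a1 a2 b1 b2 : R) :
  t *: ((a1, a2) : V) + (1 - t) *: ((b1, b2) : V) =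
  (t * a1 + (1 - t) * b1, t * a2 + (1 - t) * b2).
Proof. by []. Qed.

Variables (n m theta : nat) (P : nat -> nat -> Prop) (x y : nat -> nat).
Definition pts : set V := [set z | exists d e, P d e /\ z = pt d e].
Hypothesis n0 : (0 < n)%N.
Hypothesis Pb : forall d e, P d e -> (d <= n)%N /\ (e <= m)%N.
Hypothesis Px : forall a, (a <= theta)%N -> P (x a) 0.
Hypothesis Pxy : forall a, (a <= theta)%N -> P (x a) (y a).
Hypothesis Pext : forall a, (a <= theta)%N ->
  extreme_point (conv_hull pts) (pt (x a) (y a)).
Hypothesis Pcpl : forall d e, P d e -> pt d e <> (0, 0) ->
  extreme_point (conv_hull pts) (pt d e) ->
  exists2 a, (a <= theta)%N & d = x a /\ e = y a.
Hypotheses (x0 : x 0%N = n) (xt : x theta = 0%N).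
Hypotheses (y0 : y 0%N = 0%N) (yt : y theta = m).
Hypothesis x_decr : forall a, (a < theta)%N -> (x a.+1 < x a)%N.
Hypothesis y_incr : forall a, (a < theta)%N -> (y a < y a.+1)%N.

Definition dn a : R := (x a)%:R - (x a.+1)%:R.
Definition dm a : R := (y a.+1)%:R - (y a)%:R.
Definition phi a : R := dm a / (dn a + dm a).

Lemma dn_gt0 a : (a < theta)%N -> 0 < dn a.
Proof. by move=> at_; rewrite subr_gt0 ltr_nat x_decr. Qed.

Lemma dm_gt0 a : (a < theta)%N -> 0 < dm a.
Proof. by move=> at_; rewrite subr_gt0 ltr_nat y_incr. Qed.

Lemma dnm_gt0 a : (a < theta)%N -> 0 < dn a + dm a.
Proof. by move=> at_; apply: addr_gt0; [exact: dn_gt0 | exact: dm_gt0]. Qed.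

Lemma phi_gt0 a : (a < theta)%N -> 0 < phi a.
Proof. by move=> at_; apply: divr_gt0; [exact: dm_gt0 | exact: dnm_gt0]. Qed.

Lemma phi_lt1 a : (a < theta)%N -> phi a < 1.
Proof.
by move=> at_; rewrite ltr_pdivrMr ?dnm_gt0 // mul1r ltrDr dn_gt0.
Qed.

Lemma phi_balance a : (a < theta)%N -> phi a * dn a = (1 - phi a) * dm a.
Proof.
move=> at_; have N0 := dn_gt0 at_; have M0 := dm_gt0 at_.
have ne : dn a + dm a != 0 by rewrite gt_eqF ?dnm_gt0.
by rewrite /phi; field.
Qed.

(* If the slopes did not decrease strictly, (x, y) at a.+1 would lie on the
   segment from the point (x (a.+1), 0) to a point q of a chord of the polygon. *)
Lemma phi_decr a : (a.+1 < theta)%N -> phi a.+1 < phi a.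
Proof.
move=> at1; have at_ : (a < theta)%N := ltnW at1.
have N1 := dn_gt0 at_; have M1 := dm_gt0 at_.
have N2 := dn_gt0 at1; have M2 := dm_gt0 at1.
rewrite ltNge; apply/negP => le_phi.
have le_cross : dm a * dn a.+1 <= dm a.+1 * dn a.
  move: le_phi; rewrite /phi ler_pdivrMr ?dnm_gt0 // mulrAC ler_pdivlMr ?dnm_gt0 //.
  move: (dm a) (dm a.+1) (dn a) (dn a.+1) => r1 r2 r3 r4 ?; nra.
have [Hp ext] := Pext (ltnW at1).
have Ha : conv_hull pts (pt (x a) (y a)).
  by apply: sub_conv_hull; exists (x a), (y a); split => //; apply: Pxy; apply: ltnW.
have Hb : conv_hull pts (pt (x a.+2) (y a.+2)).
  by apply: sub_conv_hull; exists (x a.+2), (y a.+2); split => //; apply: Pxy.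
have H0 : conv_hull pts (pt (x a.+1) 0).
  by apply: sub_conv_hull; exists (x a.+1), 0%N; split => //; apply: Px; apply: ltnW.
have N12 : 0 < dn a + dn a.+1 := addr_gt0 N1 N2.
pose s := dn a.+1 / (dn a + dn a.+1).
have s01 : 0 < s < 1.
  by rewrite divr_gt0 //= ltr_pdivrMr // mul1r ltrDr.
pose Y' : R := (y a.+1)%:R + (dm a.+1 * dn a - dm a * dn a.+1) / (dn a + dn a.+1).
pose q : V := ((x a.+1)%:R, Y').
have qE : q = s *: pt (x a) (y a) + (1 - s) *: pt (x a.+2) (y a.+2).
  rewrite /q /pt conv_pt; congr (_, _); rewrite /Y' /s; move: N12 => /lt0r_neq0;
  by rewrite /dn /dm => ne; field.
have Hq : conv_hull pts q.
  by rewrite qE; apply: conv_hull_conv => //; case/andP: s01 => *; rewrite !ltW.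
have YY : (y a.+1)%:R <= Y'.
  by rewrite lerDl divr_ge0 ?subr_ge0 // ltW.
have xx : (x a)%:R = (x a.+1)%:R :> R -> False.
  by move/eqP; rewrite eqr_nat => /eqP xe; have := x_decr at_; rewrite xe ltnn.
move: YY; rewrite le_eqVlt => /orP[/eqP YE|Ylt].
  have pE : pt (x a.+1) (y a.+1) = q by rewrite /q /pt YE.
  have [e _] := ext _ _ s Ha Hb s01 (etrans pE qE).
  by apply: xx; case: e.
have y_gt0 : 0 < (y a.+1)%:R :> R.
  by rewrite ltr0n; apply: leq_ltn_trans (y_incr at_).
have Y'0 : 0 < Y' := lt_trans y_gt0 Ylt.
pose t := (y a.+1)%:R / Y'.
have t01 : 0 < t < 1 by rewrite divr_gt0 //= ltr_pdivrMr // mul1r.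
have tE : pt (x a.+1) (y a.+1) = t *: q + (1 - t) *: pt (x a.+1) 0.
  rewrite /q /pt conv_pt /t; move: (lt0r_neq0 Y'0) => ne.
  by congr (_, _); field.
have [e _] := ext _ _ t Hq H0 t01 tE.
move: Ylt; have -> : Y' = (y a.+1)%:R by case: e.
by rewrite ltxx.
Qed.

Lemma phi_nonincr a b : (a <= b)%N -> (b < theta)%N -> phi b <= phi a.
Proof.
elim: b => [|b IH]; first by rewrite leqn0 => /eqP ->.
rewrite leq_eqVlt => /orP[/eqP -> //|ab] bt.
exact: le_trans (ltW (phi_decr bt)) (IH ab (ltnW bt)).
Qed.

Definition ell a (d e : R) : R := phi a * d + (1 - phi a) * e.

Lemma ell_chain a b : (a < theta)%N -> (b <= theta)%N ->
  ell a (x b)%:R (y b)%:R <= ell a (x a)%:R (y a)%:R.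
Proof.
move=> at_ bt.
have stepE c : (c < theta)%N -> ell a (x c.+1)%:R (y c.+1)%:R =
    ell a (x c)%:R (y c)%:R + (phi c - phi a) * (dn c + dm c).
  by move=> ct; have := phi_balance ct; rewrite /ell /dn /dm; lra.
have [ab|ba] := leqP a b.
  elim: b ab bt => [|b IH]; first by rewrite leqn0 => /eqP ->.
  rewrite leq_eqVlt => /orP[/eqP -> //|ab] bt.
  rewrite stepE //; apply: le_trans (IH ab (ltnW bt)); rewrite gerDl.
  rewrite mulr_le0_ge0 ?subr_le0 ?phi_nonincr //.
  by rewrite ltW // dnm_gt0.
have : forall k, (k <= a)%N -> ell a (x (a - k))%:R (y (a - k))%:R <= ell a (x a)%:R (y a)%:R.
  elim=> [|k IH] ka; first by rewrite subn0.
  apply: le_trans (IH (ltnW ka)).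
  have -> : (a - k = (a - k.+1).+1)%N by rewrite subnSK.
  have ct : (a - k.+1 < theta)%N by apply: leq_ltn_trans (leq_subr _ _) at_.
  rewrite stepE // lerDl mulr_ge0 ?subr_ge0 ?phi_nonincr ?leq_subr //.
  by rewrite ltW // dnm_gt0.
by move=> /(_ (a - b)%N (leq_subr _ _)); rewrite subKn // ltnW.
Qed.

(* The lexicographic maximizer of (ell, first coordinate) is an extreme point,
   hence in the chain. *)
Lemma ell_max a d e : (a < theta)%N -> P d e ->
  ell a d%:R e%:R <= ell a (x a)%:R (y a)%:R.
Proof.
move=> at_ Pde; pose T := ('I_n.+1 * 'I_m.+1)%type.
pose Q (t : T) := `[< P t.1 t.2 >].
have PQ d' e' : P d' e' -> exists2 t : T, Q t & (t.1 = d' :> nat /\ t.2 = e' :> nat).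
  move=> Pde'; have [dn' em'] := Pb Pde'.
  by exists (inord d', inord e'); rewrite /Q /= !inordK //; exact/asboolP.
have [t0 Qt0 [t01 t02]] := PQ _ _ Pde.
have [t1 Qt1 t1max] := extremum_exists (fun t : T => ell a t.1%:R t.2%:R) Qt0.
pose Q' (t : T) := Q t && (ell a t.1%:R t.2%:R == ell a t1.1%:R t1.2%:R).
have Q't1 : Q' t1 by rewrite /Q' Qt1 eqxx.
have [t2 /andP[Qt2 /eqP e2] t2max] :=
  extremum_exists (fun t : T => t.1%:R : R) Q't1.
set M := ell a t1.1%:R t1.2%:R in t1max e2.
have lex : forall z : V, conv_hull pts z ->
    ell a z.1 z.2 < M \/ (ell a z.1 z.2 = M /\ z.1 <= t2.1%:R).
  apply: conv_hull_lex => z [d' [e' [/PQ[t Qt [<- <-]] ->]]] /=.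
  have := t1max t Qt; rewrite le_eqVlt => /orP[/eqP te|]; last by left.
  by right; split => //; apply: t2max; rewrite /Q' Qt te eqxx.
have phi1 : 0 < 1 - phi a by rewrite subr_gt0 phi_lt1.
have Pt2 : P t2.1 t2.2 by exact/asboolP.
have ext : extreme_point (conv_hull pts) (pt t2.1 t2.2).
  split; first by apply: sub_conv_hull; exists t2.1, t2.2.
  move=> z w t Hz Hw /andP[t_gt0 t_lt1] zw.
  have e1 : t2.1%:R = t * z.1 + (1 - t) * w.1 by have := congr1 fst zw.
  have e3 : t2.2%:R = t * z.2 + (1 - t) * w.2 by have := congr1 snd zw.
  have eM : M = t * ell a z.1 z.2 + (1 - t) * ell a w.1 w.2.
    by rewrite -e2 e1 e3 /ell; ring.
  have t1' : 0 < 1 - t by rewrite subr_gt0.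
  case: (lex _ Hz) => [zM|[zM z1]].
    suff : M < M by rewrite ltxx.
    rewrite {1}eM; have wM : ell a w.1 w.2 <= M by case: (lex _ Hw) => [/ltW|[->]].
    move: (ell a z.1 z.2) (ell a w.1 w.2) zM wM => r1 r2 zM wM; nra.
  case: (lex _ Hw) => [wM|[wM w1]].
    suff : M < M by rewrite ltxx.
    rewrite {1}eM zM; move: (ell a w.1 w.2) wM => r2 wM; nra.
  have z1E : z.1 = t2.1%:R by nra.
  have w1E : w.1 = t2.1%:R by nra.
  have z2E : z.2 = t2.2%:R.
    apply: (mulfI (lt0r_neq0 phi1)); move: zM; rewrite -e2 /ell z1E; lra.
  have w2E : w.2 = t2.2%:R.
    apply: (mulfI (lt0r_neq0 phi1)); move: wM; rewrite -e2 /ell w1E; lra.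
  by split; [rewrite (surjective_pairing z) z1E z2E |
             rewrite (surjective_pairing w) w1E w2E].
have npt : pt t2.1 t2.2 <> (0, 0).
  case=> z1 z2; move: e2; rewrite z1 z2 /ell !mulr0 addr0 => M0.
  have [t Qt [tn t0E]] := PQ _ _ (Px (leq0n theta)).
  have := t1max t Qt; rewrite tn t0E x0 -M0 /ell mulr0 addr0.
  by rewrite leNgt mulr_gt0 ?phi_gt0 // ltr0n.
have [b bt [d2 e2']] := Pcpl Pt2 npt ext.
have := t1max t0 Qt0; rewrite t01 t02 => /le_trans; apply.
by rewrite -e2 d2 e2'; exact: ell_chain.
Qed.

End Chain.

(* Blocks are numbered from 0: the paper's block alpha is the one of index
   alpha - 1, and cox turns "last x_a rows" into "rows from cox a on". *)
Section Masses.
Variable R : realType.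
Variables (n m theta : nat) (P : nat -> nat -> Prop) (x y : nat -> nat).
Hypothesis n0 : (0 < n)%N.
Hypothesis Pb : forall d e, P d e -> (d <= n)%N /\ (e <= m)%N.
Hypotheses (x0 : x 0%N = n) (xt : x theta = 0%N).
Hypotheses (y0 : y 0%N = 0%N) (yt : y theta = m).
Hypothesis x_decr : forall a, (a < theta)%N -> (x a.+1 < x a)%N.
Hypothesis y_incr : forall a, (a < theta)%N -> (y a < y a.+1)%N.
Local Notation phi := (phi R x y).
Hypothesis phi_dec : forall a, (a.+1 < theta)%N -> phi a.+1 < phi a.
Hypothesis ellP : forall a d e, (a < theta)%N -> P d e ->
  ell x y a d%:R e%:R <= ell x y a (x a)%:R (y a)%:R :> R.

Definition cox (a : nat) : nat := (n - x a)%N.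

Lemma theta_gt0 : (0 < theta)%N.
Proof. by case: theta xt => // xt'; move: n0; rewrite -x0 xt'. Qed.

Lemma x_mono a b : (a <= b)%N -> (b <= theta)%N -> (x b <= x a)%N.
Proof.
elim: b => [|b IH]; first by rewrite leqn0 => /eqP ->.
rewrite leq_eqVlt => /orP[/eqP -> //|ab] bt.
exact: leq_trans (ltnW (x_decr bt)) (IH ab (ltnW bt)).
Qed.

Lemma x_le a : (a <= theta)%N -> (x a <= n)%N.
Proof. by move=> at_; rewrite -x0; exact: x_mono. Qed.

Lemma cox0 : cox 0 = 0%N. Proof. by rewrite /cox x0 subnn. Qed.
Lemma coxt : cox theta = n. Proof. by rewrite /cox xt subn0. Qed.
Lemma cox_incr a : (a < theta)%N -> (cox a < cox a.+1)%N.
Proof.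
move=> at_; have := x_decr at_; have := x_le (ltnW at_).
by rewrite /cox; lia.
Qed.

Lemma dn_cox a : (a < theta)%N -> (cox a.+1)%:R - (cox a)%:R = dn R x a.
Proof.
move=> at_; have h1 := x_le (ltnW at_); have h2 := x_le at_.
by rewrite /cox /dn !natrB //; ring.
Qed.

Definition wsum : R := \sum_(0 <= b < theta) phi b * dn R x b.

Let dn0 a : (a < theta)%N -> 0 < dn R x a := dn_gt0 R x_decr (a := a).
Let ph0 a : (a < theta)%N -> 0 < phi a := phi_gt0 R x_decr y_incr (a := a).
Let ph1 a : (a < theta)%N -> phi a < 1 := phi_lt1 R x_decr y_incr (a := a).
Let bal a : (a < theta)%N -> phi a * dn R x a = (1 - phi a) * dm R y a :=
  phi_balance R x_decr y_incr (a := a).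

Lemma wsum_gt0 : 0 < wsum.
Proof.
rewrite /wsum big_mkord (bigD1 (Ordinal theta_gt0)) //= ltr_wpDr //.
  by apply: sumr_ge0 => i _; rewrite mulr_ge0 // ltW ?ph0 ?dn0.
by rewrite mulr_gt0 ?ph0 ?dn0 ?theta_gt0.
Qed.

Definition mass : R := wsum^-1.
Definition pv a : R := mass * phi a.
Definition qv a : R := mass - pv a.

Lemma mass_gt0 : 0 < mass. Proof. by rewrite invr_gt0 wsum_gt0. Qed.

Lemma pv_ge0 a : (a < theta)%N -> 0 <= pv a.
Proof. by move=> at_; rewrite mulr_ge0 // ltW ?mass_gt0 ?ph0. Qed.

Lemma qvE a : qv a = mass * (1 - phi a).
Proof. by rewrite mulrBr mulr1. Qed.

Lemma qv_ge0 a : (a < theta)%N -> 0 <= qv a.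
Proof.
by move=> at_; rewrite qvE mulr_ge0 ?subr_ge0 // ltW ?mass_gt0 ?ph1.
Qed.

Lemma pv_dec a : (a.+1 < theta)%N -> pv a.+1 < pv a.
Proof. by move=> at_; rewrite ltr_pM2l ?mass_gt0 // phi_dec. Qed.

Lemma bal_pq a : (a < theta)%N -> dn R x a * pv a = dm R y a * qv a.
Proof.
move=> at_; rewrite qvE /pv [LHS]mulrCA [RHS]mulrCA; congr (_ * _).
by rewrite mulrC bal // mulrC.
Qed.

Definition psumP := psum cox theta pv.
Definition psumQ := psum y theta qv.

Lemma psumP_cox a : (a <= theta)%N -> psumP (cox a) = \sum_(0 <= b < a) dn R x b * pv b.
Proof.
move=> at_; rewrite /psumP (psum_u cox0 coxt cox_incr _ at_).
by apply: eq_big_nat => b /andP[_ ba]; rewrite dn_cox // (leq_trans ba).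
Qed.

Lemma psumQ_y a : (a <= theta)%N -> psumQ (y a) = psumP (cox a).
Proof.
move=> at_; rewrite psumP_cox // /psumQ (psum_u y0 yt y_incr _ at_).
by apply: eq_big_nat => b /andP[_ ba]; rewrite bal_pq // (leq_trans ba).
Qed.

Lemma psumP_n : psumP n = 1.
Proof.
rewrite -[X in psumP X]coxt psumP_cox //.
rewrite (eq_bigr (fun b => mass * (phi b * dn R x b))) => [|b _]; last by rewrite /pv; ring.
by rewrite -mulr_sumr mulVf // gt_eqF ?wsum_gt0.
Qed.

Lemma psumQ_m : psumQ m = 1.
Proof. by rewrite -[X in psumQ X]yt psumQ_y // coxt psumP_n. Qed.

Lemma sum_sq : psum cox theta (fun a => pv a ^+ 2) n + psum y theta (fun a => qv a ^+ 2) m = mass.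
Proof.
rewrite -[X in psum cox _ _ X]coxt -[X in psum y _ _ X]yt.
rewrite (psum_u cox0 coxt cox_incr) // (psum_u y0 yt y_incr) // -big_split /=.
transitivity (mass * \sum_(0 <= b < theta) dn R x b * pv b).
  rewrite mulr_sumr; apply: eq_big_nat => b /andP[_ bt]; rewrite dn_cox //.
  rewrite -/(dm R y b); have e := bal_pq bt.
  transitivity (dn R x b * pv b * pv b + (dm R y b * qv b) * qv b).
    by rewrite /=; ring.
  by rewrite -e /qv; ring.
by rewrite -psumP_cox // coxt psumP_n mulr1.
Qed.

Lemma block_of d : (d <= n)%N -> exists2 a, (a < theta)%N & (x a.+1 <= d <= x a)%N.
Proof.
move=> dn_; have : exists a, (x a.+1 <= d)%N.
  by exists theta.-1; rewrite prednK ?theta_gt0 // xt.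
case/ex_minnP => a xa amin.
have at_ : (a < theta)%N.
  by rewrite -[theta]prednK ?theta_gt0 // ltnS; apply: amin; rewrite prednK ?theta_gt0 // xt.
exists a => //; rewrite xa /=; case: a => [|a] in xa amin at_ *; first by rewrite x0.
by rewrite leqNgt; apply/negP => /ltnW /amin; rewrite ltnn.
Qed.

Lemma mass_isotropic d e : P d e -> psumQ e <= psumP (n - d).
Proof.
move=> Pde; have [dn_ em] := Pb Pde; have [a at_ /andP[d1 d2]] := block_of dn_.
have xan := x_le (ltnW at_); have xan' := x_le at_.
have ya1 : (y a.+1 <= m)%N by rewrite -yt (u_mono y_incr).
have ea : (e <= y a.+1)%N.
  rewrite -(ler_nat R); have := ellP at_ Pde; rewrite /ell => h.
  have bl := bal at_; rewrite /dn /dm in bl.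
  have p0 := ph0 at_; have p1 : 0 < 1 - phi a by rewrite subr_gt0 ph1.
  have d1' : (x a.+1)%:R <= d%:R :> R by rewrite ler_nat.
  rewrite -(ler_pM2l p1); have : phi a * (x a.+1)%:R <= phi a * d%:R by rewrite ler_pM2l.
  lra.
have Pd : psumP (n - d) = psumP (cox a) + ((x a)%:R - d%:R) * pv a.
  rewrite /psumP (psum_block cox0 coxt cox_incr _ at_); last first.
    by rewrite /cox; apply/andP; split; lia.
  by rewrite /cox !natrB //; congr (_ + _ * _); ring.
have [ya|ya] := leqP (y a) e; last first.
  have h : psumQ e <= psumQ (y a).
    rewrite /psumQ; apply: (psum_mono y0 yt); [exact: qv_ge0 | exact: ltnW|].
    by rewrite -yt (u_mono y_incr) // ltnW.
  apply: (le_trans h); rewrite psumQ_y ?(ltnW at_) // Pd lerDl mulr_ge0 ?pv_ge0 //.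
  by rewrite subr_ge0 ler_nat.
have -> : psumQ e = psumQ (y a) + (e%:R - (y a)%:R) * qv a.
  by rewrite /psumQ (psum_block y0 yt y_incr _ at_) // ya.
rewrite Pd psumQ_y ?(ltnW at_) // lerD2l qvE /pv.
have := ler_wpM2l (ltW mass_gt0) (ellP at_ Pde); rewrite /ell; lra.
Qed.

Lemma pv_gap : exists2 g : R, 0 < g & forall a b, (a < b)%N -> (b < theta)%N -> g <= pv a - pv b.
Proof.
have mono a b : (a <= b)%N -> (b < theta)%N -> pv b <= pv a.
  elim: b => [|b IH]; first by rewrite leqn0 => /eqP ->.
  rewrite leq_eqVlt => /orP[/eqP -> //|ab] bt.
  exact: le_trans (ltW (pv_dec bt)) (IH ab (ltnW bt)).
have : forall k, (k <= theta)%N -> exists2 g : R, 0 < g &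
    forall a, (a.+1 < k)%N -> g <= pv a - pv a.+1.
  elim=> [|k IH] kt; first by exists 1.
  have [g g0 gP] := IH (ltnW kt).
  case: k => [|k] in kt IH g0 gP *; first by exists 1.
  exists (Num.min g (pv k - pv k.+1)).
    by rewrite lt_min g0 subr_gt0 pv_dec.
  move=> a; rewrite ltnS leq_eqVlt => /orP[/eqP [->]|ak].
    by rewrite ge_min lexx orbT.
  by rewrite ge_min gP.
case/(_ theta (leqnn _)) => g g0 gP; exists g => // a b ab bt.
apply: le_trans (gP a (leq_ltn_trans ab bt)) _.
by rewrite lerD2l lerN2 mono.
Qed.

End Masses.

(** * Compactness *)

Section Topology.
Variables (R : realType) (C : numClosedFieldType) (K : cplxOver R C).
Local Notation toC := (cemb K).

Lemma Re_norm (z : C) : `|toC (cre K z)| <= `|z|.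
Proof.
have r : z + z^* \is Num.real.
  by apply/CrealP; rewrite rmorphD /= conjCK addrC.
have e : toC (cre K z) *+ 2 = z + z^*.
  by rewrite (toC_real K r) ReD cre_conj -mulr2n rmorphMn.
rewrite -(ler_pMn2r (n := 2)) // -normrMn e.
by apply: le_trans (ler_normD _ _) _; rewrite norm_conjC mulr2n.
Qed.

Lemma conj_continuous : continuous (fun z : C => z^* ).
Proof.
move=> z; apply/(cvgrPdist_lt (FF := nbhs_filter z)) => e e0.
apply: filterS (nbhsx_ballx z e e0) => w.
by rewrite /ball /= -rmorphB norm_conjC.
Qed.

Lemma Re_continuous : continuous (cre K).
Proof.
move=> z; apply/(cvgrPdist_lt (FF := nbhs_filter z)) => e e0.
have e0' : 0 < toC e by rewrite -(rmorph0 toC) toC_lt.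
apply: filterS (nbhsx_ballx z _ e0') => w; rewrite /ball /= => /(le_lt_trans (Re_norm _)).
by rewrite ReD ReN (norm_sqn K) sqn_toC sqrtr_sqr toC_lt.
Qed.

Definition square : set C :=
  (fun ab : R * R => toC ab.1 + 'i * toC ab.2) @` (`[-1, 1] `*` `[-1, 1]).

Lemma compact_square : compact square.
Proof.
apply: continuous_compact.
  apply: continuous_subspaceT => ab; apply: cvgD.
    apply: (continuous_comp (f := fst) (g := toC)); first exact: cvg_fst.
    exact: toC_continuous.
  apply: cvgM; first exact: cvg_cst.
  apply: (continuous_comp (f := snd) (g := toC)); first exact: cvg_snd.
  exact: toC_continuous.
by apply: compact_setX; exact: segment_compact.
Qed.

Lemma sqn_le1_square (z : C) : sqn K z <= 1 -> square z.
Proof.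
move=> z1; have r1 := Creal_Re z; have r2 := Creal_Im z.
have e : sqn K z = cre K ('Re z) ^+ 2 + cre K ('Im z) ^+ 2.
  apply: (@toC_inj _ _ K); rewrite -mul_conj_sqn rmorphD !rmorphXn /=.
  by rewrite -!toC_real // -normCK -normC2_Re_Im.
exists (cre K ('Re z), cre K ('Im z)); last by rewrite /= -!toC_real // -Crect.
rewrite e in z1; move: (cre K _) (cre K _) z1 => a b z1.
by split => /=; rewrite in_itv /=; apply/andP; split; nra.
Qed.

Lemma continuous_mulmx (T : topologicalType) m n p (f : T -> 'M[C]_(m, n)) (g : T -> 'M[C]_(n, p)) :
  continuous f -> continuous g -> continuous (fun t => f t *m g t).
Proof.
move=> fc gc t; apply: cvg_mx_coord => i j.
rewrite mxE; under eq_fun do rewrite mxE.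
apply: (cvg_big (P := xpredT)); first exact: add_continuous.
move=> k _; apply: cvgM.
  exact: (continuous_comp (fc t) (@coord_continuous _ _ _ i k (f t))).
exact: (continuous_comp (gc t) (@coord_continuous _ _ _ k j (g t))).
Qed.

Lemma continuous_ctrmx (T : topologicalType) m n (f : T -> 'M[C]_(m, n)) :
  continuous f -> continuous (fun t => (f t)^t* ).
Proof.
move=> fc t; apply: cvg_mx_coord => i j.
rewrite !mxE; under eq_fun do rewrite !mxE.
have fij : (fun t => f t j i) @ t --> f t j i.
  exact: (continuous_comp (fc t) (@coord_continuous _ _ _ j i (f t))).
exact: (cvg_comp _ _ fij (@conj_continuous _)).
Qed.

Lemma compact_box m n : compact [set M : 'M[C]_(m, n) | forall i j, square (M i j)].
Proof.
rewrite (_ : mkset _ = vec_mx @` [set v : 'rV[C]_(m * n) | forall k, square (v ord0 k)]).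
  apply: continuous_compact; last by apply: (@rV_compact C _ (fun=> square)) => k; exact: compact_square.
  apply: continuous_subspaceT => v; apply: (cvg_mx_coord (FF := nbhs_filter v)) => i j.
  rewrite mxE; under eq_fun do rewrite mxE.
  exact: coord_continuous.
apply/seteqP; split=> [M Ms|_ [v vs <-] i j]; last by rewrite mxE; exact: vs.
exists (mxvec M); last by rewrite mxvecK.
move=> k; case/mxvec_indexP: k => i j; rewrite mxvecE; exact: Ms.
Qed.

Lemma compact_unitary n : compact [set U : 'M[C]_n | U \is unitarymx].
Proof.
apply: (subclosed_compact _ (@compact_box n n)); last first.
  move=> U /= Uu i j; apply: sqn_le1_square.
  have := rip_row K U 1%:M i.
  rewrite !mulmx1 (unitarymxP Uu) mxE eqxx mulr1n -(rmorph1 toC) Re_toC => <-.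
  rewrite ripxx big_ord1 (bigD1 j) //= mxE lerDl sumr_ge0 // => k _; exact: sqn_ge0.
have -> : [set U : 'M[C]_n | U \is unitarymx] =
    (fun U : 'M[C]_n => U *m U^t* ) @^-1` [set 1%:M].
  by apply/seteqP; split=> U /= /unitarymxP.
apply: closed_comp => [U _|]; last first.
  by apply: accessible_closed_set1; apply: hausdorff_accessible; exact: norm_hausdorff.
have idc : continuous (fun U : 'M[C]_n => U) by move=> V; exact: cvg_id.
exact: (@continuous_mulmx _ n n n id (fun U => U^t* ) idc (continuous_ctrmx idc) U).
Qed.

Section Orbit.
Variables (n m : nat) (A : 'I_2 -> 'M[C]_(n, m)).

Definition mxorbit : set ('M[C]_(n, m) * 'M[C]_(n, m)) :=
  (fun UV : 'M[C]_n * 'M[C]_m =>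
     (UV.1 *m A ord0 *m UV.2^t*, UV.1 *m A ord_max *m UV.2^t* )) @`
  ([set U | U \is unitarymx] `*` [set V | V \is unitarymx]).

Lemma compact_mxorbit : compact mxorbit.
Proof.
apply: continuous_compact; last by apply: compact_setX; exact: compact_unitary.
apply: continuous_subspaceT => UV.
have c1 : continuous (fun UV : 'M[C]_n * 'M[C]_m => UV.1) by move=> ?; exact: cvg_fst.
have c2 : continuous (fun UV : 'M[C]_n * 'M[C]_m => UV.2) by move=> ?; exact: cvg_snd.
have ca (l : 'I_2) : continuous (fun UV : 'M[C]_n * 'M[C]_m => UV.1 *m A l *m UV.2^t* ).
  apply: continuous_mulmx; last exact: continuous_ctrmx.
  by apply: continuous_mulmx => // t; exact: cvg_cst.
exact: cvg_pair (ca _ _) (ca _ _).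
Qed.

Lemma mxorbit_cluster (U : nat -> 'M[C]_n) (V : nat -> 'M[C]_m) :
  (forall k, U k \is unitarymx) -> (forall k, V k \is unitarymx) ->
  let D k l := U k *m A l *m (V k)^t* in
  let acc := cluster ((fun k => (D k ord0, D k ord_max)) @ \oo) in
  acc !=set0 /\ acc `<=` mxorbit.
Proof.
move=> Uu Vu D acc.
have Do : ((fun k => (D k ord0, D k ord_max)) @ \oo) mxorbit.
  exists 0%N => // k _ /=; exists (U k, V k) => //.
  by split; [exact: Uu | exact: Vu].
split.
  by have [p [_ pc]] := compact_mxorbit _ Do; exists p.
have oc : closed mxorbit.
  by apply: compact_closed; [exact: norm_hausdorff | exact: compact_mxorbit].
by rewrite /acc clusterE => p /(_ _ Do); rewrite -(closure_id _).1.
Qed.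

End Orbit.
End Topology.

Section Coupling.
Variables (R : realType) (n m : nat) (P Q : nat -> R).
Hypotheses (P0 : P 0%N = 0) (Q0 : Q 0%N = 0) (P1 : P n = 1) (Q1 : Q m = 1).
Hypothesis P_mono : forall i, (i < n)%N -> P i <= P i.+1.
Hypothesis Q_mono : forall j, (j < m)%N -> Q j <= Q j.+1.

(* The north-west corner coupling of the increments of P and Q. *)
Let G i j := Num.min (P i) (Q j).
Let pi i j := G i.+1 j.+1 - G i j.+1 - (G i.+1 j - G i j).

Lemma mono_le (F : nat -> R) k : (forall i, (i < k)%N -> F i <= F i.+1) ->
  forall i j, (i <= j)%N -> (j <= k)%N -> F i <= F j.
Proof.
move=> Fm i; elim=> [|j IH]; first by rewrite leqn0 => /eqP ->.
rewrite leq_eqVlt => /orP[/eqP -> //|ij] jk.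
exact: le_trans (IH ij (ltnW jk)) (Fm _ jk).
Qed.

Let P_le1 i : (i <= n)%N -> P i <= 1.
Proof. by move=> h; rewrite -P1; exact: (mono_le P_mono h (leqnn _)). Qed.
Let Q_le1 j : (j <= m)%N -> Q j <= 1.
Proof. by move=> h; rewrite -Q1; exact: (mono_le Q_mono h (leqnn _)). Qed.
Let P_ge0 i : (i <= n)%N -> 0 <= P i.
Proof. by move=> h; rewrite -P0; exact: (mono_le P_mono (leq0n _) h). Qed.
Let Q_ge0 j : (j <= m)%N -> 0 <= Q j.
Proof. by move=> h; rewrite -Q0; exact: (mono_le Q_mono (leq0n _) h). Qed.

Let pi_row i : (i < n)%N -> \sum_(0 <= j < m) pi i j = P i.+1 - P i.
Proof.
move=> lin; rewrite /pi.
rewrite (eq_bigr (fun j => (G i.+1 j.+1 - G i j.+1) - (G i.+1 j - G i j))) //.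
rewrite (telescope_sumr (fun j => G i.+1 j - G i j)) // /G Q1 Q0.
rewrite (min_l (P_le1 lin)) (min_l (P_le1 (ltnW lin))).
by rewrite (min_r (P_ge0 lin)) (min_r (P_ge0 (ltnW lin))) subrr subr0.
Qed.

Let pi_col j : (j < m)%N -> \sum_(0 <= i < n) pi i j = Q j.+1 - Q j.
Proof.
move=> ljm; rewrite /pi.
rewrite (eq_bigr (fun i => (G i.+1 j.+1 - G i.+1 j) - (G i j.+1 - G i j))) => [|i _]; last by ring.
rewrite (telescope_sumr (fun i => G i j.+1 - G i j)) // /G P1 P0.
rewrite (min_r (Q_le1 ljm)) (min_r (Q_le1 (ltnW ljm))).
by rewrite (min_l (Q_ge0 ljm)) (min_l (Q_ge0 (ltnW ljm))) subrr subr0.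
Qed.

Let pi_ge0 i j : (i < n)%N -> (j < m)%N -> 0 <= pi i j.
Proof.
move=> /P_mono hi /Q_mono hj; rewrite /pi /G.
by rewrite !minElt; do ! case: ifP => ?; lra.
Qed.

Let pi_eq0 i j : (i < n)%N -> (j < m)%N -> Q j.+1 <= P i -> pi i j = 0.
Proof.
move=> /P_mono hi /Q_mono hj h; rewrite /pi /G.
by rewrite !min_r; lra.
Qed.

Lemma coupling_le (a b : nat -> R) (L : R) :
  (forall i j, (i < n)%N -> (j < m)%N -> P i < Q j.+1 -> a i + b j <= L) ->
  \sum_(0 <= i < n) (P i.+1 - P i) * a i + \sum_(0 <= j < m) (Q j.+1 - Q j) * b j <= L.
Proof.
move=> hL.
have -> : \sum_(0 <= i < n) (P i.+1 - P i) * a i =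
    \sum_(0 <= i < n) \sum_(0 <= j < m) pi i j * a i.
  by apply: eq_big_nat => i /andP[_ lin]; rewrite -mulr_suml pi_row.
have -> : \sum_(0 <= j < m) (Q j.+1 - Q j) * b j =
    \sum_(0 <= i < n) \sum_(0 <= j < m) pi i j * b j.
  rewrite [RHS]exchange_big_nat; apply: eq_big_nat => j /andP[_ ljm].
  by rewrite -mulr_suml pi_col.
have -> : L = \sum_(0 <= i < n) \sum_(0 <= j < m) pi i j * L.
  rewrite (eq_big_nat _ _ (F2 := fun i => (P i.+1 - P i) * L)) => [|i /andP[_ lin]].
    by rewrite -mulr_suml telescope_sumr // P1 P0 subr0 mul1r.
  by rewrite -mulr_suml pi_row.
rewrite -big_split /= big_nat_cond [leRHS]big_nat_cond; apply: ler_sum => i.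
move=> /andP[/andP[_ lin] _]; rewrite -big_split /= big_nat_cond [leRHS]big_nat_cond.
apply: ler_sum => j /andP[/andP[_ ljm] _]; rewrite -mulrDr.
have [h|h] := leP (Q j.+1) (P i); first by rewrite pi_eq0 // !mul0r.
by apply: ler_wpM2l; [exact: pi_ge0 | exact: hL].
Qed.

End Coupling.

Section IsotropicSpans.
Variables (C : numClosedFieldType).

Definition glast_rows n (g : 'M[C]_n) (d : nat) : seq 'rV[C]_n :=
  [seq row i g | i <- enum 'I_n & among_last d i].
Definition gfirst_rows n (g : 'M[C]_n) (d : nat) : seq 'rV[C]_n :=
  [seq row i g | i <- enum 'I_n & among_first d i].

Lemma free_rows n (g : 'M[C]_n) (p : pred 'I_n) : g \in unitmx ->
  free [seq row i g | i <- enum 'I_n & p i].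
Proof.
move=> gu; have : free [seq row i g | i <- enum 'I_n].
  have -> : [seq row i g | i <- enum 'I_n] = [tuple row i g | i < n] by [].
  apply/freeP => k.
  have -> : \sum_(i < n) k i *: [tuple row i0 g | i0 < n]`_i = (\row_i k i) *m g.
    rewrite mulmx_sum_row; apply: eq_bigr => i _.
    by rewrite mxE (nth_map i) ?size_enum_ord // nth_ord_enum.
  move=> /(congr1 (mulmx^~ (invmx g))); rewrite mulmxK // mul0mx => /rowP kE i.
  by have := kE i; rewrite !mxE.
move: (enum 'I_n) => s; elim: s => //= i s IH; rewrite free_cons => /andP[ni fs].
case: (p i) => /=; last exact: IH.
rewrite free_cons IH // andbT; apply: contra ni; apply: subvP.
apply: sub_span => v /mapP[j]; rewrite mem_filter => /andP[_ js] ->.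
exact: map_f.
Qed.

Lemma size_last n d : (d <= n)%N -> size [seq i <- enum 'I_n | among_last d i] = d.
Proof.
move=> dn; rewrite size_filter.
have -> : count (among_last d) (enum 'I_n) = count (fun i => (n - d <= i)%N) (iota 0 n).
  by rewrite -val_enum_ord count_map.
rewrite -{2}(subnK dn) iotaD count_cat add0n.
rewrite (_ : count _ (iota 0 _) = 0%N); last first.
  apply/eqP; rewrite -leqn0 leqNgt -has_count; apply/hasPn => i.
  by rewrite mem_iota add0n -ltnNge.
rewrite (_ : count _ _ = d) //; apply/eqP; rewrite -[X in _ == X](size_iota (n - d) d).
by rewrite -all_count; apply/allP => i; rewrite mem_iota => /andP[].
Qed.

Lemma size_first n d : (d <= n)%N -> size [seq i <- enum 'I_n | among_first d i] = d.
Proof.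
move=> dn; rewrite size_filter.
have -> : count (among_first d) (enum 'I_n) = count (fun i => (i < d)%N) (iota 0 n).
  by rewrite -val_enum_ord count_map.
rewrite -{1}(subnKC dn) iotaD count_cat add0n.
rewrite (_ : count _ (iota d _) = 0%N); last first.
  apply/eqP; rewrite -leqn0 leqNgt -has_count; apply/hasPn => i.
  by rewrite mem_iota => /andP[di _]; rewrite -leqNgt.
rewrite addn0; apply/eqP; rewrite -[X in _ == X](size_iota 0 d).
by rewrite -all_count; apply/allP => i; rewrite mem_iota => /andP[].
Qed.

Lemma dim_last n (g : 'M[C]_n) d : g \in unitmx -> (d <= n)%N ->
  \dim <<glast_rows g d>> = d.
Proof.
move=> gu dn; have /eqP -> := free_rows (among_last d) gu.
by rewrite size_map size_last.
Qed.

Lemma dim_first n (g : 'M[C]_n) d : g \in unitmx -> (d <= n)%N ->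
  \dim <<gfirst_rows g d>> = d.
Proof.
move=> gu dn; have /eqP -> := free_rows (among_first d) gu.
by rewrite size_map size_first.
Qed.

Variables (n m : nat) (A : 'I_2 -> 'M[C]_(n, m)).

Definition gisotropic (X : {vspace 'rV[C]_n}) (Y : {vspace 'rV[C]_m}) : Prop :=
  forall u v l, u \in X -> v \in Y -> u *m A l *m v^t* = 0.

Lemma span_mul0 p q (X : seq 'rV[C]_p) (B : 'M[C]_(p, q)) :
  (forall u, u \in X -> u *m B = 0) -> forall u, u \in <<X>>%VS -> u *m B = 0.
Proof.
move=> XB u; have h : (<<X>> <= lker (linfun (mulmxr B : 'rV_p -> 'rV_q)))%VS.
  by apply/span_subvP => v vX; rewrite memv_ker lfunE /= XB.
by move/(subvP h); rewrite memv_ker lfunE /= => /eqP.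
Qed.

Lemma isotropic_span (X : seq 'rV[C]_n) (Y : seq 'rV[C]_m) :
  (forall u v l, u \in X -> v \in Y -> u *m A l *m v^t* = 0) ->
  gisotropic <<X>> <<Y>>.
Proof.
move=> h u v l uX vY; rewrite -mulmxA; move: u uX; apply: span_mul0 => u uX.
have flip (w : 'rV[C]_m) : (u *m (A l *m w^t* ) == 0) = (w *m (u *m A l)^t* == 0).
  rewrite mulmxA; apply/eqP/eqP => [e|e].
    by rewrite -[w]trmxCK -ctrmxM e trmx0 map_mx0.
  by rewrite -[u *m _]trmxCK -ctrmxM e trmx0 map_mx0.
apply/eqP; rewrite flip; apply/eqP; move: v vY; apply: span_mul0 => v vY.
by apply/eqP; rewrite -flip mulmxA; apply/eqP; exact: h.
Qed.

Lemma entry_rows p q (g : 'M[C]_(p, n)) (h : 'M[C]_(q, m)) l i j :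
  row i g *m A l *m (row j h)^t* = ((g *m A l *m h^t* ) i j)%:M.
Proof.
rewrite -!row_mul; apply/matrixP => i' j'; rewrite !ord1 !mxE eqxx mulr1n.
by apply: eq_bigr => k _; rewrite !mxE.
Qed.

Lemma corner0_isotropic (g : 'M[C]_n) (h : 'M[C]_m) d e :
  (forall l i j, among_last d i -> among_first e j -> (g *m A l *m h^t* ) i j = 0) ->
  gisotropic <<glast_rows g d>> <<gfirst_rows h e>>.
Proof.
move=> D0; apply: isotropic_span => u v l /mapP[i + ->] /mapP[j + ->].
rewrite !mem_filter => /andP[id _] /andP[je _].
by rewrite entry_rows D0 // raddf0.
Qed.

End IsotropicSpans.

Section Corner.
Variables (R : realType) (C : numClosedFieldType) (K : cplxOver R C).
Variables (n m : nat).
Local Notation M := ('M[C]_(n, m)).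

Definition corner (d e : nat) (D : M * M) : R :=
  \sum_i \sum_j (among_last d i && among_first e j)%:R *
    (sqn K (D.1 i j) + sqn K (D.2 i j)).

Lemma sqn_continuous : continuous (sqn K).
Proof.
move=> z; have c : (fun w : C => w * w^* ) @ z --> z * z^*.
  exact: (cvgM (cvg_id : (fun w : C => w) @ z --> z) (@conj_continuous _ z)).
exact: (cvg_comp _ _ c (@Re_continuous _ _ K _)).
Qed.

Lemma corner_continuous d e : continuous (corner d e).
Proof.
move=> D; apply: (cvg_big (P := xpredT)); first exact: add_continuous.
move=> i _; apply: (cvg_big (P := xpredT)); first exact: add_continuous.
move=> j _; apply: cvgM; first exact: cvg_cst.
have h (pr : M * M -> M) : {for D, continuous pr} ->
    (fun t => sqn K (pr t i j)) @ D --> sqn K (pr D i j).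
  move=> prc; have c1 := continuous_comp prc (@coord_continuous _ _ _ i j (pr D)).
  exact: (cvg_comp _ _ c1 (@sqn_continuous _)).
by apply: cvgD; [apply: (h fst); exact: cvg_fst | apply: (h snd); exact: cvg_snd].
Qed.

Lemma corner_ge0 d e D : 0 <= corner d e D.
Proof.
apply: sumr_ge0 => i _; apply: sumr_ge0 => j _; rewrite mulr_ge0 //.
by rewrite addr_ge0 ?sqn_ge0.
Qed.

Lemma corner_eq0 d e D : corner d e D = 0 -> forall i j,
  among_last d i -> among_first e j -> D.1 i j = 0 /\ D.2 i j = 0.
Proof.
have ge0 i j : 0 <= (among_last d i && among_first e j)%:R *
    (sqn K (D.1 i j) + sqn K (D.2 i j)).
  by rewrite mulr_ge0 // addr_ge0 ?sqn_ge0.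
move=> /eqP; rewrite psumr_eq0 => [/allP h i j id je|i _]; last exact: sumr_ge0.
have := h i; rewrite mem_index_enum => /(_ isT) /=.
rewrite psumr_eq0 // => /allP /(_ j); rewrite mem_index_enum => /(_ isT) /=.
rewrite id je mul1r paddr_eq0 ?sqn_ge0 // => /andP[/eqP/sqn_eq0 -> /eqP/sqn_eq0 ->].
by [].
Qed.

Variable A : 'I_2 -> M.

Definition giso_dims (d e : nat) : Prop :=
  exists (X : {vspace 'rV[C]_n}) (Y : {vspace 'rV[C]_m}),
    [/\ gisotropic A X Y, \dim X = d & \dim Y = e].

Lemma corner_bound d e : (d <= n)%N -> (e <= m)%N -> ~ giso_dims d e ->
  exists2 eps : R, 0 < eps & forall D, mxorbit A D -> eps <= corner d e D.
Proof.
move=> dn em niso.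
have o0 : mxorbit A !=set0.
  exists (1%:M *m A ord0 *m 1%:M^t*, 1%:M *m A ord_max *m 1%:M^t* ).
  exists (1%:M, 1%:M) => //.
  by split; apply/unitarymxP; rewrite ctrmx1 mulmx1.
have cc : {within mxorbit A, continuous (corner d e)}.
  by apply: continuous_subspaceT; exact: corner_continuous.
have [D] := compact_EVT_min o0 (@compact_mxorbit _ _ K _ _ A) cc.
rewrite inE => -[[U V] [/= Uu Vu] DE] Dmin.
exists (corner d e D); last by move=> D' D'o; apply: Dmin; rewrite inE.
rewrite lt_neqAle corner_ge0 andbT eq_sym; apply/eqP => /corner_eq0 D0.
apply: niso; exists <<glast_rows U d>>%VS, <<gfirst_rows V e>>%VS; split.
- apply: corner0_isotropic => l i j id je; have [e1 e2] := D0 i j id je.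
  rewrite -DE /= in e1 e2; have : l \in enum 'I_2 by rewrite mem_enum.
  by case: l => -[|[|//]] p _; [rewrite -[RHS]e1 | rewrite -[RHS]e2];
    congr (fun_of_matrix (_ *m A _ *m _) _ _); exact: val_inj.
- by rewrite dim_last // unitarymx_unit.
- by rewrite dim_first // unitarymx_unit.
Qed.

Lemma corner_bound_uniform :
  exists2 eps : R, 0 < eps & forall d e D, (d <= n)%N -> (e <= m)%N ->
    ~ giso_dims d e -> mxorbit A D -> eps <= corner d e D.
Proof.
have h (t : 'I_n.+1 * 'I_m.+1) : exists eps : R, 0 < eps /\
    (~ giso_dims t.1 t.2 -> forall D, mxorbit A D -> eps <= corner t.1 t.2 D).
  have [iso|niso] := pselect (giso_dims t.1 t.2); first by exists 1; split.
  have [eps e0 eP] := corner_bound (ltn_ord t.1) (ltn_ord t.2) niso.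
  by exists eps.
have {h}[f fP] := fin_all_exists h.
exists (\big[Order.min/1]_t f t).
  by apply: lt_bigmin => // t _; have [] := fP t.
move=> d e D dn em niso Do; have [_] := fP (inord d, inord e).
rewrite /= !inordK // => /(_ niso D Do); apply: le_trans.
exact: bigmin_le_cond.
Qed.

End Corner.

Section Capacity.
Variables (R : realType) (C : numClosedFieldType) (K : cplxOver R C).
Variables (n m : nat) (A : 'I_2 -> 'M[C]_(n, m)).
Variables (P Q : nat -> R).
Hypotheses (P0 : P 0%N = 0) (Q0 : Q 0%N = 0) (P1 : P n = 1) (Q1 : Q m = 1).
Hypothesis P_mono : forall i, (i < n)%N -> P i <= P i.+1.
Hypothesis Q_mono : forall j, (j < m)%N -> Q j <= Q j.+1.
Hypothesis PQ_iso : forall d e, giso_dims A d e -> Q e <= P (n - d)%N.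
Hypotheses (n0 : (0 < n)%N) (m0 : (0 < m)%N).

Lemma capacity_bound : exists2 eps : R, 0 < eps &
  forall (U : 'M[C]_n) (V : 'M[C]_m) (a : 'rV[R]_n) (b : 'rV[R]_m),
    U \is unitarymx -> V \is unitarymx -> nondecr a -> nonincr b ->
    let T := \sum_l \sum_i \sum_j expR (a 0 i + b 0 j) *
      sqn K ((U *m A l *m V^t* ) i j) in
    0 < T /\
    ln eps + \sum_(i < n) (P i.+1 - P i) * a 0 i +
      \sum_(j < m) (Q j.+1 - Q j) * b 0 j <= ln T.
Proof.
have [eps eps0 epsP] := corner_bound_uniform K A.
exists eps => // U V a b Uu Vu a_nd b_ni T.
pose D := (U *m A ord0 *m V^t*, U *m A ord_max *m V^t* ).
have Do : mxorbit A D by exists (U, V).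
have TE : T = \sum_i \sum_j expR (a 0 i + b 0 j) * (sqn K (D.1 i j) + sqn K (D.2 i j)).
  rewrite /T exchange_big; apply: eq_bigr => i _; rewrite exchange_big.
  apply: eq_bigr => j _; rewrite -mulr_sumr; congr (_ * _).
  rewrite big_ord_recl big_ord_recl big_ord0 addr0 /=.
  by congr (_ + sqn K ((_ *m A _ *m _) _ _)); exact: val_inj.
have Tcorner (i : 'I_n) (j : 'I_m) :
    expR (a 0 i + b 0 j) * corner K (n - i) j.+1 D <= T.
  rewrite TE mulr_sumr; apply: ler_sum => i' _; rewrite mulr_sumr.
  apply: ler_sum => j' _; rewrite mulrA.
  apply: ler_wpM2r; first by rewrite addr_ge0 ?sqn_ge0.
  rewrite /among_last /among_first subKn ?(ltnW (ltn_ord i)) //.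
  case: andP => [[ii jj]|_]; last by rewrite mulr0 expR_ge0.
  by rewrite mulr1 ler_expR lerD ?a_nd ?b_ni.
have key (i : 'I_n) (j : 'I_m) : P i < Q j.+1 -> expR (a 0 i + b 0 j) * eps <= T.
  move=> PQ; apply: le_trans (Tcorner i j); apply: ler_wpM2l; first exact: expR_ge0.
  apply: epsP => //; first exact: leq_subr.
  by move=> /PQ_iso; rewrite subKn ?(ltnW (ltn_ord i)) // leNgt PQ.
have m1 : (m.-1 < m)%N by rewrite ltn_predL.
have T0 : 0 < T.
  have := key (Ordinal n0) (Ordinal m1); rewrite /= prednK // P0 Q1 => /(_ ltr01).
  by apply: lt_le_trans; rewrite mulr_gt0 ?expR_gt0.
split=> //; rewrite -addrA -lerBrDl.
have := coupling_le P0 Q0 P1 Q1 P_mono Q_mono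
  (a := vnat n0 a) (b := vnat m0 b) (L := ln T - ln eps).
rewrite !big_mkord.
rewrite (eq_bigr (fun i : 'I_n => (P i.+1 - P i) * a 0 i)) => [|i _]; last by rewrite vnatE.
rewrite (eq_bigr (fun j : 'I_m => (Q j.+1 - Q j) * b 0 j)) => [|j _]; last by rewrite vnatE.
apply=> i j lin ljm PQ.
have -> : vnat n0 a i = a 0 (Ordinal lin) by rewrite -(vnatE n0).
have -> : vnat m0 b j = b 0 (Ordinal ljm) by rewrite -(vnatE m0).
have := key (Ordinal lin) (Ordinal ljm) PQ.
rewrite -ler_ln ?posrE ?mulr_gt0 ?expR_gt0 // lnM ?posrE ?expR_gt0 // expRK.
by rewrite lerBrDr.
Qed.
End Capacity.

(** * Weak duality *)

Section Projections.
Variables (R : realType) (C : numClosedFieldType) (K : cplxOver R C).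
Local Notation toC := (cemb K).

Definition prj d n (W : 'M[C]_(d, n)) : 'M[C]_n := W^t* *m W.

Lemma prj_ctrmx d n (W : 'M[C]_(d, n)) : (prj W)^t* = prj W.
Proof. by rewrite /prj ctrmxM trmxCK. Qed.

Lemma prj_idem d n (W : 'M[C]_(d, n)) : W \is unitarymx -> prj W *m prj W = prj W.
Proof. by move=> Wu; rewrite /prj !mulmxA (mulmxtVK _ Wu). Qed.

Lemma rip1_prj d n (W : 'M[C]_(d, n)) : W \is unitarymx -> rip K 1%:M (prj W) = d%:R.
Proof.
move=> Wu; rewrite ripC /rip ctrmx1 mulmx1 /prj mxtrace_mulC (unitarymxP Wu).
by rewrite mxtrace1 -(rmorph_nat toC) Re_toC.
Qed.

Lemma rip_prj_nested d d' n (W : 'M[C]_(d, n)) (W' : 'M[C]_(d', n)) :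
  W \is unitarymx -> W' \is unitarymx -> (W <= W')%MS ->
  rip K (prj W) (prj W') = d%:R.
Proof.
move=> Wu Wu' /submxP[D WE].
have e : W *m prj W' = W.
  by rewrite /prj {1}WE -mulmxA [W' *m _]mulmxA (unitarymxP Wu') mul1mx -WE.
rewrite /rip prj_ctrmx /prj -mulmxA -/(prj W') e mxtrace_mulC (unitarymxP Wu).
by rewrite mxtrace1 -(rmorph_nat toC) Re_toC.
Qed.

Lemma rip11 n : rip K (1%:M : 'M[C]_n) 1%:M = n%:R.
Proof. by rewrite /rip ctrmx1 mulmx1 mxtrace1 -(rmorph_nat toC) Re_toC. Qed.

Definition comb n (s : R) (k : nat) (c : nat -> R) (Pi : nat -> 'M[C]_n) : 'M[C]_n :=
  toC s *: 1%:M - \sum_(0 <= b < k) toC (c b) *: Pi b.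

Lemma rip_comb1 n s k c (Pi : nat -> 'M[C]_n) (M : 'M[C]_n) :
  rip K M (comb s k c Pi) = s * rip K M 1%:M - \sum_(0 <= b < k) c b * rip K M (Pi b).
Proof.
rewrite ripBr ripZr rip_sumr; congr (_ - _).
by apply: eq_bigr => b _; rewrite ripZr.
Qed.

Lemma rip_comb n s k c (Pi Pi' : nat -> 'M[C]_n) :
  (forall b, (b < k)%N -> rip K 1%:M (Pi b) = rip K 1%:M (Pi' b)) ->
  (forall b b', (b <= b' < k)%N -> rip K (Pi b) (Pi b') = rip K (Pi' b) (Pi' b')) ->
  rip K (comb s k c Pi) (comb s k c Pi) = rip K (comb s k c Pi') (comb s k c Pi') /\
  rip K 1%:M (comb s k c Pi) = rip K 1%:M (comb s k c Pi').
Proof.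
move=> h1 h2; have h2' b b' : (b < k)%N -> (b' < k)%N ->
    rip K (Pi b) (Pi b') = rip K (Pi' b) (Pi' b').
  move=> bk bk'; have [bb|bb] := leqP b b'; first by rewrite h2 ?bb.
  by rewrite ripC [RHS]ripC h2 // ltnW.
have e1 : rip K 1%:M (comb s k c Pi) = rip K 1%:M (comb s k c Pi').
  rewrite !rip_comb1; congr (_ - _); apply: eq_big_nat => b /andP[_ bk].
  by rewrite h1.
split=> //; rewrite !rip_comb1 ![rip K (comb _ _ _ _) 1%:M]ripC e1; congr (_ - _).
apply: eq_big_nat => b /andP[_ bk]; congr (_ * _).
rewrite ![rip K (comb _ _ _ _) _]ripC !rip_comb1 ![rip K _ 1%:M]ripC h1 //; congr (_ - _).
by apply: eq_big_nat => b' /andP[_ bk']; rewrite h2'.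
Qed.

Lemma rip_rdiag2 n (a b : 'rV[R]_n) : rip K (rdiag K a) (rdiag K b) = \sum_i a 0 i * b 0 i.
Proof.
rewrite /rip rdiag_ctrmx rdiagM mxtrace_diag Re_sum; apply: eq_bigr => i _.
by rewrite !mxE Re_toC.
Qed.

Lemma rdiag1 n : rdiag K (const_mx 1 : 'rV[R]_n) = 1%:M.
Proof. by apply: rdiag_eq1 => i; rewrite mxE. Qed.

Lemma comb_rdiag n s k c (chi : nat -> 'rV[R]_n) (p : 'rV[R]_n) :
  (forall i, p 0 i = s - \sum_(0 <= b < k) c b * chi b 0 i) ->
  comb s k c (fun b => rdiag K (chi b)) = rdiag K p.
Proof.
move=> pE; apply/matrixP => i j; rewrite !mxE summxE pE.
under eq_bigr do rewrite mxE rdiagE.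
rewrite rmorphB /= rmorph_sum /= mulrnBl; congr (_ - _).
  by case: (i == j); rewrite ?mulr1n ?mulr1 ?mulr0n ?mulr0.
by rewrite -sumrMnl; apply: eq_bigr => b _; rewrite rmorphM mulrnAr.
Qed.

End Projections.

Section WeakDuality.
Variables (R : realType) (C : numClosedFieldType) (K : cplxOver R C).
Variables (n m : nat) (n0 : (0 < n)%N) (m0 : (0 < m)%N).
Variables (N : 'I_2 -> 'M[C]_(n, m)) (k : nat) (c : nat -> R) (s s' mu : R).
Variables (dx dy : nat -> nat).
Variables (Wx : forall b, 'M[C]_(dx b, n)) (Wy : forall b, 'M[C]_(dy b, m)).
Variables (p : 'rV[R]_n) (q : 'rV[R]_m).
Hypothesis T0 : 0 < tnorm K N.
Hypothesis c0 : forall b, (b < k)%N -> 0 <= c b.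
Hypothesis dx_n : forall b, (b < k)%N -> (dx b <= n)%N.
Hypothesis dy_m : forall b, (b < k)%N -> (dy b <= m)%N.
Hypothesis dx_mono : forall b b', (b <= b' < k)%N -> (dx b' <= dx b)%N.
Hypothesis dy_mono : forall b b', (b <= b' < k)%N -> (dy b <= dy b')%N.
Hypothesis Wxu : forall b, (b < k)%N -> Wx b \is unitarymx.
Hypothesis Wyu : forall b, (b < k)%N -> Wy b \is unitarymx.
Hypothesis Wx_sub : forall b b', (b <= b' < k)%N -> (Wx b' <= Wx b)%MS.
Hypothesis Wy_sub : forall b b', (b <= b' < k)%N -> (Wy b <= Wy b')%MS.
Hypothesis iso : forall b l, (b < k)%N -> Wx b *m N l *m (Wy b)^t* = 0.
Hypothesis pE : forall i : 'I_n,
  p 0 i = s - \sum_(0 <= b < k) c b * (n - dx b <= i)%N%:R.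
Hypothesis qE : forall j : 'I_m,
  q 0 j = s' - \sum_(0 <= b < k) c b * (j < dy b)%N%:R.
Hypotheses (p1 : \sum_i p 0 i = 1) (q1 : \sum_i q 0 i = 1).
Hypothesis pq2 : \sum_i p 0 i ^+ 2 + \sum_j q 0 j ^+ 2 = mu.
Hypothesis ss : s + s' - \sum_(0 <= b < k) c b = mu.

Let Px b := prj (Wx b).
Let Py b := prj (Wy b).

Lemma rip_marg_iso b : (b < k)%N ->
  rip K (marg1 K N) (Px b) + rip K (marg2 K N) (Py b) <= 1.
Proof.
move=> bk; rewrite rip_marg ler_pdivrMr // mul1r; apply: ler_sum => l _.
set u := N l; set v := Px b *m u; set w := u *m Py b.
have vv : rip K v v = rip K u v.
  by rewrite {1}/v rip_mull prj_ctrmx /v mulmxA prj_idem // Wxu.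
have ww : rip K w w = rip K u w.
  by rewrite {1}/w rip_mulr prj_ctrmx /w -mulmxA prj_idem // Wyu.
have vw : rip K v w = 0.
  have -> : rip K v w = rip K u (Px b *m u *m Py b).
    by rewrite /v rip_mull prj_ctrmx mulmxA.
  have -> : Px b *m u *m Py b = 0; last by rewrite rip0r.
  have -> : Px b *m u *m Py b = (Wx b)^t* *m (Wx b *m u *m (Wy b)^t* ) *m Wy b.
    by rewrite /Px /Py /prj !mulmxA.
  by rewrite iso // mulmx0 mul0mx.
have := rip_ge0 K (u - v - w).
rewrite !ripBl !ripBr vv ww vw [rip K v u]ripC [rip K w u]ripC [rip K w v]ripC vw.
rewrite ripDr; move: (rip K u u) (rip K u v) (rip K u w) => r1 r2 r3; lra.
Qed.

Let Ex b : 'rV[R]_n := \row_i (n - dx b <= i)%N%:R.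
Let Ey b : 'rV[R]_m := \row_j (j < dy b)%N%:R.

Let count_last (d : nat) : (d <= n)%N -> \sum_(i < n) (n - d <= i)%N%:R = d%:R :> R.
Proof.
move=> dn; rewrite -natr_sum; congr _%:R.
rewrite -(big_mkord xpredT (fun i => (n - d <= i)%N : nat)).
rewrite (big_cat_nat (leq0n (n - d)) (leq_subr _ _)) /=.
rewrite big_nat_cond big1 => [|i /andP[/andP[_ h] _]]; last by rewrite leqNgt h.
rewrite add0n (eq_big_nat _ _ (F2 := fun=> 1%N)) => [|i /andP[-> _]] //.
by rewrite sum_nat_const_nat muln1 subKn.
Qed.

Let count_first (d : nat) : (d <= m)%N -> \sum_(i < m) (i < d)%N%:R = d%:R :> R.
Proof.
move=> dm; rewrite -natr_sum; congr _%:R.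
rewrite -(big_mkord xpredT (fun i => (i < d)%N : nat)).
rewrite (big_cat_nat (leq0n d) dm) /=.
rewrite [X in (_ + X)%N]big_nat_cond [X in (_ + X)%N]big1 => [|i /andP[/andP[h _] _]]; last first.
  by rewrite ltnNge h.
rewrite addn0 (eq_big_nat _ _ (F2 := fun=> 1%N)) => [|i /andP[_ ->]] //.
by rewrite sum_nat_const_nat muln1 subn0.
Qed.

(* The projections Px onto a flag have the Gram matrix of the coordinate
   projections rdiag (Ex b), so their combination has the norm of p. *)
Let Wx_gram : rip K (comb K s k c Px) (comb K s k c Px) = \sum_i p 0 i ^+ 2 /\
  rip K 1%:M (comb K s k c Px) = 1.
Proof.
have pE' i : p 0 i = s - \sum_(0 <= b < k) c b * Ex b 0 i.
  by rewrite pE; congr (_ - _); apply: eq_bigr => b _; rewrite mxE.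
have [|b b' /andP[bb bk]|-> ->] := @rip_comb _ _ K n s k c Px (fun b => rdiag K (Ex b)).
- move=> b bk; rewrite rip1_prj ?Wxu // -(rdiag1 K) rip_rdiag2 -count_last ?dx_n //.
  by apply: eq_bigr => i _; rewrite !mxE mul1r.
- have bk0 : (b < k)%N := leq_ltn_trans bb bk.
  rewrite ripC rip_prj_nested ?Wxu ?Wx_sub ?bb // rip_rdiag2 -count_last ?dx_n //.
  apply: eq_bigr => i _; rewrite !mxE -natrM mulnb; congr (_%:R); congr nat_of_bool.
  apply/idP/andP => [h|[] //]; split=> //; apply: leq_trans h.
  by rewrite leq_sub2l // dx_mono // bb.
rewrite (comb_rdiag K pE') -(rdiag1 K) !rip_rdiag2; split.
  by apply: eq_bigr => i _; rewrite expr2.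
by rewrite -[RHS]p1; apply: eq_bigr => i _; rewrite mxE mul1r.
Qed.

Let Wy_gram : rip K (comb K s' k c Py) (comb K s' k c Py) = \sum_i q 0 i ^+ 2 /\
  rip K 1%:M (comb K s' k c Py) = 1.
Proof.
have qE' i : q 0 i = s' - \sum_(0 <= b < k) c b * Ey b 0 i.
  by rewrite qE; congr (_ - _); apply: eq_bigr => b _; rewrite mxE.
have [|b b' /andP[bb bk]|-> ->] := @rip_comb _ _ K m s' k c Py (fun b => rdiag K (Ey b)).
- move=> b bk; rewrite rip1_prj ?Wyu // -(rdiag1 K) rip_rdiag2 -count_first ?dy_m //.
  by apply: eq_bigr => i _; rewrite !mxE mul1r.
- have bk0 : (b < k)%N := leq_ltn_trans bb bk.
  rewrite rip_prj_nested ?Wyu ?Wy_sub ?bb // rip_rdiag2 -count_first ?dy_m //.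
  apply: eq_bigr => i _; rewrite !mxE -natrM mulnb; congr (_%:R); congr nat_of_bool.
  apply/idP/andP => [h|[] //]; split=> //; apply: leq_trans h _.
  by rewrite dy_mono // bb.
rewrite (comb_rdiag K qE') -(rdiag1 K) !rip_rdiag2; split.
  by apply: eq_bigr => i _; rewrite expr2.
by rewrite -[RHS]q1; apply: eq_bigr => i _; rewrite mxE mul1r.
Qed.

Lemma weak_duality : mu - n%:R^-1 - m%:R^-1 <= gdot K N N.
Proof.
have [w11 w1t] := Wx_gram; have [w22 w2t] := Wy_gram.
set W1 := comb K s k c Px in w11 w1t; set W2 := comb K s' k c Py in w22 w2t.
have Tn0 : tnorm K N != 0 by rewrite gt_eqF.
have m1t : rip K (marg1 K N) 1%:M = 1.
  by rewrite /rip ctrmx1 mulmx1 tr_marg1 // -(rmorph1 (cemb K)) Re_toC.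
have m2t : rip K (marg2 K N) 1%:M = 1.
  by rewrite /rip ctrmx1 mulmx1 tr_marg2 // -(rmorph1 (cemb K)) Re_toC.
have low : mu <= rip K (marg1 K N) W1 + rip K (marg2 K N) W2.
  rewrite !rip_comb1 m1t m2t !mulr1 addrACA -opprD -big_split /= -ss lerD2l lerN2.
  rewrite big_nat_cond [leRHS]big_nat_cond; apply: ler_sum => b /andP[/andP[_ bk] _].
  by rewrite -mulrDr ler_piMr ?c0 // rip_marg_iso.
have n0' : n%:R != 0 :> R by rewrite pnatr_eq0 -lt0n.
have m0' : m%:R != 0 :> R by rewrite pnatr_eq0 -lt0n.
have centE d (d0 : d%:R != 0 :> R) (M W : 'M[C]_d) : rip K M 1%:M = 1 -> rip K 1%:M W = 1 ->
    rip K (cent K M) (cent K W) = rip K M W - d%:R^-1.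
  move=> M1 W1'; rewrite /cent !ripBl !ripBr !ripZl !ripZr M1 W1' rip11.
  by field.
have h1 := rip_amgm K (cent K (marg1 K N)) (cent K W1).
have h2 := rip_amgm K (cent K (marg2 K N)) (cent K W2).
have w1t' : rip K W1 1%:M = 1 by rewrite ripC.
have w2t' : rip K W2 1%:M = 1 by rewrite ripC.
rewrite (centE _ n0' _ _ m1t w1t) (centE _ n0' _ _ w1t' w1t) w11 in h1.
rewrite (centE _ m0' _ _ m2t w2t) (centE _ m0' _ _ w2t' w2t) w22 in h2.
rewrite /gdot; move: h1 h2 low pq2.
move: (rip K (marg1 K N) W1) (rip K (marg2 K N) W2) => r1 r2.
move: (rip K (cent _ _) _) (rip K (cent _ _) _) => r3 r4.
move: (\sum_i _ ^+ 2) (\sum_i _ ^+ 2) (n%:R^-1) (m%:R^-1) => r5 r6 r7 r8; lra.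
Qed.

End WeakDuality.

(** * Asymptotics of the log-eigenvalues *)

Section Asymptotics.
Variables (R : realType) (I : finType).

Lemma cauchy_schwarz_sum (u v : I -> R) (r s : R) : 0 <= r -> 0 <= s ->
  \sum_i u i ^+ 2 = r ^+ 2 -> \sum_i v i ^+ 2 = s ^+ 2 -> \sum_i u i * v i <= r * s.
Proof.
move=> r0 s0 ur vs.
have key (w : I -> R) : \sum_i w i ^+ 2 = 0 -> forall i, w i = 0.
  move=> /eqP; rewrite psumr_eq0 => [/allP h i|i _]; last exact: sqr_ge0.
  by have := h i; rewrite mem_index_enum => /(_ isT); rewrite sqrf_eq0 => /eqP.
have [r_eq0|r_neq0] := eqVneq r 0.
  rewrite r_eq0 mul0r big1 // => i _; rewrite (key u) ?mul0r //.
  by rewrite ur r_eq0 expr0n.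
have [s_eq0|s_neq0] := eqVneq s 0.
  rewrite s_eq0 mulr0 big1 // => i _; rewrite (key v) ?mulr0 //.
  by rewrite vs s_eq0 expr0n.
have rp : 0 < r by rewrite lt_neqAle eq_sym r_neq0.
have sp : 0 < s by rewrite lt_neqAle eq_sym s_neq0.
have h : \sum_i u i * v i <= \sum_i (s / r / 2 * u i ^+ 2 + r / s / 2 * v i ^+ 2).
  apply: ler_sum => i _; rewrite -subr_ge0.
  have -> : s / r / 2 * u i ^+ 2 + r / s / 2 * v i ^+ 2 - u i * v i =
    (s * u i - r * v i) ^+ 2 / (2 * r * s) by field; rewrite r_neq0 s_neq0.
  by rewrite divr_ge0 ?sqr_ge0 // !mulr_ge0.
apply: le_trans h _; rewrite big_split /= -!mulr_sumr ur vs.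
by rewrite le_eqVlt; apply/orP; left; apply/eqP; field; rewrite r_neq0 s_neq0.
Qed.

Lemma minkowski_step (u v w : I -> R) (r s t : R) : 0 <= r -> 0 <= s -> 0 <= t ->
  \sum_i u i ^+ 2 = r ^+ 2 -> \sum_i v i ^+ 2 = s ^+ 2 -> \sum_i w i ^+ 2 = t ^+ 2 ->
  \sum_i u i ^+ 2 <= \sum_i u i * (v i + w i) -> r <= s + t.
Proof.
move=> r0 s0 t0 ur vs wt; under [leRHS]eq_bigr do rewrite mulrDr.
rewrite big_split /= ur => h.
have := cauchy_schwarz_sum r0 s0 ur vs; have := cauchy_schwarz_sum r0 t0 ur wt => h1 h2.
have [->|r_neq0] := eqVneq r 0; first exact: addr_ge0.
have rp : 0 < r by rewrite lt_neqAle eq_sym r_neq0.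
rewrite -(ler_pM2l rp) -expr2 mulrDr.
exact: le_trans h (lerD h2 h1).
Qed.

Variables (z : nat -> I -> R) (v : I -> R) (f g r : nat -> R) (c0 kap : R).
Hypothesis kap0 : 0 <= kap.
Hypothesis vk : \sum_i v i ^+ 2 = kap ^+ 2.
Hypothesis r_ge0 : forall k, 0 <= r k.
Hypothesis zr : forall k, \sum_i z k i ^+ 2 = r k ^+ 2.
Hypothesis lower : forall k, c0 - \sum_i v i * z k i <= f k.
Hypothesis descent : forall k, 2^-1 * g k.+1 ^+ 2 <= f k - f k.+1.
Hypothesis g_low : forall k, kap <= g k.
Hypothesis r0 : r 0%N = 0.
Hypothesis r_step : forall k, r k.+1 <= r k + 2^-1 * g k.

Lemma value_descent k : f k <= f 0%N - 2^-1 * \sum_(0 <= i < k) g i.+1 ^+ 2.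
Proof.
elim: k => [|k IH]; first by rewrite big_geq // mulr0 subr0.
by rewrite big_nat_recr //=; have := descent k; lra.
Qed.

Lemma value_upper k : f k <= f 0%N - kap ^+ 2 / 2 * k%:R.
Proof.
elim: k => [|k IH]; first by rewrite mulr0 subr0.
have := descent k; have : kap ^+ 2 <= g k.+1 ^+ 2.
  by rewrite ler_sqr ?nnegrE // (le_trans kap0).
by rewrite -[k.+1%:R]natr1 mulrDr mulr1; move: (kap ^+ 2 / 2 * k%:R) IH => t; lra.
Qed.

Lemma radius_upper k : r k <= 2^-1 * \sum_(0 <= i < k) g i.
Proof.
elim: k => [|k IH]; first by rewrite r0 big_geq // mulr0.
by rewrite big_nat_recr //=; have := r_step k; lra.
Qed.

Let K1 := 2 * (f 0%N - c0) + kap * g 0%N.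

Lemma excess_sum k : \sum_(0 <= i < k) (g i.+1 - kap) ^+ 2 <= K1.
Proof.
have h1 := value_descent k; have h2 := lower k; have h3 := radius_upper k.
have h4 := cauchy_schwarz_sum kap0 (r_ge0 k) vk (zr k).
have gk0 i : 0 <= g i := le_trans kap0 (g_low i).
have h5 : \sum_(0 <= i < k) g i <= g 0%N + \sum_(0 <= i < k) g i.+1.
  have -> : g 0%N + \sum_(0 <= i < k) g i.+1 = \sum_(0 <= i < k.+1) g i.
    by rewrite big_nat_recl.
  by rewrite big_nat_recr //= lerDl.
have h6 : \sum_(0 <= i < k) (g i.+1 - kap) ^+ 2 <=
    \sum_(0 <= i < k) g i.+1 ^+ 2 - kap * \sum_(0 <= i < k) g i.+1.
  rewrite mulr_sumr -sumrB; apply: ler_sum => i _; have := g_low i.+1.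
  move: (g i.+1) => t kt; have : 0 <= kap * (t - kap) by rewrite mulr_ge0 ?subr_ge0.
  lra.
have h7 : kap * r k <= kap * (2^-1 * (g 0%N + \sum_(0 <= i < k) g i.+1)).
  by apply: ler_wpM2l => //; apply: (le_trans h3); rewrite ler_pM2l.
rewrite /K1; move: h1 h2 h4 h6 h7.
move: (\sum_(0 <= i < k) _) (\sum_(0 <= i < k) _) (\sum_(0 <= i < k) _) (\sum_i _) => s1 s2 s3 s4.
move: (kap * r k) (r k) => s5 s6; lra.
Qed.

Lemma radius_linear (eta : R) : 0 < eta -> exists K2 : R, 0 <= K2 /\
  forall k, r k <= 2^-1 * (kap + eta) * k%:R + K2.
Proof.
move=> e0; have K10 : 0 <= K1 by have := excess_sum 0; rewrite big_geq.
have gk0 i : 0 <= g i := le_trans kap0 (g_low i).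
exists (2^-1 * (g 0%N + K1 / (4 * eta))); split.
  by rewrite mulr_ge0 // addr_ge0 // divr_ge0 // mulr_ge0 // ltW.
move=> k; apply: le_trans (radius_upper k) _.
rewrite -mulrA -mulrDr ler_pM2l //.
have h5 : \sum_(0 <= i < k) g i <= g 0%N + \sum_(0 <= i < k) g i.+1.
  have -> : g 0%N + \sum_(0 <= i < k) g i.+1 = \sum_(0 <= i < k.+1) g i.
    by rewrite big_nat_recl.
  by rewrite big_nat_recr //= lerDl.
apply: (le_trans h5).
have h6 : \sum_(0 <= i < k) g i.+1 <=
    \sum_(0 <= i < k) ((kap + eta) + (g i.+1 - kap) ^+ 2 / (4 * eta)).
  apply: ler_sum => i _; rewrite -subr_ge0.
  have -> : kap + eta + (g i.+1 - kap) ^+ 2 / (4 * eta) - g i.+1 =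
     (g i.+1 - kap - 2 * eta) ^+ 2 / (4 * eta) by field; rewrite gt_eqF.
  by rewrite divr_ge0 ?sqr_ge0 // mulr_ge0 // ltW.
rewrite big_split /= sumr_const_nat subn0 -mulr_suml in h6.
have h7 : (\sum_(0 <= i < k) (g i.+1 - kap) ^+ 2) / (4 * eta) <= K1 / (4 * eta).
  by rewrite ler_pM2r ?excess_sum // invr_gt0 mulr_gt0.
rewrite -mulr_natr in h6; lra.
Qed.

Lemma asymptotic_direction (eta : R) : 0 < eta -> exists M : nat,
  forall k, (M <= k)%N -> forall i, `|z k i - k%:R / 2 * v i| <= eta * k%:R.
Proof.
move=> e0; pose de := Num.min 1 (eta ^+ 2 / (2 * (kap + 1))).
have kp1 : 0 < kap + 1 by rewrite ltr_wpDl.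
have de0 : 0 < de by rewrite lt_min ltr01 divr_gt0 ?exprn_gt0 // mulr_gt0.
have de1 : de <= 1 by rewrite ge_min lexx.
have de2 : de * (kap + 1) <= eta ^+ 2 / 2.
  have : de <= eta ^+ 2 / (2 * (kap + 1)) by rewrite ge_min lexx orbT.
  rewrite ler_pdivlMr ?mulr_gt0 //; lra.
have [K2 [K20 rK]] := radius_linear de0.
pose K3 := `|(kap + de) * K2 + f 0%N - c0| + K2 ^+ 2.
have K30 : 0 <= K3 by rewrite addr_ge0 ?sqr_ge0.
have [M MP] : exists M : nat, K3 * 2 / eta ^+ 2 < M%:R.
  by have := archi_boundP (_ : 0 <= K3 * 2 / eta ^+ 2); eexists; apply: H;
     rewrite divr_ge0 ?sqr_ge0 // mulr_ge0.
exists M.+1 => k Mk i.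
have k1 : 1 <= k%:R :> R by rewrite ler1n (leq_trans _ Mk).
have Mk' : K3 * 2 / eta ^+ 2 <= k%:R.
  by apply: le_trans (ltW MP) _; rewrite ler_nat ltnW.
rewrite ler_pdivrMr ?exprn_gt0 // in Mk'.
have sq : \sum_i (z k i - k%:R / 2 * v i) ^+ 2 =
    r k ^+ 2 - k%:R * (\sum_i v i * z k i) + k%:R ^+ 2 / 4 * kap ^+ 2.
  rewrite -zr -vk !mulr_sumr -sumrB -big_split /=; apply: eq_bigr => j _.
  by field.
have one : (z k i - k%:R / 2 * v i) ^+ 2 <= \sum_i (z k i - k%:R / 2 * v i) ^+ 2.
  by rewrite [leRHS](bigD1 i) //= lerDl sumr_ge0 // => j _; exact: sqr_ge0.
rewrite -[leRHS]gtr0_norm; last by rewrite mulr_gt0 // (lt_le_trans ltr01).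
rewrite -ler_sqr ?nnegrE // !real_normK ?num_real //.
apply: (le_trans one); rewrite sq.
have up := value_upper k; have lo := lower k.
have rr : r k ^+ 2 <= (2^-1 * (kap + de) * k%:R + K2) ^+ 2.
  by rewrite ler_sqr ?nnegrE // ?(le_trans (r_ge0 k)).
have S : k%:R * (c0 - f 0%N + kap ^+ 2 / 2 * k%:R) <= k%:R * \sum_i v i * z k i.
  by apply: ler_wpM2l; [exact: le_trans ler01 k1 | lra].
have abs := ler_norm ((kap + de) * K2 + f 0%N - c0).
have K3E : ((kap + de) * K2 + f 0%N - c0) * k%:R + K2 ^+ 2 <= K3 * k%:R.
  rewrite /K3; move: abs; set t := _ - c0 => abs.
  rewrite [leRHS]mulrDl; apply: lerD; last by rewrite ler_peMr ?sqr_ge0.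
  by rewrite ler_wpM2r // (le_trans ler01).
have dd : de * (2 * kap + de) / 4 <= eta ^+ 2 / 2.
  by apply: le_trans de2; nra.
have dk : de * (2 * kap + de) / 4 * k%:R ^+ 2 <= eta ^+ 2 / 2 * k%:R ^+ 2.
  by rewrite ler_wpM2r ?sqr_ge0.
have Kk : K3 * k%:R <= eta ^+ 2 / 2 * k%:R ^+ 2.
  have : K3 * 2 * k%:R <= k%:R * eta ^+ 2 * k%:R.
    by rewrite ler_wpM2r // (le_trans ler01).
  by rewrite expr2; lra.
rewrite exprMn; move: rr S K3E dk Kk; rewrite !expr2.
move: (\sum_i v i * z k i) => S'; lra.
Qed.

End Asymptotics.

Section AdaptedBases.
Variable C : numClosedFieldType.

Definition vmx n (X : {vspace 'rV[C]_n}) : 'M[C]_(\dim X, n) :=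
  \matrix_i (vbasis X)`_i.

Lemma vmx_comb n (X : {vspace 'rV[C]_n}) (w : 'rV[C]_(\dim X)) :
  w *m vmx X = \sum_(i < \dim X) w 0 i *: (vbasis X)`_i.
Proof.
by rewrite mulmx_sum_row; apply: eq_bigr => i _; rewrite rowK.
Qed.

Lemma vmx_free n (X : {vspace 'rV[C]_n}) : row_free (vmx X).
Proof.
apply: inj_row_free => w; rewrite vmx_comb => w0.
have /freeP := basis_free (vbasisP X) => /(_ (fun i => w 0 i) w0) {}w0.
by apply/rowP => i; rewrite w0 mxE.
Qed.

Lemma mem_vmx n (X : {vspace 'rV[C]_n}) (u : 'rV[C]_n) :
  u \in X -> (u <= vmx X)%MS.
Proof.
move=> uX; apply/submxP; exists (\row_i coord (vbasis X) i u).
rewrite vmx_comb [LHS](coord_vbasis uX).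
by apply: eq_bigr => i _; rewrite mxE.
Qed.

Lemma row_vmx n (X : {vspace 'rV[C]_n}) i : row i (vmx X) \in X.
Proof. by rewrite rowK vbasis_mem // mem_nth // size_tuple. Qed.

Lemma vmx_sub n (X X' : {vspace 'rV[C]_n}) : (X <= X')%VS -> (vmx X <= vmx X')%MS.
Proof.
move=> XX; apply/row_subP => i; apply: mem_vmx; apply: (subvP XX).
exact: row_vmx.
Qed.

Lemma dim_rV_le n (X : {vspace 'rV[C]_n}) : (\dim X <= n)%N.
Proof. by have := dimvS (subvf X); rewrite dimvf /dim /= mul1n. Qed.

Definition onb n (E : 'M[C]_n) (X : {vspace 'rV[C]_n}) : 'M[C]_(\dim X, n) :=
  schmidt (vmx X *m invmx E).

Lemma onb_unitary n (E : 'M[C]_n) (X : {vspace 'rV[C]_n}) : onb E X \is unitarymx.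
Proof. exact/schmidt_unitarymx/dim_rV_le. Qed.

Lemma onb_eq n (E : 'M[C]_n) (X : {vspace 'rV[C]_n}) : E \in unitmx ->
  (onb E X :=: vmx X *m invmx E)%MS.
Proof.
move=> Eu; apply: eqmx_schmidt_free; rewrite /row_free mxrankMfree ?vmx_free //.
  exact: vmx_free.
by rewrite row_free_unit unitmx_inv.
Qed.

Lemma onb_sub n (E : 'M[C]_n) (X X' : {vspace 'rV[C]_n}) : E \in unitmx ->
  (X <= X')%VS -> (onb E X <= onb E X')%MS.
Proof. by move=> Eu XX; rewrite !onb_eq // submxMr // vmx_sub. Qed.

Lemma onb_isotropic n m (A : 'I_2 -> 'M[C]_(n, m)) (E : 'M[C]_n) (F : 'M[C]_m) X Y l :
  E \in unitmx -> F \in unitmx -> gisotropic A X Y ->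
  onb E X *m (E *m A l *m F^t* ) *m (onb F Y)^t* = 0.
Proof.
move=> Eu Fu iso.
have /submxP[D ->] : (onb E X <= vmx X *m invmx E)%MS by rewrite onb_eq.
have /submxP[D' ->] : (onb F Y <= vmx Y *m invmx F)%MS by rewrite onb_eq.
have e : F^t* *m (invmx F)^t* = 1%:M by rewrite -ctrmxM mulVmx // ctrmx1.
have z : vmx X *m A l *m (vmx Y)^t* = 0.
  apply/matrixP => i j; have := entry_rows A (vmx X) (vmx Y) l i j.
  rewrite iso ?row_vmx // => /matrixP/(_ 0 0).
  by rewrite !mxE eqxx mulr1n => <-.
rewrite !ctrmxM !mulmxA (mulmxKV Eu).
rewrite -(mulmxA _ (F^t* )) e mulmx1.
by rewrite -(mulmxA D) -(mulmxA D) -(mulmxA D) z mul0mx mulmx0.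
Qed.
End AdaptedBases.

Section GradientNorm.
Variables (R : realType) (C : numClosedFieldType) (K : cplxOver R C).
Variables (n m : nat) (A : 'I_2 -> 'M[C]_(n, m)).

Lemma gram_unitary p (E E' : 'M[C]_p) : E \in unitmx -> E^t* *m E = E'^t* *m E' ->
  exists2 U, U \is unitarymx & E' = U *m E.
Proof.
move=> Eu EE; exists (E' *m invmx E); last by rewrite mulmxKV.
apply/unitarymxP/mulmx1C; rewrite ctrmxM !mulmxA -(mulmxA _ (E'^t* )) -EE.
by rewrite !mulmxA -ctrmxM mulmxV // ctrmx1 mul1mx mulmxV.
Qed.

Lemma gdot_factor (E E' : 'M[C]_n) (F F' : 'M[C]_m) :
  E \in unitmx -> F \in unitmx ->
  E^t* *m E = E'^t* *m E' -> F^t* *m F = F'^t* *m F' ->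
  let N l := E *m A l *m F^t* in let N' l := E' *m A l *m F'^t* in
  gdot K N' N' = gdot K N N.
Proof.
move=> Eu Fu /(gram_unitary Eu)[U Uu ->] /(gram_unitary Fu)[V Vu ->] N N'.
have -> : N' = (fun l => U *m N l *m V^t* ).
  by apply/funext => l; rewrite /N' ctrmxM !mulmxA.
have Uu' : U^t* \is unitarymx by rewrite trmxC_unitary.
have Vu' : V^t* \is unitarymx by rewrite trmxC_unitary.
rewrite /gdot marg1_unitary // marg2_unitary // -!cent_unitary //.
by rewrite (rip_unitaryr _ _ _ Uu') (rip_unitaryr _ _ _ Vu') !rip_unitaryl.
Qed.

Definition gradn (x : 'M[C]_n) (y : 'M[C]_m) : R :=
  let N l := gmxsqrt x *m A l *m gmxsqrt y in gdot K N N.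

Lemma gradnE (E : 'M[C]_n) (F : 'M[C]_m) (x : 'M[C]_n) (y : 'M[C]_m) :
  pdmx K x -> pdmx K y -> x = E^t* *m E -> y = F^t* *m F ->
  let N l := E *m A l *m F^t* in gdot K N N = gradn x y.
Proof.
move=> xp yp xE yF N.
have [ru rh rr _ _] := inv_sqrt xp; have [su sh ss _ _] := inv_sqrt yp.
have := @gdot_factor _ E _ F ru su; rewrite rh sh rr ss => /(_ xE yF).
by rewrite /gradn => <-.
Qed.

Lemma gtrace_sqrt (x : 'M[C]_n) (y : 'M[C]_m) : pdmx K x -> pdmx K y ->
  gtrace K A x y = tnorm K (fun l => gmxsqrt x *m A l *m gmxsqrt y).
Proof.
move=> xp yp.
have [ru rh rr _ _] := inv_sqrt xp; have [su sh ss _ _] := inv_sqrt yp.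
by rewrite -{1}rr -{1}rh -{1}ss -{1}sh gtrace_conj sh.
Qed.

Hypotheses (n0 : (0 < n)%N) (m0 : (0 < m)%N).
Variables (U U' : 'M[C]_n) (V V' : 'M[C]_m).
Variables (a a' : 'rV[R]_n) (b b' : 'rV[R]_m).
Hypotheses (Uu : U \is unitarymx) (Uu' : U' \is unitarymx).
Hypotheses (Vu : V \is unitarymx) (Vu' : V' \is unitarymx).
Hypotheses (a_nd : nondecr a) (a'_nd : nondecr a').
Hypotheses (b_ni : nonincr b) (b'_ni : nonincr b').
Let x := U^t* *m rdiag K (rexp a) *m U.
Let y := V^t* *m rdiag K (rexp b) *m V.
Let x' := U'^t* *m rdiag K (rexp a') *m U'.
Let y' := V'^t* *m rdiag K (rexp b') *m V'.
Hypothesis T0 : 0 < gtrace K A x y.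
Hypothesis xy' : gstep K A x y 2 = (x', y').

Lemma gstep_facts :
  [/\ 2^-1 * gradn x' y' <= ln (gtrace K A x y) - ln (gtrace K A x' y'),
      \sum_i a' 0 i = \sum_i a 0 i /\ \sum_j b' 0 j = \sum_j b 0 j &
      Num.sqrt (\sum_i a' 0 i ^+ 2 + \sum_j b' 0 j ^+ 2) <=
      Num.sqrt (\sum_i a 0 i ^+ 2 + \sum_j b 0 j ^+ 2) + 2^-1 * Num.sqrt (gradn x y)].
Proof.
have xp : pdmx K x by exists U, a.
have yp : pdmx K y by exists V, b.
have xp' : pdmx K x' by exists U', a'.
have yp' : pdmx K y' by exists V', b'.
have T0' := T0; rewrite gtrace_sqrt // in T0'.
have [E [F [al [be /= [[xE yF Eu Fu] c1 c2 st]]]]] := gstepP n0 m0 xp yp T0' 2.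
rewrite xy' in st; case: st => xE' yF'.
pose N l := E *m A l *m F^t*.
have TN : tnorm K N = gtrace K A x y by rewrite xE yF gtrace_conj.
have TN0 : 0 < tnorm K N by rewrite TN.
pose half p (d : 'rV[R]_p) := rdiag K (rexp (- (2^-1 / 2) *: d)).
have halfh p (d : 'rV[R]_p) : (half p d)^t* = half p d by rewrite rdiag_ctrmx.
have half2 p (d : 'rV[R]_p) : half p d *m half p d = rdiag K (rexp (- 2^-1 *: d)).
  rewrite rdiagM; congr rdiag; apply/rowP => i; rewrite !mxE -expRD; congr expR.
  by field.
have xh : x' = (half n al *m E)^t* *m (half n al *m E).
  by rewrite ctrmxM halfh !mulmxA -(mulmxA (E^t* )) half2.
have yh : y' = (half m be *m F)^t* *m (half m be *m F).
  by rewrite ctrmxM halfh !mulmxA -(mulmxA (F^t* )) half2.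
have flE : flow K N al be 2^-1 =
    (fun l => half n al *m E *m A l *m (half m be *m F)^t* ).
  apply/funext => l; rewrite /flow /N ctrmxM halfh -/(half n al) -/(half m be).
  by rewrite !mulmxA.
have [s1 s2] := step_inequality n0 m0 c1 c2 TN0.
have gN : gdot K N N = gradn x y by apply: gradnE.
have gN' : gdot K (flow K N al be 2^-1) (flow K N al be 2^-1) = gradn x' y'.
  by rewrite flE; apply: gradnE.
have TN' : tnorm K (flow K N al be 2^-1) = gtrace K A x' y'.
  by rewrite flE xh yh gtrace_conj.
have gd : gradn x y = \sum_i al 0 i ^+ 2 + \sum_j be 0 j ^+ 2.
  rewrite -gN /gdot c1 c2 /rip !rdiag_ctrmx !rdiagM !mxtrace_diag !Re_sum.
  by congr (_ + _); apply: eq_bigr => i _; rewrite !mxE Re_toC expr2.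
have tr0 p (d : 'rV[R]_p) P : (0 < p)%N -> \tr P = 1 -> cent K P = rdiag K d ->
    \sum_i d 0 i = 0.
  move=> p0 P1 cP; apply: (@toC_inj _ _ K); rewrite rmorph0 -(tr_cent K p0 P1) cP.
  by rewrite mxtrace_diag rmorph_sum; apply: eq_bigr => i _; rewrite !mxE.
have al0 : \sum_i al 0 i = 0 by apply: tr0 c1; rewrite ?tr_marg1 // gt_eqF.
have be0 : \sum_i be 0 i = 0 by apply: tr0 c2; rewrite ?tr_marg2 // gt_eqF.
split.
- rewrite -gN' -TN -TN'; apply: le_trans s2; by rewrite ler_pM2l.
- rewrite (horn_sum Uu Uu' xE xE') (horn_sum Vu Vu' yF yF').
  have z p (d : 'rV[R]_p) (c : R) : \sum_i d 0 i = 0 -> \sum_i (c *: d) 0 i = 0.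
    by under [X in _ -> X = _]eq_bigr do rewrite mxE; rewrite -mulr_sumr => ->; rewrite mulr0.
  by rewrite !z // !addr0.
have [da daE da_le] := horn_energy_nondecr n0 Uu Uu' xE xE' a_nd a'_nd.
have [db dbE db_le] := horn_energy m0 Vu Vu' yF yF' b_ni b'_ni.
pose cat (u : 'rV[R]_n) (v : 'rV[R]_m) (k : 'I_n + 'I_m) : R :=
  match k with inl i => u 0 i | inr j => v 0 j end.
have ge0 (u : 'rV[R]_n) (v : 'rV[R]_m) : 0 <= \sum_i u 0 i ^+ 2 + \sum_j v 0 j ^+ 2.
  by rewrite addr_ge0 // sumr_ge0 // => *; exact: sqr_ge0.
have catE u v : \sum_k cat u v k ^+ 2 =
    Num.sqrt (\sum_i u 0 i ^+ 2 + \sum_j v 0 j ^+ 2) ^+ 2.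
  by rewrite big_sumType sqr_sqrtr.
apply: (@minkowski_step _ _ (cat a' b') (cat a b) (cat da db)); rewrite ?catE ?sqrtr_ge0 //.
- rewrite daE dbE exprMn !sqr_sqrtr ?ge0 ?gd //.
  have e p (d : 'rV[R]_p) : \sum_i (- 2^-1 *: d) 0 i ^+ 2 = 2^-1 ^+ 2 * \sum_i d 0 i ^+ 2.
    by rewrite mulr_sumr; apply: eq_bigr => i _; rewrite mxE exprMn sqrrN.
  by rewrite !e -mulrDr.
by rewrite sqr_sqrtr // big_sumType; exact: lerD.
Qed.

End GradientNorm.

(** * Decay of the lower left corners *)

Section ChainMasses.
Variables (R : realType) (C : numClosedFieldType) (K : cplxOver R C).
Variables (n m : nat) (A : 'I_2 -> 'M[C]_(n, m)) (theta : nat).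
Hypotheses (n0 : (0 < n)%N) (m0 : (0 < m)%N).
Variables (X : nat -> {vspace 'rV[C]_n}) (Y : nat -> {vspace 'rV[C]_m}).
Let P := giso_dims A.
Let x a : nat := \dim (X a).
Let y a : nat := \dim (Y a).
Hypothesis XYiso : forall a, (a <= theta)%N -> gisotropic A (X a) (Y a).
Hypothesis Pext : forall a, (a <= theta)%N ->
  extreme_point (conv_hull (@pts R P)) (pt R (x a) (y a)).
Hypothesis Pcpl : forall d e, P d e -> pt R d e <> (0, 0) ->
  extreme_point (conv_hull (@pts R P)) (pt R d e) ->
  exists2 a, (a <= theta)%N & d = x a /\ e = y a.
Hypotheses (X0 : X 0%N = fullv) (Xt : X theta = 0%VS).
Hypotheses (Y0 : Y 0%N = 0%VS) (Yt : Y theta = fullv).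
Hypothesis X_decr : forall a, (a < theta)%N -> (X a.+1 <= X a)%VS /\ X a.+1 <> X a.
Hypothesis Y_incr : forall a, (a < theta)%N -> (Y a <= Y a.+1)%VS /\ Y a <> Y a.+1.

Lemma iso_dims_le d e : P d e -> (d <= n)%N /\ (e <= m)%N.
Proof. by move=> [X' [Y' [_ <- <-]]]; rewrite !dim_rV_le. Qed.

Let Px a : (a <= theta)%N -> P (x a) 0.
Proof.
move=> at_; exists (X a), 0%VS; split=> //; last exact: dimv0.
by move=> u v l _; rewrite memv0 => /eqP ->; rewrite trmx0 map_mx0 mulmx0.
Qed.

Let Pxy a : (a <= theta)%N -> P (x a) (y a).
Proof. by move=> at_; exists (X a), (Y a); split=> //; exact: XYiso. Qed.

Lemma dim_proper p (V W : {vspace 'rV[C]_p}) : (V <= W)%VS -> V <> W ->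
  (\dim V < \dim W)%N.
Proof.
move=> VW nVW; rewrite ltn_neqAle dimvS // andbT; apply/negP => /eqP dVW.
by apply: nVW; apply/eqP; rewrite eqEdim VW dVW leqnn.
Qed.

Lemma chain_x0 : x 0%N = n.
Proof. by rewrite /x X0 dimvf /dim /= mul1n. Qed.
Lemma chain_xt : x theta = 0%N.
Proof. by rewrite /x Xt dimv0. Qed.
Lemma chain_y0 : y 0%N = 0%N.
Proof. by rewrite /y Y0 dimv0. Qed.
Lemma chain_yt : y theta = m.
Proof. by rewrite /y Yt dimvf /dim /= mul1n. Qed.
Lemma chain_x_decr a : (a < theta)%N -> (x a.+1 < x a)%N.
Proof. by move=> /X_decr[h1 h2]; exact: dim_proper. Qed.
Lemma chain_y_incr a : (a < theta)%N -> (y a < y a.+1)%N.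
Proof. by move=> /Y_incr[h1 h2]; exact: dim_proper. Qed.

Let xt := chain_xt.
Let x0 := chain_x0.
Let yt := chain_yt.
Let y0 := chain_y0.
Let xd := chain_x_decr.
Let yi := chain_y_incr.

Let phd a : (a.+1 < theta)%N -> phi R x y a.+1 < phi R x y a.
Proof. exact: (phi_decr Px Pxy Pext xd yi). Qed.

Let ellP a d e : (a < theta)%N -> P d e ->
  ell x y a d%:R e%:R <= ell x y a (x a)%:R (y a)%:R :> R.
Proof. exact: (ell_max n0 iso_dims_le Px Pxy Pext Pcpl x0 xd yi). Qed.

Let p i := pv R theta x y (blk (cox n x) theta i).
Let q j := qv R theta x y (blk y theta j).

Let t0 : (0 < theta)%N. Proof. exact: theta_gt0 n0 x0 xt. Qed.
Let cox_i a : (a < theta)%N -> (cox n x a < cox n x a.+1)%N.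
Proof. exact: (cox_incr n0 x0 xt y0 yt xd). Qed.
Let c0 : cox n x 0 = 0%N. Proof. exact: cox0. Qed.
Let ct : cox n x theta = n. Proof. exact: coxt. Qed.

Lemma sum_p : \sum_(i < n) p i = 1.
Proof. by rewrite -(psumP_n R n0 x0 xt y0 yt xd yi) /psumP /psum big_mkord. Qed.

Lemma sum_q : \sum_(j < m) q j = 1.
Proof. by rewrite -(psumQ_m R n0 x0 xt y0 yt xd yi) /psumQ /psum big_mkord. Qed.

Let mu := mass R theta x y.

Lemma sum_pq2 : \sum_(i < n) p i ^+ 2 + \sum_(j < m) q j ^+ 2 = mu.
Proof. by rewrite /mu -(sum_sq R n0 x0 xt y0 yt xd yi) /psum !big_mkord. Qed.

Lemma chain_gap : exists2 g : R, 0 < g & forall (i : 'I_n) (j : 'I_m),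
  (blk y theta j < blk (cox n x) theta i)%N -> g <= mu - p i - q j.
Proof.
have [g g0 gP] := pv_gap n0 x0 xt xd yi phd.
exists g => // i j ij; have -> : mu - p i - q j =
    pv R theta x y (blk y theta j) - pv R theta x y (blk (cox n x) theta i).
  by rewrite /p /q /qv -/mu; ring.
by apply: gP => //; exact: blk_lt c0 ct _ _.
Qed.

Lemma gradn_low (X1 : 'M[C]_n) (Y1 : 'M[C]_m) : pdmx K X1 -> pdmx K Y1 ->
  0 < gtrace K A X1 Y1 -> mu - n%:R^-1 - m%:R^-1 <= gradn K A X1 Y1.
Proof.
move=> Xp Yp T0; have [ru rh _ _ _] := inv_sqrt Xp; have [su sh _ _ _] := inv_sqrt Yp.
rewrite gtrace_sqrt // in T0; rewrite /gradn.
have kt b : (b < theta.-1)%N -> (b.+1 < theta)%N by rewrite -{2}(prednK t0) ltnS.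
have X_mono b b' : (b <= b')%N -> (b' <= theta)%N -> (X b' <= X b)%VS.
  elim: b' => [|b' IH]; first by rewrite leqn0 => /eqP ->.
  rewrite leq_eqVlt => /orP[/eqP -> //|bb] bt; have [h _] := X_decr bt.
  exact: subv_trans h (IH bb (ltnW bt)).
have Y_mono b b' : (b <= b')%N -> (b' <= theta)%N -> (Y b <= Y b')%VS.
  elim: b' => [|b' IH]; first by rewrite leqn0 => /eqP ->.
  rewrite leq_eqVlt => /orP[/eqP -> //|bb] bt; have [h _] := Y_incr bt.
  exact: subv_trans (IH bb (ltnW bt)) h.
pose c b := pv R theta x y b - pv R theta x y b.+1.
pose s' := qv R theta x y 0 + \sum_(0 <= b < theta.-1) c b.
apply: (@weak_duality _ _ K n m n0 m0 _ theta.-1 c (pv R theta x y 0) s' mu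
  (fun b => x b.+1) (fun b => y b.+1) (fun b => onb (gmxsqrt X1) (X b.+1))
  (fun b => onb (gmxsqrt Y1) (Y b.+1)) (\row_i p i) (\row_j q j) T0).
- by move=> b /kt bt; rewrite subr_ge0 ltW // (pv_dec n0 x0 xt xd yi phd).
- by move=> b _; exact: dim_rV_le.
- by move=> b _; exact: dim_rV_le.
- by move=> b b' /andP[bb /kt bt]; apply: dimvS; apply: X_mono => //; exact: ltnW.
- by move=> b b' /andP[bb /kt bt]; apply: dimvS; apply: Y_mono => //; exact: ltnW.
- by move=> b _; exact: onb_unitary.
- by move=> b _; exact: onb_unitary.
- by move=> b b' /andP[bb /kt bt]; apply: onb_sub => //; apply: X_mono => //; exact: ltnW.
- by move=> b b' /andP[bb /kt bt]; apply: onb_sub => //; apply: Y_mono => //; exact: ltnW.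
- move=> b l /kt bt; rewrite -[X in _ *m (_ *m X) *m _]sh.
  by apply: onb_isotropic => //; apply: XYiso; exact: ltnW.
- move=> i; rewrite mxE /p (step_telescope c0 ct cox_i (pv R theta x y)) //.
- move=> j; rewrite mxE /q (step_telescope y0 yt yi (qv R theta x y)) // /s' -[RHS]addrA; congr (qv R theta x y 0 + _).
  rewrite -sumrB -sumrN; apply: eq_bigr => b _; rewrite /qv -/mu /c leqNgt.
  by case: (_ < _)%N; rewrite /= ?mulr1 ?mulr0; ring.
- by under eq_bigr do rewrite mxE; exact: sum_p.
- by under eq_bigr do rewrite mxE; exact: sum_q.
- rewrite -sum_pq2; congr (_ + _); apply: eq_bigr => i _; by rewrite mxE.
- by rewrite /s' addrA addrK /qv -/mu addrC subrK.
Qed.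

Lemma value_low : exists c : R, forall (U : 'M[C]_n) (V : 'M[C]_m) (a : 'rV[R]_n) (b : 'rV[R]_m),
    U \is unitarymx -> V \is unitarymx -> nondecr a -> nonincr b ->
    let T := gtrace K A (U^t* *m rdiag K (rexp a) *m U) (V^t* *m rdiag K (rexp b) *m V) in
    0 < T /\ c + \sum_(i < n) p i * a 0 i + \sum_(j < m) q j * b 0 j <= ln T.
Proof.
pose P' := psumP R n theta x y; pose Q' := psumQ R theta x y.
have P'S i : P' i.+1 - P' i = p i by rewrite /P' /psumP /psum big_nat_recr //= addrAC subrr add0r.
have Q'S j : Q' j.+1 - Q' j = q j by rewrite /Q' /psumQ /psum big_nat_recr //= addrAC subrr add0r.
have P'0 : P' 0%N = 0 by rewrite /P' /psumP /psum big_geq.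
have Q'0 : Q' 0%N = 0 by rewrite /Q' /psumQ /psum big_geq.
have P'1 : P' n = 1 by exact: (psumP_n R n0 x0 xt y0 yt xd yi).
have Q'1 : Q' m = 1 by exact: (psumQ_m R n0 x0 xt y0 yt xd yi).
have P'm i : (i < n)%N -> P' i <= P' i.+1.
  by move=> lin; rewrite -subr_ge0 P'S (pv_ge0 R n0 x0 xt xd yi) //; exact: blk_lt c0 ct _ _.
have Q'm j : (j < m)%N -> Q' j <= Q' j.+1.
  by move=> ljm; rewrite -subr_ge0 Q'S (qv_ge0 R n0 x0 xt xd yi) //; exact: blk_lt y0 yt _ _.
have PQ d e : giso_dims A d e -> Q' e <= P' (n - d)%N.
  exact: (mass_isotropic n0 iso_dims_le x0 xt y0 yt xd yi ellP).
have [eps eps0 H] := capacity_bound K P'0 Q'0 P'1 Q'1 P'm Q'm PQ n0 m0.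
exists (ln eps) => U V a b Uu Vu a_nd b_ni; have [h1 h2] := H U V a b Uu Vu a_nd b_ni.
have TE : gtrace K A (U^t* *m rdiag K (rexp a) *m U) (V^t* *m rdiag K (rexp b) *m V) =
   \sum_l \sum_i \sum_j expR (a 0 i + b 0 j) * sqn K ((U *m A l *m V^t* ) i j).
  rewrite gtrace_diag; apply: eq_bigr => l _; apply: eq_bigr => i _; apply: eq_bigr => j _.
  by rewrite !mxE expRD.
rewrite TE; split=> //; move: h2.
under eq_bigr do rewrite P'S.
by under [X in _ + X <= _ -> _]eq_bigr do rewrite Q'S.
Qed.

Lemma entry_bound (U : 'M[C]_n) (V : 'M[C]_m) (a : 'rV[R]_n) (b : 'rV[R]_m) l i j :
  let T := gtrace K A (U^t* *m rdiag K (rexp a) *m U) (V^t* *m rdiag K (rexp b) *m V) in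
  0 < T -> sqn K ((U *m A l *m V^t* ) i j) <= expR (ln T - a 0 i - b 0 j).
Proof.
move=> T T0; rewrite -addrA -opprD expRD lnK ?posrE // expRN.
rewrite ler_pdivlMr ?expR_gt0 // mulrC.
have -> : expR (a 0 i + b 0 j) = rexp a 0 i * rexp b 0 j by rewrite !mxE expRD.
rewrite /T gtrace_diag.
have ge0 l' i' j' : 0 <= rexp a 0 i' * rexp b 0 j' * sqn K ((U *m A l' *m V^t* ) i' j').
  by rewrite mulr_ge0 ?sqn_ge0 // !mxE mulr_ge0 ?expR_ge0.
rewrite (bigD1 l) //= (bigD1 i) //= (bigD1 j) //= -!addrA lerDl.
by rewrite !addr_ge0 // !sumr_ge0 // => *; rewrite !sumr_ge0 // => *; rewrite ?sumr_ge0.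
Qed.

Section Iteration.
Variables (U : nat -> 'M[C]_n) (V : nat -> 'M[C]_m).
Variables (a : nat -> 'rV[R]_n) (b : nat -> 'rV[R]_m).
Hypotheses (Uu : forall k, U k \is unitarymx) (Vu : forall k, V k \is unitarymx).
Hypotheses (a_nd : forall k, nondecr (a k)) (b_ni : forall k, nonincr (b k)).
Let xs k := (U k)^t* *m rdiag K (rexp (a k)) *m U k.
Let ys k := (V k)^t* *m rdiag K (rexp (b k)) *m V k.
Hypotheses (xs0 : xs 0%N = 1%:M) (ys0 : ys 0%N = 1%:M).
Hypothesis stepE : forall k, gstep K A (xs k) (ys k) 2 = (xs k.+1, ys k.+1).

Lemma exp_eq1 d (W : 'M[C]_d) (u : 'rV[R]_d) : W \is unitarymx ->
  W^t* *m rdiag K (rexp u) *m W = 1%:M -> forall i, u 0 i = 0.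
Proof.
move=> Wu /(congr1 (fun M => W *m M *m W^t* )).
rewrite mulmx1 (unitarymxP Wu) !mulmxA (unitarymxP Wu) mul1mx (mulmxtVK _ Wu).
move=> e i; have /matrixP/(_ i i) := e; rewrite rdiagE !mxE eqxx !mulr1n => h.
by apply: expR_inj; rewrite expR0; apply: (@toC_inj _ _ K); rewrite h rmorph1.
Qed.

Theorem corner_decay : exists (c : R) (M : nat), [/\ 0 < c, (0 < M)%N &
  forall k l (i : 'I_n) (j : 'I_m), (M <= k)%N ->
    (blk y theta j < blk (cox n x) theta i)%N ->
    sqn K ((U k *m A l *m (V k)^t* ) i j) <= expR (- (c * k%:R))].
Proof.
have [c cP] := value_low.
pose T k := gtrace K A (xs k) (ys k).
have T0 k : 0 < T k by have [] := cP _ _ _ _ (Uu k) (Vu k) (a_nd k) (b_ni k).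
have xp k : pdmx K (xs k) by exists (U k), (a k).
have yp k : pdmx K (ys k) by exists (V k), (b k).
have fact k := gstep_facts n0 m0 (Uu k) (Uu k.+1) (Vu k) (Vu k.+1) (a_nd k) (a_nd k.+1)
  (b_ni k) (b_ni k.+1) (T0 k) (stepE k).
have a0 := exp_eq1 (Uu 0%N) xs0; have b0 := exp_eq1 (Vu 0%N) ys0.
have sa k : \sum_i a k 0 i = 0.
  elim: k => [|k IH]; first by rewrite big1.
  by have [_ [-> _] _] := fact k.
have sb k : \sum_j b k 0 j = 0.
  elim: k => [|k IH]; first by rewrite big1.
  by have [_ [_ ->] _] := fact k.
pose v (h : 'I_n + 'I_m) : R :=
  match h with inl i => n%:R^-1 - p i | inr j => m%:R^-1 - q j end.
pose z k (h : 'I_n + 'I_m) : R :=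
  match h with inl i => a k 0 i | inr j => b k 0 j end.
pose r k := Num.sqrt (\sum_i a k 0 i ^+ 2 + \sum_j b k 0 j ^+ 2).
pose kap2 := mu - n%:R^-1 - m%:R^-1.
pose kap := Num.sqrt kap2.
have v2 : \sum_h v h ^+ 2 = kap2.
  have e d (w : nat -> R) : (0 < d)%N -> \sum_(i < d) w i = 1 ->
      \sum_(i < d) (d%:R^-1 - w i) ^+ 2 = \sum_(i < d) w i ^+ 2 - d%:R^-1.
    move=> d0 w1; have dn0 : d%:R != 0 :> R by rewrite pnatr_eq0 -lt0n.
    rewrite (eq_bigr (fun i : 'I_d => d%:R^-1 ^+ 2 - 2 * d%:R^-1 * w i + w i ^+ 2)); last first.
      by move=> i _; ring.
    rewrite big_split sumrB /= -[X in _ - X + _]mulr_sumr w1 sumr_const card_ord -mulr_natr.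
    by field.
  rewrite big_sumType /= !e ?sum_p ?sum_q // /kap2 -sum_pq2.
  by rewrite addrACA addrA.
have kap20 : 0 <= kap2 by rewrite -v2 sumr_ge0 // => *; exact: sqr_ge0.
have kapE : kap ^+ 2 = kap2 by rewrite sqr_sqrtr.
pose gn k := Num.sqrt (gradn K A (xs k) (ys k)).
have gk k : kap2 <= gradn K A (xs k) (ys k) by exact: gradn_low (xp k) (yp k) (T0 k).
have gn2 k : gn k ^+ 2 = gradn K A (xs k) (ys k).
  by rewrite sqr_sqrtr // (le_trans kap20 (gk k)).
have zr k : \sum_h z k h ^+ 2 = r k ^+ 2.
  by rewrite big_sumType sqr_sqrtr // addr_ge0 // sumr_ge0 // => *; exact: sqr_ge0.
have lower k : c - \sum_h v h * z k h <= ln (T k).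
  have [_] := cP _ _ _ _ (Uu k) (Vu k) (a_nd k) (b_ni k); apply: le_trans.
  rewrite big_sumType /= (eq_bigr (fun i => n%:R^-1 * a k 0 i - p i * a k 0 i)); last first.
    by move=> i _; rewrite mulrBl.
  rewrite [X in _ - (_ + X)](eq_bigr (fun j => m%:R^-1 * b k 0 j - q j * b k 0 j)); last first.
    by move=> j _; rewrite mulrBl.
  by rewrite !sumrB -!mulr_sumr sa sb !mulr0 !sub0r -opprD opprK addrA.
have descent k : 2^-1 * gn k.+1 ^+ 2 <= ln (T k) - ln (T k.+1).
  by rewrite gn2; have [] := fact k.
have g_low k : kap <= gn k by rewrite ler_sqrt ?gk // (le_trans kap20 (gk k)).
have r0 : r 0%N = 0.
  rewrite /r !big1 ?addr0 ?sqrtr0 // => i _; by rewrite ?a0 ?b0 expr0n.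
have r_step k : r k.+1 <= r k + 2^-1 * gn k by have [] := fact k.
have [g g0 gP] := chain_gap.
have g16 : 0 < g / 16 by rewrite divr_gt0.
have [M MP] := @asymptotic_direction R _ z v (fun k => ln (T k)) gn r c kap (sqrtr_ge0 _)
  (etrans v2 (esym kapE)) (fun k => sqrtr_ge0 _) zr lower descent g_low r0 r_step _ g16.
have up k := value_upper (f := fun k => ln (T k)) (sqrtr_ge0 _) descent g_low k.
rewrite kapE in up.
have [M' M'P] : exists M : nat, 8 * `|ln (T 0%N)| / g < M%:R.
  by have := archi_boundP (_ : 0 <= 8 * `|ln (T 0%N)| / g); eexists; apply: H;
     rewrite divr_ge0 ?mulr_ge0 // ltW.
exists (g / 4), (maxn M M').+1; split=> // [|k l i j Mk ij]; first by rewrite divr_gt0.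
apply: le_trans (entry_bound l i j (T0 k)) _; rewrite ler_expR -/(T k).
have Mk1 : (M <= k)%N by rewrite (leq_trans (leq_maxl M M')) // ltnW.
have Mk2 : (M' <= k)%N by rewrite (leq_trans (leq_maxr M M')) // ltnW.
have := MP k Mk1 (inl i); have := MP k Mk1 (inr j); rewrite /= !ler_norml.
move=> /andP[hb _] /andP[ha _].
have := gP i j ij => gij.
have k0 : 0 <= k%:R :> R by [].
have kg : k%:R / 2 * g <= k%:R / 2 * (mu - p i - q j) by rewrite ler_wpM2l // divr_ge0.
have hM : 8 * `|ln (T 0%N)| <= k%:R * g.
  rewrite -ler_pdivrMr //; apply: le_trans (ltW M'P) _; by rewrite ler_nat.
have hT := ler_norm (ln (T 0%N)).
have := up k; rewrite /kap2.
move: hb ha kg hM hT; move: (ln (T k)) (ln _) `|_| (n%:R^-1) (m%:R^-1) => *; lra.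
Qed.
End Iteration.
End ChainMasses.

Lemma pencil_conj (C : numClosedFieldType) n m (U : 'M[C]_n) (V : 'M[C]_m) (A0 A1 : 'M[C]_(n, m)) :
  'X *: map_mx polyC (U *m A0 *m V) + map_mx polyC (U *m A1 *m V) =
  map_mx polyC U *m ('X *: map_mx polyC A0 + map_mx polyC A1) *m map_mx polyC V.
Proof.
by rewrite !map_mxM mulmxDr mulmxDl -scalemxAr -scalemxAl.
Qed.

Lemma cluster_decay (R : realType) (T : topologicalType) (h : T -> R) (D : nat -> T)
    (B c : R) (M : nat) (z : T) :
  {for z, continuous h} -> 0 < c ->
  (forall k, (M <= k)%N -> h (D k) <= B * expR (- (c * k%:R))) ->
  cluster (D @ \oo) z -> h z <= 0.
Proof.
move=> hc c0 hD Dz; rewrite leNgt; apply/negP => hz.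
have hz2 : 0 < h z / 2 by rewrite divr_gt0.
have near_z : nbhs z [set w | h z / 2 < h w].
  by apply: (cvgr_gt _ hc); rewrite ltr_pdivrMr // ltr_pMr // ltrDl.
have [M' M'P] : exists M' : nat, 2 * `|B| / (c * h z) < M'%:R.
  by have := archi_boundP (_ : 0 <= 2 * `|B| / (c * h z)); eexists; apply: H;
     rewrite divr_ge0 ?mulr_ge0 // ltW.
pose S := [set D k | k in [set k | (maxn M M' <= k)%N]].
have SD : (D @ \oo) S by exists (maxn M M') => // k kM; exists k.
have [_ [[k /= kM <-] /= hk]] := Dz _ _ SD near_z.
have := hD k (leq_trans (leq_maxl _ _) kM).
have kM' : M'%:R <= k%:R :> R by rewrite ler_nat (leq_trans (leq_maxr _ _) kM).
move=> hk'; have := lt_le_trans hk hk'.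
apply/negP; rewrite -leNgt expRN ler_pdivrMr ?expR_gt0 //.
have e1 : c * k%:R <= expR (c * k%:R).
  by apply: le_trans (expR_ge1Dx _); rewrite lerDr.
apply: le_trans (ler_norm B) _; apply: le_trans (ler_wpM2l (ltW hz2) e1).
have : 2 * `|B| / (c * h z) <= k%:R := ltW (lt_le_trans M'P kM').
rewrite ler_pdivrMr ?mulr_gt0 //; lra.
Qed.

Section Accumulation.
Variables (R : realType) (C : numClosedFieldType) (K : cplxOver R C).
Variables (n m : nat) (A : 'I_2 -> 'M[C]_(n, m)) (c : R) (M : nat).
Variables (U : nat -> 'M[C]_n) (V : nat -> 'M[C]_m).
Hypotheses (Uu : forall k, U k \is unitarymx) (Vu : forall k, V k \is unitarymx).
Let D k l := U k *m A l *m (V k)^t*.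
Hypothesis c0 : 0 < c.

Lemma accum_isotropic (Z : 'M[C]_(n, m) * 'M[C]_(n, m)) :
  cluster ((fun k => (D k ord0, D k ord_max)) @ \oo) Z ->
  exists (U' : 'M[C]_n) (V' : 'M[C]_m), [/\ U' \in unitmx, V' \in unitmx,
    Z = (U' *m A ord0 *m V'^t*, U' *m A ord_max *m V'^t* ) &
    forall d e, (forall k l i j, (M <= k)%N -> among_last d i -> among_first e j ->
        sqn K (D k l i j) <= expR (- (c * k%:R))) ->
      gisotropic A <<glast_rows U' d>> <<gfirst_rows V' e>>].
Proof.
move=> DZ; have [_ /(_ Z DZ)[[U' V'] [/= Uu' Vu'] ZE]] := mxorbit_cluster K A Uu Vu.
exists U', V'; split; rewrite ?unitarymx_unit // => d e De.
apply: corner0_isotropic => l i j id je.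
have cz : corner K d e Z <= 0.
  have bnd k : (M <= k)%N -> corner K d e (D k ord0, D k ord_max) <=
      (\sum_(i < n) \sum_(j < m) 2) * expR (- (c * k%:R)).
    move=> Mk; rewrite mulr_suml; apply: ler_sum => i' _.
    rewrite mulr_suml; apply: ler_sum => j' _.
    case: (boolP (_ && _)) => [/andP[id' je']|_]; last first.
      by rewrite mul0r mulr_ge0 ?expR_ge0.
    by rewrite mul1r mulr_natl mulr2n lerD // De.
  exact: cluster_decay (@corner_continuous _ _ K _ _ d e Z) c0 bnd DZ.
have c_0 : corner K d e Z = 0 by apply: le_anti; rewrite cz corner_ge0.
have [] := corner_eq0 c_0 id je; rewrite -ZE /= => e1 e2.
case: l => -[|[|//]] lt2; [rewrite -[RHS]e1 | rewrite -[RHS]e2];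
  congr (fun_of_matrix (_ *m A _ *m _) _ _); exact: val_inj.
Qed.

End Accumulation.

HB.instance Definition _ (R : realType) := GRing.RMorphism.copy (@toC R) (real_complex R).

Section Specialization.
Variable R : realType.

Lemma Cplx_reD (z w : Cplx R) : complex.Re (z + w) = complex.Re z + complex.Re w.
Proof. exact: (raddfD (@complex.Re R)). Qed.

Lemma Cplx_re_toCM (t : R) (z : Cplx R) : complex.Re (toC t * z) = t * complex.Re z.
Proof. by case: z => z1 z2 /=; rewrite mul0r subr0. Qed.

Lemma Cplx_re1 : complex.Re (1 : Cplx R) = 1.
Proof. by []. Qed.

Lemma Cplx_re_conj (z : Cplx R) : complex.Re (z^* ) = complex.Re z.
Proof. by case: z. Qed.

Lemma Cplx_toC_re (z : Cplx R) : z \is Num.real -> z = toC (complex.Re z).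
Proof. by move=> /RRe_real zr; exact: esym zr. Qed.

Lemma Cplx_toC_le (a b : R) : (toC a <= toC b) = (a <= b).
Proof. exact: lecR. Qed.

Definition Cplx_over : cplxOver R (Cplx R) :=
  @CplxOver R (Cplx R) (@toC R) (@complex.Re R) Cplx_reD Cplx_re_toCM Cplx_re1
    Cplx_re_conj Cplx_toC_re Cplx_toC_le.

Variables (n m : nat) (A : 'I_2 -> 'M[Cplx R]_(n, m)).

Lemma grad_descentS (L : R) k : grad_descent A L k.+1 =
  gstep Cplx_over A (grad_descent A L k).1 (grad_descent A L k).2 L.
Proof. by []. Qed.

Lemma mxexp_rdiag p (a : 'rV[R]_p) :
  mxexp (diag_mx (map_mx (@toC R) a)) = rdiag Cplx_over (rexp a).
Proof.
have := @mxexpE R (Cplx R) Cplx_over p 1%:M a.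
rewrite !ctrmx1 !mul1mx !mulmx1; apply.
by apply/unitarymxP; rewrite ctrmx1 mulmx1.
Qed.

Lemma pts_isotropic : @pts R (giso_dims A) = @dim_pair R n m @` isotropic_pairs A.
Proof.
apply/seteqP; split=> [z [d [e [[X [Y [iso <- <-]]] ->]]]|z [[X Y] iso <-]].
  by exists (X, Y).
by exists (\dim X), (\dim Y); split=> //; exists X, Y.
Qed.
End Specialization.

Theorem theorem4p33 (R : realType) (n m : nat) (hn : (0 < n)%N) (hm : (0 < m)%N)
    (A : 'I_2 -> 'M[Cplx R]_(n, m))
    (hkerA : forall v : 'cV[Cplx R]_m, (forall l, A l *m v = 0) -> v = 0)
    (hkerAd : forall u : 'cV[Cplx R]_n, (forall l, (A l)^t* *m u = 0) -> u = 0)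
    (theta : nat)
    (X : nat -> {vspace 'rV[Cplx R]_n}) (Y : nat -> {vspace 'rV[Cplx R]_m})
    (hXY : chain_arrangement A theta X Y)
    (sigma : nat -> 'M[Cplx R]_n) (tau : nat -> 'M[Cplx R]_m)
    (a : nat -> 'rV[R]_n) (b : nat -> 'rV[R]_m)
    (hsigma : forall k, sigma k \is unitarymx)
    (htau : forall k, tau k \is unitarymx)
    (ha : forall k (i j : 'I_n), (i <= j)%N -> a k 0 i <= a k 0 j)
    (hb : forall k (i j : 'I_m), (i <= j)%N -> b k 0 j <= b k 0 i)
    (hx : forall k, (grad_descent A 2 k).1 =
      (sigma k)^t* *m mxexp (diag_mx (map_mx (@toC R) (a k))) *m sigma k)
    (hy : forall k, (grad_descent A 2 k).2 =
      (tau k)^t* *m mxexp (diag_mx (map_mx (@toC R) (b k))) *m tau k) :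
  let D (k : nat) (l : 'I_2) := sigma k *m A l *m (tau k)^t* in
  let accum := cluster ((fun k => (D k ord0, D k ord_max)) @ \oo) in
  [/\ accum !=set0,
      forall B : 'I_2 -> 'M[Cplx R]_(n, m),
        accum (B ord0, B ord_max) -> coarse_KTF A theta X Y (pencil B) &
      exists (c : R) (M : nat), [/\ 0 < c, (0 < M)%N &
        forall (k : nat) (l : 'I_2) (p q : nat) (i : 'I_n) (j : 'I_m),
          (M <= k)%N -> (0 < q)%N -> (q < p)%N -> (p <= theta)%N ->
          i \in row_block X p -> j \in col_block Y q ->
          `|D k l i j| <= toC (expR (- (c * k%:R)))]].
Proof.
move=> D accum; case: hXY => hE [X0 Xt] [Y0 Yt] Xd Yi.
pose K := Cplx_over R.
have ext e : (e <= theta)%N -> extreme_pairs A (X e, Y e) by move=> et; rewrite hE; exists e.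
have XYiso e : (e <= theta)%N -> gisotropic A (X e) (Y e) by move=> /ext[].
have Pext e : (e <= theta)%N ->
    extreme_point (conv_hull (@pts R (giso_dims A))) (pt R (\dim (X e)) (\dim (Y e))).
  by move=> /ext[_ _]; rewrite pts_isotropic.
have Pcpl d e : giso_dims A d e -> pt R d e <> (0, 0) ->
    extreme_point (conv_hull (@pts R (giso_dims A))) (pt R d e) ->
    exists2 f, (f <= theta)%N & d = \dim (X f) /\ e = \dim (Y f).
  move=> [X' [Y' [iso <- <-]]]; rewrite pts_isotropic => nz ex.
  have : extreme_pairs A (X', Y') by split.
  by rewrite hE => -[f /= ft [<- <-]]; exists f.
have xE k : (grad_descent A 2 k).1 = (sigma k)^t* *m rdiag K (rexp (a k)) *m sigma k.
  by rewrite hx mxexp_rdiag.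
have yE k : (grad_descent A 2 k).2 = (tau k)^t* *m rdiag K (rexp (b k)) *m tau k.
  by rewrite hy mxexp_rdiag.
have stepE k : gstep K A ((sigma k)^t* *m rdiag K (rexp (a k)) *m sigma k)
    ((tau k)^t* *m rdiag K (rexp (b k)) *m tau k) 2 =
    ((sigma k.+1)^t* *m rdiag K (rexp (a k.+1)) *m sigma k.+1,
     (tau k.+1)^t* *m rdiag K (rexp (b k.+1)) *m tau k.+1).
  by rewrite -xE -yE -grad_descentS -xE -yE -surjective_pairing.
have [c [M [c0 M0 decay]]] := corner_decay hn hm XYiso Pext Pcpl X0 Xt Y0 Yt Xd Yi
  hsigma htau ha hb (esym (xE 0%N)) (esym (yE 0%N)) stepE.
pose x e : nat := \dim (X e); pose y e : nat := \dim (Y e).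
have x0 : x 0%N = n := chain_x0 X0; have xt : x theta = 0%N := chain_xt Xt.
have y0 : y 0%N = 0%N := chain_y0 Y0; have yt : y theta = m := chain_yt Yt.
have xd : forall e, (e < theta)%N -> (x e.+1 < x e)%N := chain_x_decr Xd.
have yi : forall e, (e < theta)%N -> (y e < y e.+1)%N := chain_y_incr Yi.
have cross e f (i : 'I_n) (j : 'I_m) : (f <= e)%N -> (e <= theta)%N ->
    among_last (x e) i -> among_first (y f) j ->
    (blk y theta j < blk (cox n x) theta i)%N.
  move=> fe et ie jf; apply: (@leq_trans f).
    by rewrite (blk_lt_u y0 yt yi) // (leq_trans fe).
  apply: leq_trans fe _; rewrite leqNgt.
  rewrite (blk_lt_u (cox0 x0) (coxt n xt) (cox_incr hn x0 xt y0 yt xd)) //.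
  by rewrite -leqNgt.
have x_anti e f : (e < f)%N -> (f <= theta)%N -> (x f < x e)%N.
  move=> ef ft; apply: leq_ltn_trans (x_mono xd ef ft) (xd _ _).
  exact: leq_trans ef ft.
split.
- by have [] := mxorbit_cluster K A hsigma htau.
- move=> B /(@accum_isotropic _ _ K _ _ A c M _ _ hsigma htau c0)[U [V [Uu Vu [B0 B1] iso]]].
  have spans e : (e <= theta)%N ->
      X e = <<glast_rows U (x e)>>%VS /\ Y e = <<gfirst_rows V (y e)>>%VS.
    move=> et; set X' := <<_>>%VS; set Y' := <<_>>%VS.
    have [_ nz ex] := ext e et.
    have dX' : \dim X' = x e by rewrite dim_last ?dim_rV_le.
    have dY' : \dim Y' = y e by rewrite dim_first ?dim_rV_le.
    have : extreme_pairs A (X', Y').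
      have dE : dim_pair (X', Y') = dim_pair (X e, Y e).
        by rewrite /dim_pair /= dX' dY'.
      split; rewrite ?dE //; apply: iso => k l i j Mk ie je.
      exact: decay Mk (cross e e i j (leqnn e) et ie je).
    rewrite hE => -[f /= ft [Xf Yf]].
    have xfe : x f = x e by rewrite /x Xf.
    suff -> : e = f by [].
    by have [ef|fe|] := ltngtP e f => //; [have := x_anti _ _ ef ft | have := x_anti _ _ fe et];
      rewrite xfe ltnn.
  exists U, V; split=> // [e et|e et|].
  + have [Xe _] := spans e et; rewrite /basis_of (free_rows _ Uu) andbT.
    by rewrite [X in _ == X]Xe.
  + have [_ Ye] := spans e et; rewrite /basis_of (free_rows _ Vu) andbT.
    by rewrite [X in _ == X]Ye.
  by rewrite /pencil B0 B1 pencil_conj.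
exists (c / 2), M; split=> //; first by rewrite divr_gt0.
move=> k l p q i j Mk q0 qp pt_ /[!inE] /andP[ip _] /andP[jq _].
have qp' : (q <= p.-1)%N by case: p qp {pt_ ip}.
have pt' : (p.-1 <= theta)%N := leq_trans (leq_pred p) pt_.
have := decay k l i j Mk (cross p.-1 q i j qp' pt' ip jq).
rewrite (norm_sqn K) => h; apply: (etrans (toC_le K _ _)).
apply: le_trans (ler_wsqrtr h) _.
have -> : - (c * k%:R) = 2%:R * - (c / 2 * k%:R) by field.
by rewrite expRM_natl sqrtr_sqr ger0_norm ?expR_ge0.
Qed.
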